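(* Let $\mu\colon Z^1(M)\to B^1(M)$ be any homomorphism and $c\geq0$. (1) $d_{(\mu,c)}$ is positive (i.e. takes non-negative values) and satisfies the triangle inequality $d_{(\mu,c)}(\varphi_1,\varphi_3)\leq d_{(\mu,c)}(\varphi_1,\varphi_2)+d_{(\mu,c)}(\varphi_2,\varphi_3)$ for all $\varphi_1,\varphi_2,\varphi_3\in\mathrm{Symp}_0(M,\omega)$, so that $d^s_{(\mu,c)}$ is a pseudo-distance on $\mathrm{Symp}_0(M,\omega)$. (2) $d_{(\mu,c)}$ is left-invariant (i.e. $d_{(\mu,c)}(\theta\phi,\theta\psi)=d_{(\mu,c)}(\phi,\psi)$ for all $\theta,\phi,\psi\in\mathrm{Symp}_0(M,\omega)$) but not right-invariant in general (i.e. right-invariance fails for some choices of the data). (3) If $c=0$ and $\mu$ satisfies $n^B(\mu(\alpha))=n^B(\mu(\phi^*\alpha))$ for all $\alpha\in Z^1(M)$ and all $\phi\in\mathrm{Symp}_0(M,\omega)$, then $d_{(\mu,0)}$ is symmetric (and $d_{(\mu,0)}=d^s_{(\mu,0)}$).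
   Context: $(M,\omega)$ is a closed symplectic manifold; $Z^1(M)$ and $B^1(M)$ are the real vector spaces of closed and exact smooth $1$-forms on $M$. Fix a norm $n^B$ on $B^1(M)$ and a Riemannian metric $g$ on $M$; $\|\cdot\|_{L^2}$ is the $L^2$-norm on $1$-forms induced by $g$. For a homomorphism (linear map) $\mu\colon Z^1(M)\to B^1(M)$ and a real number $c\geq0$, set $n_{(\mu,c)}(\alpha)=n^B(\mu(\alpha))+c\|\alpha-\mu(\alpha)\|_{L^2}$ for $\alpha\in Z^1(M)$. $\mathrm{Symp}_0(M,\omega)$ is the identity component of the group of symplectomorphisms. A (smooth) path $\Psi=\{\psi_t\}_{t\in[0,1]}$ of symplectomorphisms with $\psi_0=\mathrm{id}$ corresponds to the path $\alpha(\Psi)=\{\alpha(\Psi)_t\}_{t\in[0,1]}$ in $Z^1(M)$ given by $\alpha(\Psi)_t=\omega(X_t^\Psi,\cdot)$, where $\partial_t\psi_t=X_t^\Psi(\psi_t)$. The length of $\Psi$ is $\ell_{(\mu,c)}(\Psi)=\int_0^1 n_{(\mu,c)}(\alpha(\Psi)_t)\,dt$. For $\phi,\psi\in\mathrm{Symp}_0(M,\omega)$, $d_{(\mu,c)}(\mathrm{id},\phi)$ is the infimum of $\ell_{(\mu,c)}(\Phi)$ over all paths $\Phi$ of symplectomorphisms from $\mathrm{id}$ to $\phi$, $d_{(\mu,c)}(\phi,\psi)=d_{(\mu,c)}(\mathrm{id},\phi^{-1}\psi)$, and $d^s_{(\mu,c)}(\phi,\psi)=\frac12\big(d_{(\mu,c)}(\phi,\psi)+d_{(\mu,c)}(\psi,\phi)\big)$.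 *)

(* Defs.v *)
From mathcomp Require Export all_boot all_order all_algebra.
From mathcomp Require Export all_classical all_reals all_analysis.

Set Implicit Arguments.
Unset Strict Implicit.
Unset Printing Implicit Defensive.

Export Order.TTheory GRing.Theory Num.Theory.
Export numFieldNormedType.Exports.

Local Open Scope classical_set_scope.
Local Open Scope ring_scope.

(** * Smooth functions on open subsets of finite-dimensional normed spaces *)

Section Smooth.
Context {R : realType}.

(* Only used with U open and E finite-dimensional, where this is C^k. *)
Fixpoint Ck (E : normedModType R) (k : nat) (U : set E) (f : E -> R) : Prop :=
  (forall x, U x -> {for x, continuous f}) /\
  (if k is k'.+1 then
     forall v : E, (forall x, U x -> derivable (f : E -> R^o) x v) /\
                   Ck k' U ('D_v (f : E -> R^o))
   else True).

Definition smooth_on (E : normedModType R) (U : set E) (f : E -> R) : Prop :=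
  forall k, Ck k U f.

Definition partial (n : nat) (i : 'I_n) (f : 'rV[R]_n -> R) : 'rV[R]_n -> R :=
  'D_(delta_mx 0 i : 'rV[R]_n) (f : 'rV[R]_n -> R^o).

(* The Lebesgue integral over R^n of a nonnegative function, iterated. *)
Fixpoint lebesgue_rV (n : nat) : ('rV[R]_n -> \bar R) -> \bar R :=
  match n return ('rV[R]_n -> \bar R) -> \bar R with
  | 0 => fun f => f 0
  | n'.+1 => fun f => (\int[@lebesgue_measure R]_(x in [set: R])
               lebesgue_rV (fun y : 'rV[R]_n' =>
                 f (row_mx (x%:M : 'rV[R]_1) y : 'rV[R]_(1 + n'))))%E
  end.

End Smooth.

(** * Closed manifolds *)

Record chart (R : realType) (n : nat) (M : topologicalType) := Chart {
  cdom : set M;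
  cmap : M -> 'rV[R]_n;
  cinv : 'rV[R]_n -> M }.

Definition cimg (R : realType) n (M : topologicalType) (c : chart R n M) :=
  cmap c @` cdom c.

Definition is_chart (R : realType) n (M : topologicalType) (c : chart R n M) :=
  [/\ open (cdom c), open (cimg c),
      forall p, cdom c p -> cinv c (cmap c p) = p,
      forall p, cdom c p -> {for p, continuous (cmap c)}
    & forall y, cimg c y -> {for y, continuous (cinv c)}].

(* A smooth structure is presented by one of its atlases; by compactness the
   atlas may be taken finite.  Second countability follows from compactness. *)
Record closedManifold (R : realType) (n : nat) := ClosedManifold {
  carrier :> topologicalType;
  natlas : nat;
  atlas : 'I_natlas -> chart R n carrier;
  carrier_hausdorff : hausdorff_space carrier;
  carrier_compact : compact [set: carrier];
  atlas_chart : forall i, is_chart (atlas i);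
  atlas_cover : forall p : carrier, exists i, cdom (atlas i) p;
  atlas_compat : forall i j (k : 'I_n),
    smooth_on (cmap (atlas i) @` (cdom (atlas i) `&` cdom (atlas j)))
              (fun y => cmap (atlas j) (cinv (atlas i) y) 0 k) }.

Arguments atlas {R n} c _.

Section Manifold.
Context {R : realType} {n : nat} {M : closedManifold R n}.

Definition smooth_fun (f : M -> R) : Prop :=
  forall i, smooth_on (cimg (atlas M i)) (f \o cinv (atlas M i)).

Definition smooth_map (phi : M -> M) : Prop :=
  continuous phi /\
  forall i j (k : 'I_n),
    smooth_on [set y | cimg (atlas M i) y /\
                       cdom (atlas M j) (phi (cinv (atlas M i) y))]
              (fun y => cmap (atlas M j) (phi (cinv (atlas M i) y)) 0 k).

(* (t, p) |-> psi t p is smooth on I x M, for I an open interval. *)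
Definition smooth_family (I : set R) (psi : R -> M -> M) : Prop :=
  (forall t p, I t ->
     {for (t, p), continuous (fun tp : R * M => psi tp.1 tp.2)}) /\
  forall i j (k : 'I_n),
    smooth_on [set ty : R^o * 'rV[R]_n |
                 [/\ I ty.1, cimg (atlas M i) ty.2
                   & cdom (atlas M j) (psi ty.1 (cinv (atlas M i) ty.2))]]
      (fun ty : R^o * 'rV[R]_n =>
         cmap (atlas M j) (psi ty.1 (cinv (atlas M i) ty.2)) 0 k).

(* The inverse map, when phi is bijective. *)
Definition minv (phi : M -> M) (p : M) : M := xget p [set q | phi q = p].

(** ** Tangent vectors

   A tangent vector at p is a derivation at p of the algebra of smooth
   functions.  It is encoded as a functional on all functions M -> R which is
   set to 0 on the non-smooth ones, so that equality of functionals is equality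
   of derivations. *)

Definition tvec : Type := (M -> R) -> R.

Definition smooth_part (v : tvec) : tvec :=
  fun f => if `[< smooth_fun f >] then v f else 0.

Definition tangent (p : M) (v : tvec) : Prop :=
  [/\ forall (a : R) (f h : M -> R), smooth_fun f -> smooth_fun h ->
        v (fun x => a * f x + h x) = a * v f + v h,
      forall f h : M -> R, smooth_fun f -> smooth_fun h ->
        v (fun x => f x * h x) = f p * v h + h p * v f
    & forall f, ~ smooth_fun f -> v f = 0].

(* The vector d/dx_k, in the coordinates of the i-th chart, at the point of
   coordinates y. *)
Definition coordvec i (k : 'I_n) (y : 'rV[R]_n) : tvec :=
  smooth_part (fun f => partial k (f \o cinv (atlas M i)) y).

Definition tmap (phi : M -> M) (v : tvec) : tvec :=
  smooth_part (fun f => v (f \o phi)).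

(** ** Differential forms

   A 1-form is encoded as a function of a point and a functional, set to 0 when
   the functional is not tangent at the point, so that equality of functions is
   equality of 1-forms. *)

Definition form1 : Type := M -> tvec -> R.

Definition tangent_part (alpha : form1) : form1 :=
  fun p v => if `[< tangent p v >] then alpha p v else 0.

Definition coef1 (alpha : form1) i (k : 'I_n) (y : 'rV[R]_n) : R :=
  alpha (cinv (atlas M i) y) (coordvec i k y).

Definition is_form1 (alpha : form1) : Prop :=
  [/\ forall p (a : R) v w, tangent p v -> tangent p w ->
        alpha p (fun f => a * v f + w f) = a * alpha p v + alpha p w,
      forall p v, ~ tangent p v -> alpha p v = 0
    & forall i k, smooth_on (cimg (atlas M i)) (coef1 alpha i k)].

Definition dfun (f : M -> R) : form1 := tangent_part (fun _ v => v f).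

Definition closed_forms : set form1 := [set alpha | is_form1 alpha /\
  forall i (j k : 'I_n) y, cimg (atlas M i) y ->
    partial j (coef1 alpha i k) y = partial k (coef1 alpha i j) y].

Definition exact_forms : set form1 :=
  [set alpha | exists2 f, smooth_fun f & alpha = dfun f].

Definition pullback (phi : M -> M) (alpha : form1) : form1 :=
  tangent_part (fun p v => alpha (phi p) (tmap phi v)).

Definition tensor2 : Type := M -> tvec -> tvec -> R.

Definition coef2 (b : tensor2) i (j k : 'I_n) (y : 'rV[R]_n) : R :=
  b (cinv (atlas M i) y) (coordvec i j y) (coordvec i k y).

Definition is_tensor2 (b : tensor2) : Prop :=
  [/\ forall p (a : R) u v w, tangent p u -> tangent p v -> tangent p w ->
        b p (fun f => a * u f + v f) w = a * b p u w + b p v w,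
      forall p (a : R) u v w, tangent p u -> tangent p v -> tangent p w ->
        b p w (fun f => a * u f + v f) = a * b p w u + b p w v
    & forall i j k, smooth_on (cimg (atlas M i)) (coef2 b i j k)].

Definition symplectic_form (omega : tensor2) : Prop :=
  [/\ is_tensor2 omega,
      forall p v, tangent p v -> omega p v v = 0,
      forall p v, tangent p v ->
        (forall w, tangent p w -> omega p v w = 0) -> v = (fun=> 0)
    & forall i (j k l : 'I_n) y, cimg (atlas M i) y ->
        partial j (coef2 omega i k l) y + partial k (coef2 omega i l j) y +
        partial l (coef2 omega i j k) y = 0].

Definition riemannian_metric (g : tensor2) : Prop :=
  [/\ is_tensor2 g,
      forall p v w, tangent p v -> tangent p w -> g p v w = g p w v
    & forall p v, tangent p v -> v <> (fun=> 0) -> 0 < g p v v].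

(** ** The L^2-norm of 1-forms

   M is cut into the pieces dom(c_i) \ U_(j < i) dom(c_j); in the coordinates of
   c_i the integrand is |alpha|^2 dvol_g = g^(kl) alpha_k alpha_l sqrt(det g).
   The total is finite for every (smooth) 1-form alpha. *)

Definition gram (g : tensor2) i (y : 'rV[R]_n) : 'M[R]_n :=
  \matrix_(j, k) coef2 g i j k y.

Definition L2_density (g : tensor2) (alpha : form1) i (y : 'rV[R]_n) : R :=
  let a := \row_k coef1 alpha i k y in
  (a *m invmx (gram g i y) *m a^T) 0 0 * Num.sqrt (\det (gram g i y)).

Definition chart_piece i : set 'rV[R]_n :=
  [set y | cimg (atlas M i) y /\
     forall j : 'I_(natlas M), (j < i)%N ->
       ~ cdom (atlas M j) (cinv (atlas M i) y)].

Definition L2norm (g : tensor2) (alpha : form1) : R :=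
  Num.sqrt (fine (\sum_(i < natlas M)
    lebesgue_rV (fun y => (if `[< chart_piece i y >]
                           then L2_density g alpha i y else 0)%:E))%E).

(** ** Symplectomorphisms and their paths *)

Definition symplectomorphism (omega : tensor2) (phi : M -> M) : Prop :=
  [/\ bijective phi, smooth_map phi, smooth_map (minv phi)
    & forall p v w, tangent p v -> tangent p w ->
        omega (phi p) (tmap phi v) (tmap phi w) = omega p v w].

(* Only the values psi t for t in [0, 1] are relevant: smoothness on
   [0, 1] x M means being the restriction of a smooth map defined on a
   neighbourhood. *)
Definition symp_path (omega : tensor2) (psi : R -> M -> M) : Prop :=
  [/\ psi 0 = id,
      forall t : R, 0 <= t <= 1 -> symplectomorphism omega (psi t)
    & exists2 e : R, 0 < e & smooth_family `]- e, 1 + e[ psi].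

(* X_t, determined by d/dt psi_t = X_t(psi_t). *)
Definition velocity (psi : R -> M -> M) (t : R) (p : M) : tvec :=
  smooth_part (fun f =>
    derive1 (fun s : R => f (psi s (minv (psi t) p)) : R^o) t).

Definition path_form (omega : tensor2) (psi : R -> M -> M) (t : R) : form1 :=
  tangent_part (fun p v => omega p (velocity psi t p) v).

(* The component of the identity: the symplectomorphisms which are smoothly
   isotopic to the identity through symplectomorphisms. *)
Definition Symp0 (omega : tensor2) : set (M -> M) :=
  [set phi | exists2 psi, symp_path omega psi & psi 1 = phi].

(** ** The pseudo-distances *)

Definition norm_on (V : set form1) (nB : form1 -> R) : Prop :=
  [/\ forall a, V a -> 0 <= nB a,
      forall a, V a -> nB a = 0 -> a = (fun _ _ => 0),
      forall (l : R) a, V a -> nB (fun p v => l * a p v) = `|l| * nB a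
    & forall a b, V a -> V b -> nB (fun p v => a p v + b p v) <= nB a + nB b].

(* Only the values of mu on closed forms are relevant. *)
Definition closed_to_exact (mu : form1 -> form1) : Prop :=
  (forall a, closed_forms a -> exact_forms (mu a)) /\
  (forall (l : R) a b, closed_forms a -> closed_forms b ->
     mu (fun p v => l * a p v + b p v) = (fun p v => l * mu a p v + mu b p v)).

Definition nmu (g : tensor2) (nB : form1 -> R) (mu : form1 -> form1) (c : R)
    (alpha : form1) : R :=
  nB (mu alpha) + c * L2norm g (fun p v => alpha p v - mu alpha p v).

Section Distance.
Variables (omega g : tensor2) (nB : form1 -> R) (mu : form1 -> form1) (c : R).

(* Since nB and mu are arbitrary, t |-> nmu (alpha(Psi)_t) need be neither
   measurable nor bounded: lengths and distances live in [0, +oo]. *)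
Definition plength (psi : R -> M -> M) : \bar R :=
  (\int[@lebesgue_measure R]_(t in `[0%R, 1%R])
     (nmu g nB mu c (path_form omega psi t))%:E)%E.

Definition lengths_defined : Prop := forall psi, symp_path omega psi ->
  (@lebesgue_measure R).-integrable `[0, 1]
    (fun t => (nmu g nB mu c (path_form omega psi t))%:E).

Definition dist_id (phi : M -> M) : \bar R :=
  ereal_inf [set plength psi | psi in
               [set psi | symp_path omega psi /\ psi 1 = phi]].

Definition dist (phi psi : M -> M) : \bar R := dist_id (minv phi \o psi).

Definition sdist (phi psi : M -> M) : \bar R :=
  ((2^-1)%:E * (dist phi psi + dist psi phi))%E.

End Distance.

End Manifold.

Arguments tvec {R n} M.
Arguments form1 {R n} M.
Arguments tensor2 {R n} M.
Arguments closed_forms {R n} M.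
Arguments exact_forms {R n} M.

Definition pseudo_distance (R : realType) (T : Type) (S : set T)
    (d : T -> T -> \bar R) : Prop :=
  [/\ forall x y, S x -> S y -> (0 <= d x y)%E,
      forall x, S x -> d x x = 0%E,
      forall x y, S x -> S y -> d x y = d y x
    & forall x y z, S x -> S y -> S z -> (d x z <= d x y + d y z)%E].

Definition left_invariant (R : realType) (T : Type) (S : set (T -> T))
    (d : (T -> T) -> (T -> T) -> \bar R) : Prop :=
  forall h x y, S h -> S x -> S y -> d (h \o x) (h \o y) = d x y.

Definition right_invariant (R : realType) (T : Type) (S : set (T -> T))
    (d : (T -> T) -> (T -> T) -> \bar R) : Prop :=
  forall h x y, S h -> S x -> S y -> d (x \o h) (y \o h) = d x y.

(* Main.v *)
From HB Require Import structures.
Require Import Defs.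
From mathcomp Require Import ring lra measurable_realfun.

Set Implicit Arguments.
Unset Strict Implicit.
Unset Printing Implicit Defensive.

Local Open Scope classical_set_scope.
Local Open Scope ring_scope.

(** Everything is measured by the forms alpha(Psi)_t, and these behave well under
two operations on paths: translating a path on the right by a fixed map leaves
them unchanged, and running it at speed tau' multiplies them by tau'
([velocity_reparam]).

Left-invariance is built into the definition, since d(phi, psi) only depends on
phi^-1 psi.  For the triangle inequality, a path from id to b is followed by a
path from id to a, translated by b; both are first reparametrized by a smooth step
function which is constant near the junction, so that the concatenation is smooth
and has at most the sum of the two lengths ([plength_concat]).  A path from id to
phi run backwards and translated by phi^-1 goes from id to phi^-1 and is no longer
than the original ([plength_reverse]); hence d(id, phi) = d(id, phi^-1), and d is
symmetric.

Two points need care.  Because mu and the norm are arbitrary, the length element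
t |-> n(alpha(Psi)_t) need not be measurable, and its integral is the supremum of
the integrals of the simple functions below it.  The substitution rules used above
are therefore proved as inequalities for such lower integrals ([lower_change]): a
simple function is transported by the inverse change of variables, and becomes a
measurable function for which the ordinary substitution rule holds.  Moreover
n_(mu,c) is only homogeneous on closed forms, so one has to know that alpha(Psi)_t
is closed.  This is Cartan's formula d(i_X omega) = L_X omega - i_X d(omega) = 0
in a chart ([path_form_closed]).

Right-invariance fails on the torus T^2 = (R/2 pi Z)^2 with omega = dx /\ dy, c = 0,
mu(alpha) = d(alpha(d/dy)), and the norm which sends dF to the oscillation
max F - min F.  For alpha = alpha(Psi)_t the function alpha(d/dy) is the
x-component of the velocity field of Psi, so the length of Psi is the integral of
the oscillation of the x-speed.  The half turn phi = (x, y + pi) is reached by a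
path without any motion in x: d(id, phi) = 0.  With the shear
h = (x + (pi/4) sin y, y), the conjugate h^-1 phi h = (x + (pi/2) sin y, y + pi)
moves the points (0, pi/2) and (0, 0) by different amounts in x.  Along a path the
cosine of the difference of the x-coordinates of two points changes at most at the
rate of the oscillation of the x-speed ([xcos_le_plength]); between the identity
and the conjugate it goes from 1 to 0.  So d(h, phi h) = d(id, h^-1 phi h) >= 1.

Tangent vectors being derivations, the torus requires one more classical fact: a
derivation at a point is a combination of the coordinate vectors.  It follows from
Hadamard's lemma, in a version adapted to periodic functions ([tangent_trepl]),
and the smooth quotients which occur in it are averages of derivatives
([hadamard_div]). *)

(** * Calculus of C^k functions *)

Section CkBasics.
Context {R : realType} {E : normedModType R}.
Implicit Types (U V : set E) (f g : E -> R) (k : nat).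

Lemma Ck_cont k U f x : Ck k U f -> U x -> {for x, continuous f}.
Proof. by case: k => [|k] [+ _]; apply. Qed.

Lemma Ck_derivable k U f x v : Ck k.+1 U f -> U x ->
  derivable (f : E -> R^o) x v.
Proof. by move=> [_ /(_ v)[+ _]]; apply. Qed.

Lemma Ck_D k U f v : Ck k.+1 U f -> Ck k U ('D_v (f : E -> R^o)).
Proof. by move=> [_ /(_ v)[_ +]]. Qed.

Lemma CkS k U f : (forall x, U x -> {for x, continuous f}) ->
  (forall v x, U x -> derivable (f : E -> R^o) x v) ->
  (forall v, Ck k U ('D_v (f : E -> R^o))) -> Ck k.+1 U f.
Proof. by move=> fc fd fD; split => // v; split => // x /fd. Qed.

Lemma CkW k U f : Ck k.+1 U f -> Ck k U f.
Proof.
elim: k f => [|k ih] f fk; first by split=> // x; exact: Ck_cont fk.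
apply: CkS => [x|v x Ux|v]; [exact: Ck_cont fk|exact: Ck_derivable fk Ux|].
by apply: ih; exact: Ck_D.
Qed.

Lemma Ck_le k l U f : (l <= k)%N -> Ck k U f -> Ck l U f.
Proof.
move=> /subnK <-; elim: (k - l)%N => // m ih; rewrite addSn => /CkW.
exact: ih.
Qed.

(** Derivatives only see germs. *)
Lemma Ck_local k U f :
  (forall x, U x -> exists V g, [/\ open V, V x, Ck k V g &
     forall y, V y -> f y = g y]) -> Ck k U f.
Proof.
elim: k f => [|k ih] f loc.
  split=> // x /loc[V [g [oV Vx gk fg]]].
  have nfg : \near x, g x = f x.
    by near=> y; rewrite fg//; near: y; exact: open_nbhs_nbhs.
  rewrite /prop_for /continuous_at fg//.
  apply: cvg_trans (Ck_cont gk Vx).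
  exact: near_eq_cvg.
have nfg x V g : open V -> V x -> (forall y, V y -> f y = g y) ->
    \near x, g x = f x.
  move=> oV Vx fg; near=> y; rewrite fg//; near: y; exact: open_nbhs_nbhs.
apply: CkS.
- move=> x /loc[V [g [oV Vx gk fg]]].
  rewrite /prop_for /continuous_at fg//.
  apply: cvg_trans (Ck_cont gk Vx).
  by apply: near_eq_cvg; exact: nfg Vx fg.
- move=> v x /loc[V [g [oV Vx gk fg]]].
  apply: (near_eq_derivable (f := g : E -> R^o)); first exact: nfg Vx fg.
  exact: Ck_derivable gk Vx.
- move=> v; apply: ih => x /loc[V [g [oV Vx gk fg]]].
  exists V, ('D_v (g : E -> R^o)); split => //; first exact: Ck_D.
  move=> y Vy; apply: near_eq_derive.
  by near=> z; rewrite fg//; near: z; exact: open_nbhs_nbhs.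
Unshelve. all: by end_near. Qed.

Lemma Ck_ext k U f g : open U -> (forall x, U x -> f x = g x) ->
  Ck k U g -> Ck k U f.
Proof. by move=> oU fg gk; apply: Ck_local => x Ux; exists U, g; split. Qed.

Lemma Ck_sub k U V f : V `<=` U -> Ck k U f -> Ck k V f.
Proof.
move=> VU; elim: k f => [|k ih] f fk; first by split=> // x /VU; exact: Ck_cont fk.
apply: CkS => [x /VU|v x /VU Ux|v]; [exact: Ck_cont fk|exact: Ck_derivable fk Ux|].
by apply: ih; exact: Ck_D.
Qed.

Lemma Ck_cst k U (a : R) : Ck k U (fun=> a).
Proof.
elim: k a => [|k ih] a; first by split=> // x _; exact: cst_continuous.
apply: CkS => [x _|v x _|v]; [exact: cst_continuous|exact: derivable_cst|].
suff -> : 'D_v ((fun=> a) : E -> R^o) = fun=> 0 by exact: ih.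
by apply/funext => x; rewrite (derive_cst (a : R^o)).
Qed.

Lemma Ck_add k U f g : open U -> Ck k U f -> Ck k U g ->
  Ck k U (fun x => f x + g x).
Proof.
move=> oU; elim: k f g => [|k ih] f g fk gk.
  by split=> // x Ux; apply: cvgD; [exact: Ck_cont fk _|exact: Ck_cont gk _].
apply: CkS => [x Ux|v x Ux|v].
- by apply: cvgD; [exact: Ck_cont fk _|exact: Ck_cont gk _].
- by apply: (@derivableD _ _ _ (f : E -> R^o) g); [exact: Ck_derivable fk Ux|exact: Ck_derivable gk Ux].
apply: (Ck_ext (g := fun x => 'D_v (f : E -> R^o) x + 'D_v (g : E -> R^o) x)) => //.
  by move=> x Ux; apply: (@deriveD _ _ _ (f : E -> R^o) g);
   [exact: Ck_derivable fk Ux|exact: Ck_derivable gk Ux].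
by apply: ih; exact: Ck_D.
Qed.

Lemma Ck_mul k U f g : open U -> Ck k U f -> Ck k U g ->
  Ck k U (fun x => f x * g x).
Proof.
move=> oU; elim: k f g => [|k ih] f g fk gk.
  by split=> // x Ux; apply: cvgM; [exact: Ck_cont fk _|exact: Ck_cont gk _].
apply: CkS => [x Ux|v x Ux|v].
- by apply: cvgM; [exact: Ck_cont fk _|exact: Ck_cont gk _].
- by apply: (@derivableM _ _ f g); [exact: Ck_derivable fk Ux|exact: Ck_derivable gk Ux].
apply: (Ck_ext (g := fun x => f x * 'D_v (g : E -> R^o) x + g x * 'D_v (f : E -> R^o) x)) => //.
  by move=> x Ux; apply: (@deriveM _ _ f g);
   [exact: Ck_derivable fk Ux|exact: Ck_derivable gk Ux].
by apply: Ck_add => //; apply: ih; [exact: CkW|exact: Ck_D|exact: CkW|exact: Ck_D].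
Qed.

Lemma Ck_sum k U (I : Type) (r : seq I) (F : I -> E -> R) : open U ->
  (forall i, Ck k U (F i)) -> Ck k U (fun x => \sum_(i <- r) F i x).
Proof.
move=> oU Fk; elim: r => [|i r ih].
  by under eq_fun do rewrite big_nil; exact: Ck_cst.
by under eq_fun do rewrite big_cons; exact: Ck_add.
Qed.

Lemma Ck_opp k U f : open U -> Ck k U f -> Ck k U (fun x => - f x).
Proof.
move=> oU fk; under eq_fun do rewrite -mulN1r.
by apply: Ck_mul => //; exact: Ck_cst.
Qed.

Lemma Ck_inv k U f : open U -> (forall x, U x -> f x != 0) -> Ck k U f ->
  Ck k U (fun x => (f x)^-1).
Proof.
move=> oU f0; elim: k => [|k ih] fk.
  by split=> // x Ux; apply: cvgV; [exact: f0|exact: Ck_cont fk _].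
apply: CkS => [x Ux|v x Ux|v].
- by apply: cvgV; [exact: f0|exact: Ck_cont fk _].
- by apply: (@derivableV _ _ f); [exact: f0|exact: Ck_derivable fk Ux].
apply: (Ck_ext (g := fun x => - ((f x)^-1 * (f x)^-1) * 'D_v (f : E -> R^o) x)) => //.
  move=> x Ux; rewrite (@deriveV _ _ f); [|exact: f0|exact: Ck_derivable fk Ux].
  by rewrite -exprVn expr2 scaleNr mulNr.
have := ih (CkW fk) => ik.
by apply: Ck_mul; [|apply: Ck_opp => //; apply: Ck_mul|exact: Ck_D].
Qed.

Lemma is_derive_linear f x v : (forall a x y, f (a *: x + y) = a * f x + f y) ->
  is_derive x v (f : E -> R^o) (f v).
Proof.
move=> fl; have cv : h^-1 *: (f (h *: v + x) - f x) @[h --> (0:R)^'] --> f v.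
  apply: cvg_near_cst; near=> h; rewrite fl addrK scalerA.
  rewrite mulVf ?scale1r//; near: h; exact: nbhs_dnbhs_neq.
by apply: DeriveDef; [apply/cvg_ex; exists (f v : R^o)|apply: cvg_lim].
Unshelve. all: by end_near. Qed.

Lemma Ck_linear k U f : (forall a x y, f (a *: x + y) = a * f x + f y) ->
  continuous f -> Ck k U f.
Proof.
move=> fl fc; case: k => [|k]; first by split => // x _; exact: fc.
apply: CkS => [x _|v x _|v]; [exact: fc|by have [] := is_derive_linear x v fl|].
suff -> : 'D_v (f : E -> R^o) = fun=> f v by exact: Ck_cst.
by apply/funext => x; have [_] := is_derive_linear x v fl.
Qed.

End CkBasics.

Section PointwiseDerive.
Context {R : realType} {E : normedModType R}.

Lemma is_derive_mulp (f g : E -> R) (x v : E) (df dg : R) :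
  is_derive x v (f : E -> R^o) df -> is_derive x v (g : E -> R^o) dg ->
  is_derive x v (fun x => f x * g x : R^o) (f x * dg + g x * df).
Proof.
case=> f1 f1E; case=> g1 g1E; apply: DeriveDef; first exact: (@derivableM _ _ f g).
by have := @deriveM _ _ f g x v f1 g1; rewrite f1E g1E.
Qed.

Lemma is_derive_addp (f g : E -> R) (x v : E) (df dg : R) :
  is_derive x v (f : E -> R^o) df -> is_derive x v (g : E -> R^o) dg ->
  is_derive x v (fun x => f x + g x : R^o) (df + dg).
Proof.
move=> [f1 <-] [g1 <-]; apply: DeriveDef; first exact: (@derivableD _ _ _ (f : E -> R^o) g).
exact: (@deriveD _ _ _ (f : E -> R^o) g).
Qed.

Lemma is_derive_oppp (f : E -> R) (x v : E) (df : R) :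
  is_derive x v (f : E -> R^o) df -> is_derive x v (fun x => - f x : R^o) (- df).
Proof.
move=> [f1 <-]; apply: DeriveDef; first exact: (@derivableN _ _ _ (f : E -> R^o)).
exact: (@deriveN _ _ _ (f : E -> R^o)).
Qed.

Lemma is_derive_sump (I : Type) (r : seq I) (F : I -> E -> R) (x v : E) (dF : I -> R) :
  (forall i, is_derive x v (F i : E -> R^o) (dF i)) ->
  is_derive x v (fun x => \sum_(i <- r) F i x : R^o) (\sum_(i <- r) dF i).
Proof.
move=> dFi; elim: r => [|i r ih].
  by under eq_fun do rewrite big_nil; rewrite big_nil; exact: (is_derive_cst (0 : R^o)).
by under eq_fun do rewrite big_cons; rewrite big_cons; exact: is_derive_addp.
Qed.

Lemma Ck_is_derive k (U : set E) (f : E -> R) (x v : E) : Ck k.+1 U f -> U x ->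
  is_derive x v (f : E -> R^o) ('D_v (f : E -> R^o) x).
Proof. by move=> fk Ux; apply: DeriveDef => //; exact: Ck_derivable fk Ux. Qed.

Lemma near_derive (U : set E) (f g : E -> R) (x v : E) : open U -> U x ->
  (forall y, U y -> f y = g y) -> 'D_v (f : E -> R^o) x = 'D_v (g : E -> R^o) x.
Proof.
move=> oU Ux fg; apply: near_eq_derive.
by apply: filterS (open_nbhs_nbhs (conj oU Ux)) => y /fg.
Qed.

End PointwiseDerive.

(** Two uses: points of the covering with the same image on the torus, and reduction of
a directional derivative to a derivative in one variable. *)
Lemma derive_eq_line (R : realType) (E E' : normedModType R) (F : E -> R) (G : E' -> R)
    (z v : E) (z' v' : E') :
  (forall h, F (h *: v + z) = G (h *: v' + z')) ->
  'D_v (F : E -> R^o) z = 'D_v' (G : E' -> R^o) z'.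
Proof.
move=> FG; have e : F z = G z' by have := FG 0; rewrite !scale0r !add0r.
rewrite /derive (_ : (fun h : R => _) =
  (fun h : R => h^-1 *: (((G : E' -> R^o) \o shift z') (h *: v') - G z')))//.
by apply/funext => h /=; rewrite FG e.
Qed.

(** * Mean value theorem, chain rule and symmetry of second derivatives *)

Section ChainRule.
Context {R : realType}.

Lemma is_derive_line (E : normedModType R) (f : E -> R) (e x : E) (s : R) :
  derivable (f : E -> R^o) (s *: e + x) e ->
  is_derive s (1 : R) (fun s : R => f (s *: e + x) : R^o)
    ('D_e (f : E -> R^o) (s *: e + x)).
Proof.
pose q1 := fun h : R => h^-1 *: (f ((h *: (1 : R) + s) *: e + x) - f (s *: e + x) : R^o).
pose q2 := fun h : R => h^-1 *: (f (h *: e + (s *: e + x)) - f (s *: e + x) : R^o).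
have q12 : q1 = q2.
  by apply/funext => h; rewrite /q1 /q2 [_%:A]mulr1 scalerDl addrA.
move=> fd; apply: DeriveDef.
  by rewrite /derivable; change (cvg (q1 h @[h --> (0:R)^'])); rewrite q12.
by rewrite /derive; change (lim (q1 h @[h --> (0:R)^']) = lim (q2 h @[h --> (0:R)^'])); rewrite q12.
Qed.

Lemma MVT_line (E : normedModType R) (U : set E) (f : E -> R) (e x : E) (d : R) :
  Ck 1 U f -> (forall s, `|s| <= `|d| -> U (s *: e + x)) ->
  exists2 s, `|s| <= `|d| &
    f (d *: e + x) - f x = d * 'D_e (f : E -> R^o) (s *: e + x).
Proof.
move=> f1 Ux; pose phi := fun s : R => f (s *: e + x) : R^o.
have dphi s : `|s| <= `|d| ->
    is_derive s (1 : R) phi ('D_e (f : E -> R^o) (s *: e + x)).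
  by move=> sd; apply: is_derive_line; exact: Ck_derivable f1 (Ux _ sd).
have cphi s : `|s| <= `|d| -> {for s, continuous phi}.
  by move=> /dphi[ds _]; apply: differentiable_continuous; exact/derivable1_diffP.
have [d0|d0|->] := ltgtP d 0.
- have [s sd] := @MVT_segment R phi (fun s => 'D_e (f : E -> R^o) (s *: e + x)) d 0 (ltW d0)
    ltac:(move=> s; rewrite in_itv/= => /andP[ds s0]; apply: dphi; rewrite !ler0_norm; [lra|lra|lra])
    ltac:(apply: continuous_in_subspaceT => s; rewrite inE/= in_itv/= => /andP[ds s0]; apply: cphi; rewrite !ler0_norm; [lra|lra|lra]).
  move: sd; rewrite in_itv/= => /andP[ds s0] eq.
  exists s; first by rewrite !ler0_norm; lra.
  move: eq; rewrite /phi scale0r add0r sub0r => eq.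
  by rewrite -opprB eq mulrN opprK mulrC.
- have [s sd] := @MVT_segment R phi (fun s => 'D_e (f : E -> R^o) (s *: e + x)) 0 d (ltW d0)
    ltac:(move=> s; rewrite in_itv/= => /andP[ds s0]; apply: dphi; rewrite !ger0_norm; [lra|lra|lra])
    ltac:(apply: continuous_in_subspaceT => s; rewrite inE/= in_itv/= => /andP[ds s0]; apply: cphi; rewrite !ger0_norm; [lra|lra|lra]).
  move: sd; rewrite in_itv/= => /andP[ds s0] eq.
  exists s; first by rewrite !ger0_norm; lra.
  by move: eq; rewrite /phi scale0r add0r subr0 mulrC.
- by exists 0; rewrite ?normr0// scale0r add0r subrr mul0r.
Qed.

(** A step [d h] in the fixed direction [e] from a moving base point [p h]
contributes the directional derivative at the limit point; the increment of a
C^1 function along a curve is a sum of such steps, one per coordinate. *)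
Lemma step_derive (E : normedModType R) (U : set E) (f : E -> R) (e y : E)
    (p : R -> E) (d : R -> R) (d' : R) :
  open U -> Ck 1 U f -> U y ->
  p h @[h --> (0:R)^'] --> y -> d h @[h --> (0:R)^'] --> (0 : R) ->
  h^-1 * d h @[h --> (0:R)^'] --> d' ->
  h^-1 * (f (d h *: e + p h) - f (p h)) @[h --> (0:R)^'] -->
    d' * 'D_e (f : E -> R^o) y.
Proof.
move=> oU f1 Uy py d0 dd.
have [q qP] : exists2 q : R -> R, \forall h \near (0:R)^', f (d h *: e + p h) - f (p h) =
     d h * q h & q h @[h --> (0:R)^'] --> 'D_e (f : E -> R^o) y.
  pose q h := xget 0 [set r | (exists2 s, `|s| <= `|d h| &
      r = 'D_e (f : E -> R^o) (s *: e + p h)) /\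
      f (d h *: e + p h) - f (p h) = d h * r].
  have key (W : set E) : open W -> W y ->
      \forall h \near (0:R)^', forall s, `|s| <= `|d h| -> W (s *: e + p h).
    move=> oW Wy.
    have /nbhs_ballP[r /= r0 rW] : nbhs y W by exact: open_nbhs_nbhs.
    have k0 : 0 < `|e| + 1 by rewrite ltr_wpDl.
    near=> h; move=> s sd; apply: rW; rewrite -ball_normE/=.
    have py' : `|y - p h| < r / 2.
      near: h; apply: (@cvgr_dist_lt _ _ _ _ _ _ _ py); exact: divr_gt0.
    have pd : `|d h| < r / 2 / (`|e| + 1).
      near: h; have := @cvgr_dist_lt _ _ _ _ _ _ _ d0 (r / 2 / (`|e| + 1)).
      by under eq_near do rewrite sub0r normrN; apply; rewrite !divr_gt0.
    rewrite opprD addrCA (le_lt_trans (ler_normD _ _))//.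
    rewrite (splitr r) ltrD// normrN normrZ.
    apply: (@le_lt_trans _ _ (`|d h| * (`|e| + 1))).
      by apply: ler_pM => //; rewrite lerDl.
    by rewrite -ltr_pdivlMr.
  have qE : \forall h \near (0:R)^', (exists2 s, `|s| <= `|d h| &
      q h = 'D_e (f : E -> R^o) (s *: e + p h)) /\
      f (d h *: e + p h) - f (p h) = d h * q h.
    have := key U oU Uy; apply: filterS => h Uh.
    have [s sd eq] := MVT_line f1 Uh.
    by rewrite /q; case: xgetP => [r -> //|/(_ ('D_e (f : E -> R^o) (s *: e + p h)))[]];
      split => //; exists s.
  exists q; first by move: qE; apply: filterS => h [].
  have cD := Ck_cont (Ck_D e f1) Uy.
  apply/cvgrPdist_lt => eps eps0.
  have /cvgrPdist_lt/(_ _ eps0) := cD.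
  rewrite nearE nbhsE => -[W [oW Wy] Wd].
  near=> h.
  have Wh : forall s, `|s| <= `|d h| -> W (s *: e + p h) by near: h; exact: key.
  have [[s sd ->] _] : (exists2 s, `|s| <= `|d h| &
      q h = 'D_e (f : E -> R^o) (s *: e + p h)) /\
      f (d h *: e + p h) - f (p h) = d h * q h by near: h.
  by apply: Wd; exact: Wh.
move=> qc.
apply: cvg_trans (cvgM dd qc).
apply: near_eq_cvg; near=> h.
have -> : f (d h *: e + p h) - f (p h) = d h * q h by near: h.
by rewrite mulrA.
Unshelve. all: by end_near. Qed.

End ChainRule.

(** A finite basis of a normed space together with its (continuous) coordinate
functionals.  This treats R^n and R x R^n, the source of the families of maps,
on the same footing. *)
Definition coordinates (R : realType) (F : normedModType R) (I : finType)
    (e : I -> F) (c : I -> F -> R) : Prop :=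
  [/\ forall i (a : R) x y, c i (a *: x + y) = a * c i x + c i y,
      forall i, continuous (c i)
    & forall x, x = \sum_i c i x *: e i].

Section Chain.
Context {R : realType} {E F : normedModType R} {I : finType}.
Variables (e : I -> F) (c : I -> F -> R).
Hypothesis ec : coordinates e c.

(** The increment of [g] is added one coordinate at a time, and [step_derive] gives
the contribution of each step.  Only directional derivatives enter, as in the
definition of C^k. *)
Lemma is_derive_chain (V : set F) (f : F -> R) (g : E -> F) (x v : E) :
  open V -> Ck 1 V f -> V (g x) ->
  (forall i, derivable (c i \o g : E -> R^o) x v) ->
  is_derive x v (f \o g : E -> R^o)
    (\sum_i 'D_v (c i \o g : E -> R^o) x * 'D_(e i) (f : F -> R^o) (g x)).
Proof.
case: ec => cl cc eE oV f1 Vgx dg.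
pose d i h := c i (g (h *: v + x)) - c i (g x).
pose p s h := g x + \sum_(i <- s) d i h *: e i.
have dd i : h^-1 * d i h @[h --> (0:R)^'] --> 'D_v (c i \o g : E -> R^o) x.
  exact: (dg i).
have d0 i : d i h @[h --> (0:R)^'] --> (0 : R).
  rewrite -[X in _ --> X](mul0r ('D_v (c i \o g : E -> R^o) x)).
  have h0 : h @[h --> (0:R)^'] --> (0:R) by exact: nbhs_dnbhs.
  apply: cvg_trans (cvgM h0 (dd i)).
  apply: near_eq_cvg; near=> h; change (h * (h^-1 * d i h) = d i h); rewrite mulrA mulfV ?mul1r//.
  near: h; exact: nbhs_dnbhs_neq.
have pc s : p s h @[h --> (0:R)^'] --> g x.
  suff sc : (\sum_(i <- s) d i h *: e i) @[h --> (0:R)^'] --> (0 : F).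
    by have := cvgD (cvg_cst (g x)) sc; rewrite addr0; apply.
  elim: s => [|i s ih].
    by under eq_fun do rewrite big_nil; exact: cvg_cst.
  under eq_fun do rewrite big_cons.
  have := cvgD (cvgZ (d0 i) (cvg_cst (e i))) ih.
  by rewrite scale0r addr0; apply.
have key s : h^-1 * (f (p s h) - f (g x)) @[h --> (0:R)^'] -->
    \sum_(i <- s) 'D_v (c i \o g : E -> R^o) x * 'D_(e i) (f : F -> R^o) (g x).
  elim: s => [|i s ih].
    rewrite big_nil; under eq_fun do rewrite /p big_nil addr0 subrr mulr0.
    exact: cvg_cst.
  rewrite big_cons.
  have := cvgD (@step_derive R F V f (e i) (g x) (p s) (d i) _ oV f1 Vgx (pc s) (d0 i) (dd i)) ih.
  move=> /(_ _); apply: cvg_trans; apply: near_eq_cvg; near=> h.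
  rewrite fctE.
  rewrite -mulrDr; congr (_ * _); rewrite /p big_cons (addrCA (g x)).
  by rewrite [LHS]addrA subrK.
have pE h : p (index_enum I) h = g (h *: v + x).
  rewrite /p [X in X + _]eE -big_split/= [RHS]eE; apply: eq_bigr => i _.
  by rewrite -scalerDl addrC subrK.
have {}key : h^-1 *: (f (g (h *: v + x)) - f (g x) : R^o) @[h --> (0:R)^'] -->
    \sum_i 'D_v (c i \o g : E -> R^o) x * 'D_(e i) (f : F -> R^o) (g x).
  have := key (index_enum I); apply: cvg_trans.
  by apply: near_eq_cvg; near=> h; rewrite pE.
by apply: DeriveDef; [apply/cvg_ex; eexists; exact: key|exact: cvg_lim key].
Unshelve. all: by end_near. Qed.

Lemma coordinates_cvg T (G : set_system T) (FG : Filter G) (g : T -> F) (y : F) :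
  (forall i, c i (g t) @[t --> G] --> c i y) -> g t @[t --> G] --> y.
Proof.
case: ec => cl cc eE cg.
have -> : g = fun t => \sum_i c i (g t) *: e i by apply/funext => t; exact: eE.
rewrite [X in _ --> X]eE.
elim: (index_enum I) => [|i s ih].
  by under eq_fun do rewrite big_nil; rewrite big_nil; exact: cvg_cst.
under eq_fun do rewrite big_cons; rewrite big_cons.
by apply: cvgD => //; apply: cvgZ => //; exact: cvg_cst.
Qed.

Lemma Ck_comp k (U : set E) (V : set F) (f : F -> R) (g : E -> F) :
  open U -> open V -> (forall x, U x -> V (g x)) ->
  (forall i, Ck k U (c i \o g)) -> Ck k V f -> Ck k U (f \o g).
Proof.
move=> oU oV UV; elim: k f => [|k ih] f gk fk.
  split=> // x Ux; apply: (@cvg_comp _ _ _ g f _ (nbhs (g x))).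
    by apply: coordinates_cvg => i; exact: Ck_cont (gk i) Ux.
  by apply: (Ck_cont fk); exact: UV.
have f1 : Ck 1 V f by exact: Ck_le fk.
have dfg x v : U x -> is_derive x v (f \o g : E -> R^o)
    (\sum_i 'D_v (c i \o g : E -> R^o) x * 'D_(e i) (f : F -> R^o) (g x)).
  move=> Ux; apply: (is_derive_chain oV f1); first exact: UV.
  by move=> i; exact: Ck_derivable (gk i) Ux.
apply: CkS.
- have : Ck k U (f \o g) by apply: ih; [move=> i; exact: CkW|exact: CkW].
  by move=> fgk x Ux; exact: Ck_cont fgk Ux.
- by move=> v x Ux; have [] := dfg x v Ux.
- move=> v; apply: (Ck_ext (g := fun x => \sum_i 'D_v (c i \o g : E -> R^o) x *
     ('D_(e i) (f : F -> R^o) \o g) x)) => //.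
    by move=> x Ux; have [] := dfg x v Ux.
  apply: Ck_sum => // i; apply: Ck_mul => //; first exact: Ck_D.
  by apply: ih; [move=> j; exact: CkW|exact: Ck_D].
Qed.

End Chain.

Section CoordinateSpaces.
Context {R : realType}.

Lemma coordinates_rV n : coordinates (F := 'rV[R]_n)
  (fun i : 'I_n => delta_mx 0 i) (fun i x => x 0 i).
Proof.
split; [by move=> i a x y; rewrite !mxE|by move=> i; exact: coord_continuous|].
by move=> x; rewrite [LHS]row_sum_delta.
Qed.

Lemma coordinates_pair n : coordinates (F := (R^o * 'rV[R]_n)%type)
  (fun i : option 'I_n => if i is Some i then (0, delta_mx 0 i) else (1, 0))
  (fun i x => if i is Some i then x.2 0 i else x.1).
Proof.
split.
- by move=> [i|] a x y /=; rewrite ?mxE.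
- move=> [i|] x; last exact: cvg_fst.
  apply: (@continuous_comp _ _ _ (@snd R^o 'rV[R]_n) (fun y => y 0 i)).
    exact: cvg_snd.
  exact: coord_continuous.
- move=> [a x].
  rewrite (bigD1 None)//= (reindex_omap Some id)/=; last by case.
  under eq_bigl do rewrite eqxx.
  apply/pair_equal_spec; split; rewrite /= !raddf_sum/=.
    by rewrite big1 ?addr0 ?[_%:A]mulr1// => i _; rewrite scaler0.
  by rewrite scaler0 add0r -row_sum_delta.
Qed.

Lemma coordinates_R : coordinates (F := R^o) (fun i : unit => 1) (fun i x => x).
Proof.
split=> //; first by move=> i x; exact: cvg_id.
by move=> x; rewrite big_const card_unit/= addr0 [RHS]mulr1.
Qed.

End CoordinateSpaces.

Section Schwarz.
Context {R : realType} {E : normedModType R}.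

Lemma is_derive_translate (f : E -> R) (a x v : E) :
  derivable (f : E -> R^o) (x + a) v ->
  is_derive x v (fun x => f (x + a) : R^o) ('D_v (f : E -> R^o) (x + a)).
Proof.
pose q1 := fun h : R => h^-1 *: (f (h *: v + x + a) - f (x + a) : R^o).
pose q2 := fun h : R => h^-1 *: (f (h *: v + (x + a)) - f (x + a) : R^o).
have q12 : q1 = q2 by apply/funext => h; rewrite /q1 /q2 addrA.
move=> fd; apply: DeriveDef.
  by rewrite /derivable; change (cvg (q1 h @[h --> (0:R)^'])); rewrite q12.
by rewrite /derive; change (lim (q1 h @[h --> (0:R)^']) = lim (q2 h @[h --> (0:R)^'])); rewrite q12.
Qed.

Lemma translate_continuous (a : E) : continuous (fun x => x + a).
Proof. by move=> x; apply: cvgD; [exact: cvg_id|exact: cvg_cst]. Qed.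

Lemma open_translate (U : set E) (a : E) : open U -> open [set x | U (x + a)].
Proof. by move: U; apply/continuousP; exact: translate_continuous. Qed.

Lemma Ck_translate k (U : set E) (f : E -> R) (a : E) : open U ->
  Ck k U f -> Ck k [set x | U (x + a)] (fun x => f (x + a)).
Proof.
move=> oU; have ca : continuous (fun x : E => x + a) by exact: translate_continuous.
have oUa : open [set x | U (x + a)] by exact: open_translate.
elim: k f => [|k ih] f fk.
  split=> // x Ux; apply: (@continuous_comp _ _ _ (fun x : E => x + a) f).
    exact: ca.
  exact: Ck_cont fk Ux.
apply: CkS.
- move=> x Ux; apply: (@continuous_comp _ _ _ (fun x : E => x + a) f).
    exact: ca.
  exact: Ck_cont fk Ux.
- by move=> v x Ux; have [] := is_derive_translate (Ck_derivable (v := v) fk Ux).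
- move=> v; apply: (Ck_ext (g := fun x => 'D_v (f : E -> R^o) (x + a))); first exact: oUa.
    by move=> x Ux; have [] := is_derive_translate (Ck_derivable (v := v) fk Ux).
  by apply: (ih ('D_v (f : E -> R^o))); exact: Ck_D.
Qed.

(** The mean value theorem, applied first in direction [v] to the first difference in
direction [w], then in direction [w] to the derivative obtained. *)
Lemma second_difference (U : set E) (f : E -> R) (x v w : E) (h : R) :
  open U -> Ck 2 U f ->
  (forall s t, `|s| <= `|h| -> `|t| <= `|h| -> U (t *: w + (s *: v + x))) ->
  exists s t, [/\ `|s| <= `|h|, `|t| <= `|h| &
    (f (h *: w + (h *: v + x)) - f (h *: v + x)) - (f (h *: w + x) - f x) =
    h * h * 'D_w ('D_v (f : E -> R^o) : E -> R^o) (t *: w + (s *: v + x))].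
Proof.
move=> oU f2 Ust; pose phi u := f (u + h *: w) - f u.
pose U' := [set u | U (u + h *: w)] `&` U.
have oU' : open U'.
  apply: openI => //; apply: open_comp => // u _.
  by apply: cvgD; [exact: cvg_id|exact: cvg_cst].
have f1 : Ck 1 U f by exact: CkW.
have phi1 : Ck 1 U' phi.
  apply: Ck_add; [exact: oU'| |apply: Ck_opp; first exact: oU'].
    apply: (@Ck_sub _ _ _ [set u | U (u + h *: w)]); last exact: Ck_translate.
    by move=> u [].
  by apply: Ck_sub f1 => u [].
have U's s : `|s| <= `|h| -> U' (s *: v + x).
  move=> sh; split => /=; first by rewrite addrC; exact: Ust.
  by have := Ust s 0 sh; rewrite normr0 scale0r add0r; exact.
have [s sh phiE] := MVT_line phi1 U's.
have dphi : 'D_v (phi : E -> R^o) (s *: v + x) =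
    'D_v (f : E -> R^o) (h *: w + (s *: v + x)) - 'D_v (f : E -> R^o) (s *: v + x).
  have [U1 U2] := U's s sh.
  have [d1 e1] := is_derive_translate (Ck_derivable (v := v) f1 U1).
  rewrite -(addrC (s *: v + x)) -e1.
  apply: (@deriveB _ _ _ (fun u => f (u + h *: w) : R^o) (f : E -> R^o)); first exact: d1.
  exact: Ck_derivable f1 U2.
have [t th tE] := MVT_line (Ck_D v f2) (fun t => Ust s t sh).
exists s, t; split; [exact: sh|exact: th|].
rewrite -[RHS]mulrA -tE -dphi -phiE /phi.
by rewrite !(addrC _ (h *: w)).
Qed.

(** To be applied to the two mixed second derivatives. *)
Lemma continuous_eq (A B : E -> R) (x : E) :
  {for x, continuous A} -> {for x, continuous B} ->
  (forall r, 0 < r -> exists y z, [/\ `|x - y| < r, `|x - z| < r & A y = B z]) ->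
  A x = B x.
Proof.
move=> cA cB AB; apply/eqP; rewrite -subr_eq0 -normr_le0; apply/ler_addgt0Pr => eps eps0.
rewrite add0r.
have e20 : 0 < eps / 2 by rewrite divr_gt0.
have [r r0 rP] : exists2 r, 0 < r & forall y, `|x - y| < r ->
    `|A x - A y| < eps / 2 /\ `|B x - B y| < eps / 2.
  have nx : \forall y \near x, `|A x - A y| < eps / 2 /\ `|B x - B y| < eps / 2.
    move/cvgrPdist_lt/(_ _ e20) : cA => nA; move/cvgrPdist_lt/(_ _ e20) : cB => nB.
    by apply: filterS2 nA nB => y Ay By; split.
  have /nbhs_ballP[r /= r0 rU] := nx.
  by exists r => // y xy; apply: rU; rewrite -ball_normE.
have [y [z [/rP[Ay _] /rP[_ Bz] AyBz]]] := AB r r0.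
have -> : A x - B x = (A x - A y) - (B x - B z) by rewrite AyBz; ring.
rewrite (le_trans (ler_normB _ _))// [leRHS]splitr.
by apply: ltW; exact: ltrD.
Qed.

(** Both mixed derivatives at x are limits of values that they take at nearby points,
where both are equal to the same second difference divided by h^2. *)
Lemma Schwarz (U : set E) (f : E -> R) (x v w : E) : open U -> Ck 2 U f -> U x ->
  'D_w ('D_v (f : E -> R^o) : E -> R^o) x = 'D_v ('D_w (f : E -> R^o) : E -> R^o) x.
Proof.
move=> oU f2 Ux.
have cA := Ck_cont (Ck_D w (Ck_D v f2)) Ux.
have cB := Ck_cont (Ck_D v (Ck_D w f2)) Ux.
apply: (continuous_eq cA cB) => {cA cB} r' r'0.
have [r r0 [rr' rP]] : exists2 r, 0 < r & r <= r' /\ forall y, `|x - y| < r -> U y.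
  have /nbhs_ballP[r /= r0 rU] : nbhs x U by apply: open_nbhs_nbhs; split.
  exists (Num.min r r'); first by rewrite lt_min r0.
  split; first by rewrite ge_min lexx orbT.
  by move=> y xy; apply: rU; rewrite -ball_normE /=; apply: lt_le_trans xy _; rewrite ge_min lexx.
pose h := r / (2 * (`|v| + `|w| + 1)).
have k0 : 0 < `|v| + `|w| + 1 by rewrite ltr_wpDl// addr_ge0.
have h0 : 0 < h by rewrite divr_gt0// mulr_gt0.
have hr : h * (`|v| + `|w|) < r.
  apply: (@le_lt_trans _ _ (h * (`|v| + `|w| + 1))).
    by rewrite ler_pM2l// lerDl.
  rewrite /h invfM mulrA -mulrA mulVf ?gt_eqF// mulr1.
  by rewrite ltr_pdivrMr//; lra.
have bd s t : `|s| <= h -> `|t| <= h -> `|x - (t *: w + (s *: v + x))| < r.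
  move=> sh th; rewrite distrC addrA addrK.
  apply: le_lt_trans hr; apply: le_trans (ler_normD _ _) _.
  by rewrite mulrDr addrC lerD// normrZ ler_pM.
have bd' s t : `|s| <= h -> `|t| <= h -> `|x - (t *: v + (s *: w + x))| < r.
  by move=> sh th; rewrite addrCA; exact: bd.
have nh : `|h| = h by rewrite gtr0_norm.
have [s [t]] := @second_difference U f x v w h oU f2
  ltac:(by move=> ? ?; rewrite nh => sh th; apply: rP; exact: bd).
have [s' [t']] := @second_difference U f x w v h oU f2
  ltac:(by move=> ? ?; rewrite nh => sh th; apply: rP; exact: bd').
rewrite !nh => -[sh' th' E'] [sh th E0].
exists (t *: w + (s *: v + x)), (t' *: v + (s' *: w + x)); split.
- by apply: lt_le_trans rr'; exact: bd.
- by apply: lt_le_trans rr'; exact: bd'.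
have hh : h * h != 0 by rewrite mulf_neq0 ?gt_eqF.
apply: (mulfI hh); apply: etrans (esym E0) _; apply: etrans E'.
by rewrite (addrCA (h *: v)); ring.
Qed.

End Schwarz.

(** * Functions on a product *)

Lemma pair_snd_continuous (T U : topologicalType) (t : T) :
  continuous (fun y : U => (t, y)).
Proof. by move=> y; apply: cvg_pair => /=; [exact: cvg_cst|exact: cvg_id]. Qed.

Lemma pair_fst_continuous (T U : topologicalType) (y : U) :
  continuous (fun t : T => (t, y)).
Proof. by move=> t; apply: cvg_pair => /=; [exact: cvg_id|exact: cvg_cst]. Qed.

Section Slices.
Context {R : realType} {n : nat}.
Local Notation RV := (R^o * 'rV[R]_n)%type.
Implicit Types (F : RV -> R) (U : set RV).

Lemma quotient_fst F (t : R) y :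
  (fun h : R => h^-1 *: (F (h *: ((1, 0) : RV) + (t, y)) - F (t, y) : R^o)) =
  (fun h : R => h^-1 *: (F (h *: (1 : R) + t, y) - F (t, y) : R^o)).
Proof.
apply/funext => h; congr (_ *: (F _ - _)).
by apply/pair_equal_spec; split => //=; rewrite scaler0 add0r.
Qed.

Lemma derive_fst F (t : R) y : 'D_((1, 0) : RV) (F : RV -> R^o) (t, y) =
  'D_(1 : R) (fun s : R => F (s, y) : R^o) t.
Proof.
exact: (congr1 (fun q : R -> R^o => lim (q h @[h --> (0:R)^'])) (quotient_fst F t y)).
Qed.

Lemma derivable_fst F (t : R) y : derivable (F : RV -> R^o) (t, y) ((1, 0) : RV) ->
  derivable (fun s : R => F (s, y) : R^o) t (1 : R).
Proof.
have := congr1 (fun q : R -> R^o => cvg (q h @[h --> (0:R)^'])) (quotient_fst F t y).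
by rewrite /derivable => <-.
Qed.

Lemma derive_snd F (t : R) y w : 'D_((0, w) : RV) (F : RV -> R^o) (t, y) =
  'D_w (fun y => F (t, y) : R^o) y.
Proof.
apply: (derive_eq_line (G := fun y => F (t, y))) => h; congr (F _).
by apply/pair_equal_spec; split => //=; rewrite scaler0 add0r.
Qed.

Lemma open_slice_snd U t : open U -> open [set y | U (t, y)].
Proof. by move: U; apply/continuousP; exact: pair_snd_continuous. Qed.

Lemma open_slice_fst U y : open U -> open [set t : R^o | U (t, y)].
Proof. by move: U; apply/continuousP; exact: pair_fst_continuous. Qed.

Lemma Ck_coord k (V : set 'rV[R]_n) (i : 'I_n) : Ck k V (fun y => y 0 i).
Proof.
apply: Ck_linear; [by move=> a x y; rewrite !mxE|exact: coord_continuous].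
Qed.

Lemma Ck_id k (V : set R^o) : Ck k V (fun t : R^o => t : R).
Proof. by apply: Ck_linear => // x; exact: cvg_id. Qed.

Lemma Ck_slice_snd k U F t : open U -> Ck k U F ->
  Ck k [set y | U (t, y)] (fun y => F (t, y)).
Proof.
move=> oU Fk; apply: (Ck_comp (g := fun y => (t, y) : RV) (coordinates_pair n) _ oU _ _ Fk).
- exact: open_slice_snd.
- by [].
- by move=> [i|] /=; [exact: Ck_coord|exact: Ck_cst].
Qed.

Lemma Ck_slice_fst k U F y : open U -> Ck k U F ->
  Ck k [set t : R^o | U (t, y)] (fun t : R^o => F (t, y)).
Proof.
move=> oU Fk; apply: (Ck_comp (g := fun t : R^o => (t, y) : RV) (coordinates_pair n) _ oU _ _ Fk).
- exact: open_slice_fst.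
- by [].
- by move=> [i|] /=; [exact: Ck_cst|exact: Ck_id].
Qed.

Lemma Ck_fst k (U : set RV) : Ck k U fst.
Proof. by apply: Ck_linear => // x; exact: cvg_fst. Qed.

Lemma Ck_snd k (U : set RV) i : Ck k U (fun x => x.2 0 i).
Proof.
apply: Ck_linear; first by move=> a x y; rewrite !mxE.
move=> x; apply: (@continuous_comp _ _ _ (@snd R^o 'rV[R]_n) (fun y => y 0 i)).
  exact: cvg_snd.
exact: coord_continuous.
Qed.

Lemma open_fst (K : set R) : open K -> open [set x : RV | K x.1].
Proof.
by move=> oK; apply: (open_comp (f := fst : RV -> R)) oK => x _; exact: cvg_fst.
Qed.

Lemma open_snd (V : set 'rV[R]_n) : open V -> open [set x : RV | V x.2].
Proof.
by move=> oV; apply: (open_comp (f := snd : RV -> _)) oV => x _; exact: cvg_snd.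
Qed.

Lemma Ck_comp1 k (E : normedModType R) (U : set E) (K : set R^o) (s : R^o -> R) (g : E -> R) :
  open U -> open K -> (forall x, U x -> K (g x)) -> Ck k U g -> Ck k K s ->
  Ck k U (fun x => s (g x)).
Proof.
move=> oU oK UK gk sk.
by apply: (Ck_comp (g := g : E -> R^o) (coordinates_R (R := R)) oU oK UK _ sk).
Qed.

Lemma Ck_comp_pair k m (E : normedModType R) (U : set E) (V : set (R^o * 'rV[R]_m)%type)
    (f : (R^o * 'rV[R]_m)%type -> R) (a : E -> R) (b : E -> 'rV[R]_m) :
  open U -> open V -> (forall x, U x -> V (a x, b x)) ->
  Ck k U a -> (forall i, Ck k U (fun x => b x 0 i)) -> Ck k V f ->
  Ck k U (fun x => f (a x, b x)).
Proof.
move=> oU oV UV ak bk fk.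
apply: (Ck_comp (g := fun x => (a x, b x) : R^o * 'rV[R]_m) (coordinates_pair m) oU oV UV _ fk).
by move=> [i|] /=; [exact: bk|exact: ak].
Qed.

Lemma Ck_comp_rV k m (E : normedModType R) (U : set E) (V : set 'rV[R]_m)
    (f : 'rV[R]_m -> R) (b : E -> 'rV[R]_m) :
  open U -> open V -> (forall x, U x -> V (b x)) ->
  (forall i, Ck k U (fun x => b x 0 i)) -> Ck k V f ->
  Ck k U (fun x => f (b x)).
Proof. by move=> oU oV UV bk fk; exact: (Ck_comp (coordinates_rV m) oU oV UV bk fk). Qed.

End Slices.

(** * Smooth families of maps of a manifold *)

Lemma openI_preimage (X Y : topologicalType) (A : set X) (B : set Y) (f : X -> Y) :
  open A -> open B -> (forall x, A x -> {for x, continuous f}) ->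
  open (A `&` f @^-1` B).
Proof.
move=> oA oB fc; rewrite openE => x [Ax Bx]; apply: filterI.
  by apply: open_nbhs_nbhs; split.
by apply: fc => //; apply: open_nbhs_nbhs; split.
Qed.

Lemma continuous_fst_comp (X Y Z : topologicalType) (f : X -> Z) (x : X) (y : Y) :
  {for x, continuous f} -> {for (x, y), continuous (fun xy : X * Y => f xy.1)}.
Proof.
move=> fc; apply: (@continuous_comp _ _ _ (@fst X Y) f); [exact: cvg_fst|exact: fc].
Qed.

Lemma continuous_snd_comp (X Y Z : topologicalType) (f : Y -> Z) (x : X) (y : Y) :
  {for y, continuous f} -> {for (x, y), continuous (fun xy : X * Y => f xy.2)}.
Proof.
move=> fc; apply: (@continuous_comp _ _ _ (@snd X Y) f); [exact: cvg_snd|exact: fc].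
Qed.

Lemma continuous_pair (X Y Z : topologicalType) (f : X -> Y) (g : X -> Z) (x : X) :
  {for x, continuous f} -> {for x, continuous g} ->
  {for x, continuous (fun x => (f x, g x))}.
Proof. by move=> fc gc; apply: cvg_pair => /=; [exact: fc|exact: gc]. Qed.

Section Families.
Context {R : realType} {n : nat} {M : closedManifold R n}.
Local Notation RV := (R^o * 'rV[R]_n)%type.
Implicit Types (i j : 'I_(natlas M)) (y : 'rV[R]_n) (p : M) (I J K : set R).

Lemma cdom_open i : open (cdom (atlas M i)).
Proof. by have [] := atlas_chart (c := M) i. Qed.

Lemma cimg_open i : open (cimg (atlas M i)).
Proof. by have [] := atlas_chart (c := M) i. Qed.

Lemma cmapK i p : cdom (atlas M i) p -> cinv (atlas M i) (cmap (atlas M i) p) = p.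
Proof. by have [_ _ + _ _] := atlas_chart (c := M) i; apply. Qed.

Lemma cmap_continuous i p : cdom (atlas M i) p -> {for p, continuous (cmap (atlas M i))}.
Proof. by have [_ _ _ + _] := atlas_chart (c := M) i; apply. Qed.

Lemma cinv_continuous i y : cimg (atlas M i) y -> {for y, continuous (cinv (atlas M i))}.
Proof. by have [_ _ _ _] := atlas_chart (c := M) i; apply. Qed.

Lemma cimg_cmap i p : cdom (atlas M i) p -> cimg (atlas M i) (cmap (atlas M i) p).
Proof. by move=> ip; exists p. Qed.

Lemma cimg_cdom i y : cimg (atlas M i) y -> cdom (atlas M i) (cinv (atlas M i) y).
Proof. by move=> [p ip <-]; rewrite cmapK. Qed.

Lemma cinvK i y : cimg (atlas M i) y -> cmap (atlas M i) (cinv (atlas M i) y) = y.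
Proof. by move=> [p ip <-]; rewrite cmapK. Qed.

(** The open set on which the expression [fexpr] of a family in two charts makes
sense; it is the set that occurs in the definition of a smooth family. *)
Definition fdom I (psi : R -> M -> M) i j : set RV :=
  [set ty | [/\ I ty.1, cimg (atlas M i) ty.2
              & cdom (atlas M j) (psi ty.1 (cinv (atlas M i) ty.2))]].

Definition fexpr (psi : R -> M -> M) i j (ty : RV) : 'rV[R]_n :=
  cmap (atlas M j) (psi ty.1 (cinv (atlas M i) ty.2)).

Definition jcont I (psi : R -> M -> M) := forall t p, I t ->
  {for (t, p), continuous (fun tp : R * M => psi tp.1 tp.2)}.

Lemma jcont_chart I psi i (ty : RV) : jcont I psi -> I ty.1 -> cimg (atlas M i) ty.2 ->
  {for ty, continuous (fun ty : RV => psi ty.1 (cinv (atlas M i) ty.2))}.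
Proof.
move=> pc It iy.
apply: (@continuous_comp _ _ _ (fun ty : RV => (ty.1, cinv (atlas M i) ty.2) : R * M)
  (fun tp => psi tp.1 tp.2)); last exact: pc.
case: ty It iy => u y /= It iy.
apply: continuous_pair; first exact: cvg_fst.
by apply: continuous_snd_comp; exact: cinv_continuous.
Qed.

Lemma open_box I i : open I -> open [set ty : RV | I ty.1 /\ cimg (atlas M i) ty.2].
Proof.
move=> oI; apply: openI; first exact: open_fst.
by apply: open_snd; exact: cimg_open.
Qed.

Lemma open_fdom I psi i j : open I -> jcont I psi -> open (fdom I psi i j).
Proof.
move=> oI pc; have -> : fdom I psi i j = [set ty : RV | I ty.1 /\ cimg (atlas M i) ty.2] `&`
    (fun ty : RV => psi ty.1 (cinv (atlas M i) ty.2)) @^-1` cdom (atlas M j).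
  by apply/seteqP; split => [ty []|ty [[]]].
apply: openI_preimage; [exact: open_box|exact: cdom_open|].
by move=> ty [It iy]; exact: jcont_chart pc It iy.
Qed.

(** The time changes [s] and [t] let this single statement cover reparametrization,
reversal, right translation and concatenation of paths.  Near a given point the
composition is read in three charts. *)
Lemma smooth_family_comp I J K (phi psi : R -> M -> M) (s t : R -> R) :
  open I -> open J -> open K ->
  smooth_family I phi -> smooth_family J psi ->
  smooth_on (E := R^o) K s -> smooth_on (E := R^o) K t ->
  (forall u, K u -> I (s u)) -> (forall u, K u -> J (t u)) ->
  smooth_family K (fun u p => phi (s u) (psi (t u) p)).
Proof.
move=> oI oJ oK [phic phis] [psic psis] ss ts KI KJ.
have sc (u : R) : K u -> {for u, continuous s} by move=> Ku; exact: Ck_cont (ss 0) Ku.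
have tc (u : R) : K u -> {for u, continuous t} by move=> Ku; exact: Ck_cont (ts 0) Ku.
have psitc : jcont K (fun u => psi (t u)).
  move=> u p Ku.
  apply: (@continuous_comp _ _ _ (fun up : R * M => (t up.1, up.2) : R * M)
    (fun tp => psi tp.1 tp.2)); last by apply: psic; exact: KJ.
  apply: continuous_pair; last exact: cvg_snd.
  by apply: continuous_fst_comp; exact: tc.
have phitc : jcont K (fun u p => phi (s u) (psi (t u) p)).
  move=> u p Ku.
  apply: (@continuous_comp _ _ _ (fun up : R * M => (s up.1, psi (t up.1) up.2) : R * M)
    (fun tp => phi tp.1 tp.2)); last by apply: phic; exact: KI.
  apply: continuous_pair; last exact: psitc.
  by apply: continuous_fst_comp; exact: sc.
split; first exact: phitc.
move=> i j k; change (smooth_on (fdom K (fun u p => phi (s u) (psi (t u) p)) i j)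
  (fun ty => fexpr (fun u p => phi (s u) (psi (t u) p)) i j ty 0 k)).
move=> m; apply: Ck_local => -[u y] [/= Ku iy jy].
have [l ly] := atlas_cover (psi (t u) (cinv (atlas M i) y)).
pose V := fdom K (fun u => psi (t u)) i l `&` fdom K (fun u p => phi (s u) (psi (t u) p)) i j.
have oV : open V by apply: openI; exact: open_fdom.
exists V, (fun ty : RV => fexpr phi l j (s ty.1, fexpr (fun u => psi (t u)) i l ty) 0 k).
split; [exact: oV|by split| |].
  have oW := @open_fdom I phi l j oI phic.
  apply: (Ck_comp_pair oV oW _ _ _ (phis l j k m)).
  - by move=> [u' y'] [[/= Ku' iy' ly'] [_ _ /= jy']]; split => /=;
      [exact: KI|exact: cimg_cmap|rewrite /fexpr cmapK].
  - apply: (Ck_comp1 (K := K) (s := s) (g := fst) oV oK) => //.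
      by move=> [u' y'] [[]].
    exact: Ck_fst.
  - move=> a.
    have oW' := @open_fdom J psi i l oJ psic.
    apply: (Ck_comp_pair (a := fun ty : RV => t ty.1) (b := snd) oV oW' _ _ _ (psis i l a m)).
    + by move=> [u' y'] [[/= Ku' iy' ly'] [_ _ /= jy']]; split => //=; exact: KJ.
    + apply: (Ck_comp1 (K := K) (s := t) (g := fst) oV oK) => //.
        by move=> [u' y'] [[]].
      exact: Ck_fst.
    + by move=> b; exact: Ck_snd.
by move=> [u' y'] [[/= Ku' iy' ly'] _]; rewrite /fexpr /= cmapK.
Qed.

Lemma smooth_map_family (phi : M -> M) I : open I ->
  smooth_map phi -> smooth_family I (fun=> phi).
Proof.
move=> oI [phic phis]; have jc : jcont I (fun=> phi).
  move=> t p It; apply: continuous_snd_comp.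
  exact: phic.
split => // i j k m.
apply: (Ck_comp_rV (b := snd) (f := fun y => cmap (atlas M j) (phi (cinv (atlas M i) y)) 0 k)
    _ _ _ _ (phis i j k m)).
- exact: open_fdom jc.
- have := open_slice_snd (t := 0) (@open_fdom setT (fun=> phi) i j openT _).
  rewrite (_ : [set y | fdom setT (fun=> phi) i j (0, y)] = [set y | cimg (atlas M i) y /\
     cdom (atlas M j) (phi (cinv (atlas M i) y))]).
    apply => t p _; apply: continuous_snd_comp.
    exact: phic.
  by apply/seteqP; split => [y []|y []].
- by move=> [t y] [].
- by move=> a; exact: Ck_snd.
Qed.

Lemma smooth_family_map I (psi : R -> M -> M) t : open I -> I t -> smooth_family I psi -> smooth_map (psi t).
Proof.
move=> oI It [pc ps]; split.
  move=> p; apply: (@continuous_comp _ _ _ (fun p : M => (t, p)) (fun tp : R * M => psi tp.1 tp.2)).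
    exact: pair_snd_continuous.
  exact: pc.
move=> i j k m; have := Ck_slice_snd t (@open_fdom I psi i j oI pc) (ps i j k m).
by apply: Ck_sub => y [].
Qed.

Lemma smooth_map_comp (phi psi : M -> M) : smooth_map phi -> smooth_map psi ->
  smooth_map (phi \o psi).
Proof.
move=> phis psis.
have oT : open [set: R] := openT.
apply: (@smooth_family_map setT (fun=> phi \o psi) 0) => //.
apply: (@smooth_family_comp setT setT setT (fun=> phi) (fun=> psi) (fun=> 0) (fun=> 0)) => //;
  try exact: smooth_map_family.
- by move=> k; exact: Ck_cst.
- by move=> k; exact: Ck_cst.
Qed.

Lemma smooth_map_id : smooth_map (@id M).
Proof.
split; first by move=> p; exact: cvg_id.
move=> i j k; have := atlas_compat (c := M) i j k.
have -> : cmap (atlas M i) @` (cdom (atlas M i) `&` cdom (atlas M j)) =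
  [set y | cimg (atlas M i) y /\ cdom (atlas M j) (id (cinv (atlas M i) y))]; last by [].
apply/seteqP; split => [_ [p [ip jp] <-]|y [iy jy]].
  by rewrite /= cmapK//; split => //; exact: cimg_cmap.
by exists (cinv (atlas M i) y); [split => //; exact: cimg_cdom|exact: cinvK].
Qed.

(** The coordinate expression of [f] in a chart at the image is composed with that
of the family. *)
Lemma smooth_fun_family I (psi : R -> M -> M) (f : M -> R) i : open I -> smooth_family I psi ->
  smooth_fun f ->
  smooth_on [set ty : RV | I ty.1 /\ cimg (atlas M i) ty.2]
    (fun ty : RV => f (psi ty.1 (cinv (atlas M i) ty.2))).
Proof.
move=> oI [pc ps] fs m; apply: Ck_local => -[t y] [/= It iy].
have [j jy] := atlas_cover (psi t (cinv (atlas M i) y)).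
exists (fdom I psi i j), (fun ty => (f \o cinv (atlas M j)) (fexpr psi i j ty)); split.
- exact: open_fdom.
- by split.
- apply: (Ck_comp_rV (@open_fdom I psi i j oI pc) (@cimg_open j) _ _ (fs j m)).
    by move=> [t' y'] [/= _ _ jy']; exact: cimg_cmap.
  by move=> a; exact: (ps i j a m).
- by move=> [t' y'] [/= _ _ jy']; rewrite /fexpr /= cmapK.
Qed.

Lemma smooth_fun_comp (phi : M -> M) (f : M -> R) :
  smooth_map phi -> smooth_fun f -> smooth_fun (f \o phi).
Proof.
move=> phis fs i m.
have oT : open [set: R] := openT.
have := Ck_slice_snd 0 (@open_box setT i oT) (smooth_fun_family i oT (smooth_map_family oT phis) fs m).
by apply: Ck_sub => y iy; split.
Qed.

Lemma smooth_fun_cst a : smooth_fun (fun _ : M => a).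
Proof. by move=> i k; exact: Ck_cst. Qed.

Lemma smooth_fun_lin a (f h : M -> R) : smooth_fun f -> smooth_fun h ->
  smooth_fun (fun x => a * f x + h x).
Proof.
move=> fs hs i k; have oi := @cimg_open i; apply: (Ck_add oi); last exact: hs.
by apply: (Ck_mul oi); [exact: Ck_cst|exact: fs].
Qed.

Lemma smooth_fun_mul (f h : M -> R) : smooth_fun f -> smooth_fun h ->
  smooth_fun (fun x => f x * h x).
Proof. by move=> fs hs i k; have oi := @cimg_open i; apply: (Ck_mul oi); [exact: fs|exact: hs]. Qed.

End Families.

(** * Tangent vectors and velocities *)

Section Tangent.
Context {R : realType} {n : nat} {M : closedManifold R n}.
Local Notation RV := (R^o * 'rV[R]_n)%type.
Implicit Types (i j : 'I_(natlas M)) (y : 'rV[R]_n) (p q : M) (I J K : set R)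
  (psi : R -> M -> M) (f : M -> R).

Lemma minvK (phi : M -> M) : bijective phi -> cancel phi (minv phi).
Proof.
move=> [g gK Kg] p; rewrite /minv; case: xgetP => [q _ /= /(can_inj gK)//|/(_ p)].
by case.
Qed.

Lemma minvKV (phi : M -> M) : bijective phi -> cancel (minv phi) phi.
Proof. by move=> phib p; have [g gK Kg] := phib; rewrite -{2}(Kg p) -{1}(Kg p) minvK. Qed.

Lemma minv_bij (phi : M -> M) : bijective phi -> bijective (minv phi).
Proof. by move=> phib; exists phi; [exact: minvKV|exact: minvK]. Qed.

Lemma minv_eq (phi : M -> M) (g : M -> M) : cancel phi g -> cancel g phi -> minv phi = g.
Proof.
move=> gK Kg; apply/funext => p; have phib : bijective phi by exists g.
by apply: (can_inj gK); rewrite minvKV.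
Qed.

Lemma minv_comp (phi psi : M -> M) : bijective phi -> bijective psi ->
  minv (phi \o psi) = minv psi \o minv phi.
Proof.
move=> phib psib; apply: minv_eq => p /=; first by rewrite !minvK.
by rewrite !minvKV.
Qed.

Lemma smooth_partE (v : tvec M) f : smooth_fun f -> smooth_part v f = v f.
Proof. by move=> fs; rewrite /smooth_part; case: asboolP. Qed.

Lemma smooth_partN (v : tvec M) f : ~ smooth_fun f -> smooth_part v f = 0.
Proof. by move=> fs; rewrite /smooth_part; case: asboolP. Qed.

Lemma tangent_partE (al : form1 M) p v : tangent p v -> tangent_part al p v = al p v.
Proof. by move=> pv; rewrite /tangent_part; case: asboolP. Qed.

Lemma tangent_partN (al : form1 M) p v : ~ tangent p v -> tangent_part al p v = 0.
Proof. by move=> pv; rewrite /tangent_part; case: asboolP. Qed.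

Lemma tangent_lin p (a : R) (u v : tvec M) : tangent p u -> tangent p v ->
  tangent p (fun f => a * u f + v f).
Proof.
move=> [u1 u2 u3] [v1 v2 v3]; split.
- by move=> b f h fs hs; rewrite u1// v1//; ring.
- by move=> f h fs hs; rewrite u2// v2//; ring.
- by move=> f fs; rewrite u3// v3//; ring.
Qed.

Lemma tangent0 p : tangent p (fun=> 0).
Proof. by split => *; ring. Qed.

Lemma tangent_sum p (S : Type) (r : seq S) (a : S -> R) (u : S -> tvec M) :
  (forall s, tangent p (u s)) -> tangent p (fun f => \sum_(s <- r) a s * u s f).
Proof.
move=> ut; elim: r => [|s r ih].
  by under [X in tangent _ X]eq_fun do rewrite big_nil; exact: tangent0.
by under [X in tangent _ X]eq_fun do rewrite big_cons; exact: tangent_lin.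
Qed.

Lemma tensor0l (b : tensor2 M) p w : is_tensor2 b -> tangent p w -> b p (fun=> 0) w = 0.
Proof.
move=> [b1 _ _] pw; have := b1 p 1 _ _ w (tangent0 p) (tangent0 p) pw.
under [X in b p X w]eq_fun do rewrite mulr0 addr0.
by rewrite mul1r => e; apply/eqP; rewrite -(inj_eq (addrI (b p (fun=> 0) w))) addr0 -e.
Qed.

Lemma tensor0r (b : tensor2 M) p w : is_tensor2 b -> tangent p w -> b p w (fun=> 0) = 0.
Proof.
move=> [_ b1 _] pw; have := b1 p 1 _ _ w (tangent0 p) (tangent0 p) pw.
under [X in b p w X]eq_fun do rewrite mulr0 addr0.
by rewrite mul1r => e; apply/eqP; rewrite -(inj_eq (addrI (b p w (fun=> 0)))) addr0 -e.
Qed.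

Lemma tensor_suml (b : tensor2 M) p w (S : Type) (r : seq S) (a : S -> R) (u : S -> tvec M) :
  is_tensor2 b -> tangent p w -> (forall s, tangent p (u s)) ->
  b p (fun f => \sum_(s <- r) a s * u s f) w = \sum_(s <- r) a s * b p (u s) w.
Proof.
move=> bt pw pu; elim: r => [|s r ih].
  by under [X in b p X w]eq_fun do rewrite big_nil; rewrite big_nil; exact: tensor0l.
under [X in b p X w]eq_fun do rewrite big_cons.
have [b1 _ _] := bt.
by rewrite big_cons -ih b1//; exact: tangent_sum.
Qed.

Lemma tensor_sumr (b : tensor2 M) p w (S : Type) (r : seq S) (a : S -> R) (u : S -> tvec M) :
  is_tensor2 b -> tangent p w -> (forall s, tangent p (u s)) ->
  b p w (fun f => \sum_(s <- r) a s * u s f) = \sum_(s <- r) a s * b p w (u s).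
Proof.
move=> bt pw pu; elim: r => [|s r ih].
  by under [X in b p w X]eq_fun do rewrite big_nil; rewrite big_nil; exact: tensor0r.
under [X in b p w X]eq_fun do rewrite big_cons.
have [_ b1 _] := bt.
by rewrite big_cons -ih b1//; exact: tangent_sum.
Qed.

Lemma tensor_scalel (b : tensor2 M) p (a : R) u w :
  is_tensor2 b -> tangent p w -> tangent p u -> b p (fun f => a * u f) w = a * b p u w.
Proof.
move=> bt pw pu; have [b1 _ _] := bt.
have := b1 p a u _ w pu (tangent0 p) pw; rewrite tensor0l// addr0 => <-.
by congr (b p _ w); apply/funext => f; rewrite addr0.
Qed.

(** The direction [w] of R x R^n pushed forward by the family to a tangent
vector: [(1, 0)] gives the velocity of a curve, [(0, e_k)] the image of a
coordinate vector. *)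
Definition fpush (psi : R -> M -> M) i (w : RV) (ty : RV) : tvec M :=
  smooth_part (fun f => 'D_w (fun ty : RV => f (psi ty.1 (cinv (atlas M i) ty.2)) : R^o) ty).

Lemma family_Ck I psi f i k : open I -> smooth_family I psi -> smooth_fun f ->
  Ck k [set ty : RV | I ty.1 /\ cimg (atlas M i) ty.2]
    (fun ty : RV => f (psi ty.1 (cinv (atlas M i) ty.2))).
Proof. by move=> oI psis fs; exact: (smooth_fun_family i oI psis fs k). Qed.

Lemma fpush_tangent I psi i w (ty : RV) : open I -> smooth_family I psi ->
  I ty.1 -> cimg (atlas M i) ty.2 ->
  tangent (psi ty.1 (cinv (atlas M i) ty.2)) (fpush psi i w ty).
Proof.
move=> oI psis It iy.
have dF f : smooth_fun f ->
    derivable (fun ty : RV => f (psi ty.1 (cinv (atlas M i) ty.2)) : R^o) ty w.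
  by move=> fs; have /Ck_derivable := @family_Ck I psi f i 1 oI psis fs; apply; split.
split.
- move=> a f h fs hs.
  rewrite /fpush !smooth_partE//; last exact: smooth_fun_lin.
  pose F := fun ty : RV => f (psi ty.1 (cinv (atlas M i) ty.2)) : R^o.
  pose H := fun ty : RV => h (psi ty.1 (cinv (atlas M i) ty.2)) : R^o.
  have dF' : derivable F ty w by exact: dF.
  have dH' : derivable H ty w by exact: dF.
  transitivity ('D_w (a \*: F + H) ty); first by [].
  by rewrite deriveD; [rewrite deriveZ|exact: derivableZ|exact: dH'].
- move=> f h fs hs.
  rewrite /fpush !smooth_partE//; last exact: smooth_fun_mul.
  pose F := fun ty : RV => f (psi ty.1 (cinv (atlas M i) ty.2)).
  pose H := fun ty : RV => h (psi ty.1 (cinv (atlas M i) ty.2)).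
  by apply: (@deriveM _ _ F H); exact: dF.
- by move=> f fs; rewrite /fpush smooth_partN.
Qed.

Lemma coordvecE i (k : 'I_n) y f : smooth_fun f ->
  coordvec i k y f = 'D_(delta_mx 0 k : 'rV[R]_n) (f \o cinv (atlas M i) : _ -> R^o) y.
Proof. by move=> fs; rewrite /coordvec smooth_partE. Qed.

Lemma coordvec_push i (k : 'I_n) y t :
  coordvec i k y = fpush (fun=> id) i (0, delta_mx 0 k) (t, y).
Proof.
apply/funext => f; rewrite /coordvec /fpush; congr (smooth_part _ f).
Qed.

Lemma smooth_family_id I : open I -> smooth_family I (fun=> @id M).
Proof. by move=> oI; apply: smooth_map_family => //; exact: smooth_map_id. Qed.

Lemma coordvec_tangent i (k : 'I_n) y : cimg (atlas M i) y ->
  tangent (cinv (atlas M i) y) (coordvec i k y).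
Proof.
move=> iy; rewrite (coordvec_push i k y 0).
by apply: (@fpush_tangent setT (fun=> id) i _ (0, y)) => //;
  [exact: openT|apply: smooth_family_id; exact: openT].
Qed.

(** The chain rule in a chart at the image; this is how a tensor is evaluated on
velocities and on images of coordinate vectors. *)
Lemma fpush_chart I psi i j w (ty : RV) : open I -> smooth_family I psi ->
  fdom I psi i j ty ->
  fpush psi i w ty = fun f => \sum_(a < n)
    'D_w (fun ty => fexpr psi i j ty 0 a : R^o) ty * coordvec j a (fexpr psi i j ty) f.
Proof.
move=> oI psis dty; apply/funext => f.
have [fs|fs] := asboolP (smooth_fun f); last first.
  rewrite /fpush smooth_partN// big1// => a _.
  by rewrite /coordvec smooth_partN// mulr0.
rewrite /fpush smooth_partE//; under eq_bigr do rewrite coordvecE//.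
have [pc ps] := psis.
have oD : open (fdom I psi i j) by exact: open_fdom.
have [_ <-] : is_derive ty w ((f \o cinv (atlas M j)) \o fexpr psi i j : RV -> R^o)
   (\sum_(a < n)
      'D_w (fun ty => fexpr psi i j ty 0 a : R^o) ty *
      'D_(delta_mx 0 a) (f \o cinv (atlas M j) : _ -> R^o) (fexpr psi i j ty)).
  apply: (is_derive_chain (coordinates_rV n) (@cimg_open _ _ M j)) => //.
  - exact: (fs j 1).
  - by case: dty => _ _ jy; exact: cimg_cmap.
  - by move=> a; have /Ck_derivable := ps i j a 1; apply.
apply: near_eq_derive.
have : nbhs ty (fdom I psi i j) by apply: open_nbhs_nbhs; split.
by apply: filterS => -[t' y'] [/= _ _ jy']; rewrite /fexpr/= cmapK.
Qed.

Lemma tmap_coordvec I psi i (k : 'I_n) (ty : RV) : open I -> smooth_family I psi ->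
  I ty.1 -> tmap (psi ty.1) (coordvec i k ty.2) = fpush psi i (0, delta_mx 0 k) ty.
Proof.
move=> oI psis It; apply/funext => f.
have [fs|fs] := asboolP (smooth_fun f); last by rewrite /tmap /fpush !smooth_partN.
rewrite /tmap /fpush !smooth_partE// coordvecE.
  by case: ty It => t y It /=; rewrite derive_snd.
by apply: smooth_fun_comp => //; exact: smooth_family_map psis.
Qed.

Lemma derive_curve I psi f t q : open I -> I t -> smooth_family I psi -> smooth_fun f ->
  derivable (fun s : R => f (psi s q) : R^o) t 1.
Proof.
move=> oI It psis fs; have [i iq] := atlas_cover q.
rewrite -(cmapK iq).
apply: (derivable_fst (F := fun ty => f (psi ty.1 (cinv (atlas M i) ty.2)))).
have /Ck_derivable := @family_Ck I psi f i 1 oI psis fs.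
by apply; split => //; exact: cimg_cmap.
Qed.

Lemma curve_push psi f t i y : smooth_fun f ->
  derive1 (fun s : R => f (psi s (cinv (atlas M i) y)) : R^o) t = fpush psi i (1, 0) (t, y) f.
Proof. by move=> fs; rewrite /fpush smooth_partE// derive_fst derive1E. Qed.

Lemma velocity_push psi t i y p : minv (psi t) p = cinv (atlas M i) y ->
  velocity psi t p = fpush psi i (1, 0) (t, y).
Proof.
move=> qE; apply/funext => f.
have [fs|fs] := asboolP (smooth_fun f); last by rewrite /velocity /fpush !smooth_partN.
by rewrite -curve_push// /velocity smooth_partE// qE.
Qed.

Lemma velocity_tangent I psi t p : open I -> I t -> smooth_family I psi ->
  bijective (psi t) -> tangent p (velocity psi t p).
Proof.
move=> oI It psis psib.
have [i iq] := atlas_cover (minv (psi t) p).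
rewrite (@velocity_push psi t i (cmap (atlas M i) (minv (psi t) p))); last by rewrite cmapK.
rewrite -{1}(minvKV psib p) -{1}(cmapK iq).
by apply: (@fpush_tangent I psi i (1, 0) (t, cmap (atlas M i) (minv (psi t) p))) => //;
   exact: cimg_cmap.
Qed.

(** In f(psi_(tau s)(b(q))) the point b(q) is fixed while s varies, and the chain rule
applies to the time change. *)
Lemma velocity_reparam I psi (Th : R -> M -> M) (b : M -> M) (tau : R -> R) t p :
  open I -> I (tau t) -> smooth_family I psi -> bijective (psi (tau t)) -> bijective b ->
  derivable (tau : R -> R^o) t 1 ->
  (\forall s \near t, Th s = psi (tau s) \o b) ->
  velocity Th t p = fun f => derive1 (tau : R -> R^o) t * velocity psi (tau t) p f.
Proof.
move=> oI It psis psib bb taud Thn; apply/funext => f.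
have [fs|fs] := asboolP (smooth_fun f); last by rewrite /velocity !smooth_partN// mulr0.
rewrite /velocity !smooth_partE//.
have -> : minv (Th t) p = minv b (minv (psi (tau t)) p).
  by rewrite (nbhs_singleton Thn) minv_comp.
set q := minv (psi (tau t)) p.
transitivity (derive1 ((fun s => f (psi s q)) \o tau : R -> R^o) t).
  rewrite !derive1E; apply: near_eq_derive; near=> s.
  by have -> : Th s = psi (tau s) \o b; [near: s|rewrite /= minvKV].
rewrite derive1_comp; [by rewrite mulrC| |exact: derive_curve psis fs].
exact: taud.
Unshelve. all: by end_near. Qed.

End Tangent.

(** * The group of symplectomorphisms *)

Section Symplectomorphisms.
Context {R : realType} {n : nat} {M : closedManifold R n}.
Implicit Types (phi psi : M -> M) (p : M) (v w : tvec M).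

Lemma tangent_tmap phi p v : smooth_map phi -> tangent p v -> tangent (phi p) (tmap phi v).
Proof.
move=> phis [v1 v2 v3]; split.
- move=> a f h fs hs; rewrite /tmap !smooth_partE//; last exact: smooth_fun_lin.
  by rewrite -v1//; exact: smooth_fun_comp.
- move=> f h fs hs; rewrite /tmap !smooth_partE//; last exact: smooth_fun_mul.
  by apply: v2; exact: smooth_fun_comp.
- by move=> f fs; rewrite /tmap smooth_partN.
Qed.

Lemma tmap_comp phi psi v : smooth_map phi -> tmap (phi \o psi) v = tmap phi (tmap psi v).
Proof.
move=> phis; apply/funext => f; have [fs|fs] := asboolP (smooth_fun f); last first.
  by rewrite /tmap !smooth_partN.
by rewrite /tmap !smooth_partE//; exact: smooth_fun_comp.
Qed.

Lemma tmap_id p v : tangent p v -> tmap id v = v.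
Proof.
move=> [_ _ v3]; apply/funext => f; have [fs|fs] := asboolP (smooth_fun f).
  by rewrite /tmap smooth_partE.
by rewrite /tmap smooth_partN// v3.
Qed.

Variable omega : tensor2 M.

Lemma symplectomorphism_id : symplectomorphism omega id.
Proof.
split; [by exists id|exact: smooth_map_id| |].
  by rewrite (@minv_eq _ _ _ id id)//; exact: smooth_map_id.
by move=> p v w pv pw; rewrite !(@tmap_id p).
Qed.

Lemma symplectomorphism_comp phi psi : symplectomorphism omega phi ->
  symplectomorphism omega psi -> symplectomorphism omega (phi \o psi).
Proof.
move=> [b1 s1 i1 o1] [b2 s2 i2 o2]; split.
- exact: bij_comp.
- exact: smooth_map_comp.
- by rewrite minv_comp//; exact: smooth_map_comp.
- by move=> p v w pv pw; rewrite (tmap_comp _ _ s1) (tmap_comp _ _ s1) /= o1 ?o2//; exact: tangent_tmap.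
Qed.

Lemma symplectomorphism_minv phi : symplectomorphism omega phi ->
  symplectomorphism omega (minv phi).
Proof.
move=> [b1 s1 i1 o1]; have ib := minv_bij b1.
have iE : minv (minv phi) = phi by apply: minv_eq; [exact: minvKV|exact: minvK].
split => //; first by rewrite iE.
move=> p v w pv pw.
have K : phi \o minv phi = id by apply/funext => q /=; rewrite minvKV.
rewrite -(o1 (minv phi p)); [|exact: tangent_tmap..].
by rewrite -(tmap_comp _ v s1) -(tmap_comp _ w s1) K !(@tmap_id p)// minvKV.
Qed.

End Symplectomorphisms.

(** * The form of a path is closed *)

(** The product rule for the coefficients w_ab A_a B_b of a pulled-back 2-form, at a
time when the Jacobian matrix is the identity: there A and B are Kronecker
deltas, and their derivatives Q and P are multiplied by W. *)
Lemma delta_expand (R : pzRingType) (n : nat) (j k : 'I_n) (W Z : 'I_n -> 'I_n -> R)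
    (P Q : 'I_n -> R) :
  \sum_a \sum_b (W a b * ((a == j)%:R * P b + (b == k)%:R * Q a) +
    (a == j)%:R * (b == k)%:R * Z a b) =
  Z j k + \sum_a W a k * Q a + \sum_b W j b * P b.
Proof.
have dl (l : 'I_n) (f : 'I_n -> R) : \sum_a (a == l)%:R * f a = f l.
  rewrite (bigD1 l)//= eqxx mul1r big1 ?addr0// => a /negbTE ->.
  by rewrite mul0r.
transitivity (\sum_a ((a == j)%:R * (\sum_b W a b * P b) + W a k * Q a +
    (a == j)%:R * Z a k)).
  apply: eq_bigr => a _; rewrite -(dl k (fun b => W a b * Q a)) -(dl k (fun b => Z a b)).
  rewrite !mulr_sumr -!big_split/=; apply: eq_bigr => b _.
  case: (a == j); case: (b == k); rewrite ?(mul1r, mul0r, mulr0, add0r, addr0, mulrDr)//.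
by rewrite !big_split/= !dl addrC (addrC (\sum_b W j b * P b)) addrA.
Qed.

(** One term of Cartan's formula: [a], [b] and [c] are the derivatives of the
coefficients of omega, whose cyclic sum vanishes because omega is closed. *)
Lemma cartan_algebra (R : pzRingType) (x a b c u v s t : R) : c + - a + b = 0 ->
  x * a + u * s - (x * b + v * t) = x * c + u * s + - v * t.
Proof.
move=> /eqP; rewrite -addrA addr_eq0 opprD opprK => /eqP ->.
by rewrite mulrBr opprD mulNr addrACA addrA.
Qed.

Section Closedness.
Context {R : realType} {n : nat} {M : closedManifold R n}.
Local Notation RV := (R^o * 'rV[R]_n)%type.
Implicit Types (i : 'I_(natlas M)) (y : 'rV[R]_n) (p q : M) (I : set R).

Definition preserves (omega : tensor2 M) (phi : M -> M) := forall p v w,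
  tangent p v -> tangent p w -> omega (phi p) (tmap phi v) (tmap phi w) = omega p v w.

Lemma tensor_anti (b : tensor2 M) p u v : is_tensor2 b ->
  (forall v, tangent p v -> b p v v = 0) -> tangent p u -> tangent p v ->
  b p u v = - b p v u.
Proof.
move=> [b1 b2 _] b0 pu pv; have puv := tangent_lin 1 pu pv.
have := b0 _ puv.
rewrite (b1 p 1 u v _ pu pv puv) (b2 p 1 u v u pu pv pu) (b2 p 1 u v v pu pv pv).
rewrite (b0 u pu) (b0 v pv) !mul1r add0r addr0 => /eqP.
by rewrite addr_eq0 => /eqP.
Qed.

Lemma coef2_anti (omega : tensor2 M) i (a b : 'I_n) y :
  symplectic_form omega -> cimg (atlas M i) y ->
  coef2 omega i a b y = - coef2 omega i b a y.
Proof.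
by move=> [ot o0 _ _] iy; apply: tensor_anti => //; [exact: o0|exact: coordvec_tangent..].
Qed.

Variables (omega : tensor2 M) (th : R -> M -> M) (I : set R) (t : R).
Hypotheses (so : symplectic_form omega) (oI : open I) (It : I t)
  (ths : smooth_family I th) (tht : th t = id).

Let ot : is_tensor2 omega. Proof. by case: so. Qed.

Variable i : 'I_(natlas M).

(* In the chart i: the coordinates of the family, those of its velocity at time t, and
   the coefficients of omega. *)
Let th_ (a : 'I_n) (ty : RV) : R := fexpr th i i ty 0 a.
Let X (a : 'I_n) (y : 'rV[R]_n) : R := 'D_((1, 0) : RV) (th_ a : RV -> R^o) (t, y).
Let w_ := coef2 omega i.
Let e (a : 'I_n) : 'rV[R]_n := delta_mx 0 a.
Let De (a : 'I_n) : RV := (0, delta_mx 0 a).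
Let D := fdom I th i i.

Let oD : open D. Proof. by apply: open_fdom; [exact: oI|case: ths]. Qed.

Let thk a k : Ck k D (th_ a). Proof. by case: ths => _ /(_ i i a k). Qed.

Let Dt y : cimg (atlas M i) y -> D (t, y).
Proof. by move=> iy; split => //=; rewrite tht; exact: cimg_cdom. Qed.

Let th_t y : cimg (atlas M i) y -> fexpr th i i (t, y) = y.
Proof. by move=> iy; rewrite /fexpr/= tht cinvK. Qed.

Lemma coef1_path_form (k : 'I_n) y : cimg (atlas M i) y ->
  coef1 (path_form omega th t) i k y = \sum_a X a y * w_ a k y.
Proof.
move=> iy; rewrite /coef1 /path_form tangent_partE; last exact: coordvec_tangent.
rewrite (@velocity_push _ _ _ _ _ i y); last first.
  by rewrite tht (@minv_eq _ _ _ _ id).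
rewrite (fpush_chart _ oI ths (Dt iy)) th_t// tensor_suml//.
- exact: coordvec_tangent.
- by move=> a; exact: coordvec_tangent.
Qed.

Lemma X_smooth a k : Ck k (cimg (atlas M i)) (X a).
Proof.
have := Ck_slice_snd t oD (Ck_D ((1, 0) : RV) (thk a k.+1)).
by apply: Ck_sub => y /Dt.
Qed.

Lemma w_smooth a b k : Ck k (cimg (atlas M i)) (w_ a b).
Proof. by case: ot => _ _ /(_ i a b k). Qed.

Lemma coef1_path_form_smooth k l : Ck l (cimg (atlas M i)) (coef1 (path_form omega th t) i k).
Proof.
have oi := @cimg_open _ _ M i.
apply: (Ck_ext (g := fun y => \sum_a X a y * w_ a k y) oi).
  by move=> y iy; exact: coef1_path_form.
by apply: (Ck_sum _ oi) => a; apply: (Ck_mul oi); [exact: X_smooth|exact: w_smooth].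
Qed.

Hypothesis pres : \forall s \near t, preserves omega (th s).

(** L_X omega = 0 in coordinates: the t-derivative of the coefficients of the
pull-back of omega, which do not depend on t.  The exchange of the t-derivative
with the derivatives of the coordinates is Schwarz's theorem. *)
Lemma lie_derivative_eq0 (j k : 'I_n) y : cimg (atlas M i) y ->
  \sum_a X a y * partial a (w_ j k) y + \sum_a w_ a k y * partial j (X a) y
    + \sum_a w_ j a y * partial k (X a) y = 0.
Proof.
move=> iy; have oi := @cimg_open _ _ M i.
have Dty := Dt iy.
pose A a (ty : RV) := 'D_(De j) (th_ a : RV -> R^o) ty.
pose B a (ty : RV) := 'D_(De k) (th_ a : RV -> R^o) ty.
pose G (ty : RV) := \sum_a \sum_b w_ a b (fexpr th i i ty) * (A a ty * B b ty).
have [U [Uo Ut] Up] : exists2 U : set RV, open U /\ U (t, y) &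
    forall ty, U ty -> D ty /\ preserves omega (th ty.1).
  move: pres; rewrite -[X in X -> _]/(nbhs t [set s | preserves omega (th s)]) nbhsE => -[K [oK Kt] Kp].
  exists (D `&` [set ty : RV | K ty.1]).
    by split; [apply: openI => //; exact: open_fst|split].
  by move=> ty [Dty' /Kp].
have GE ty : U ty -> G ty = w_ j k ty.2.
  move=> /Up[Dy Pt]; have [Is /= iy' jy'] := Dy.
  have tj (b : 'I_n) := @coordvec_tangent _ _ M i b ty.2 iy'.
  rewrite [RHS]/w_ /coef2 -(Pt _ _ _ (tj j) (tj k)).
  rewrite !(tmap_coordvec _ _ oI ths)// !(fpush_chart _ oI ths Dy).
  have pE : th ty.1 (cinv (atlas M i) ty.2) = cinv (atlas M i) (fexpr th i i ty).
    by rewrite /fexpr cmapK.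
  have iF : cimg (atlas M i) (fexpr th i i ty) by exact: cimg_cmap.
  have tF (b : 'I_n) := @coordvec_tangent _ _ M i b _ iF.
  rewrite pE (tensor_suml _ _ ot (tangent_sum _ _ tF) tF).
  apply: eq_bigr => a _; rewrite (tensor_sumr _ _ ot (tF a) tF) mulr_sumr.
  by apply: eq_bigr => b _; rewrite [LHS]mulrC -[LHS]mulrA.
have DG0 : 'D_((1, 0) : RV) (G : RV -> R^o) (t, y) = 0.
  rewrite (near_derive _ Uo Ut GE) (derive_fst (fun ty : RV => w_ j k ty.2)).
  exact: (derive_cst (w_ j k y : R^o)).
have dw a b : is_derive ((t, y) : RV) ((1, 0) : RV) (fun ty => w_ a b (fexpr th i i ty) : R^o)
    (\sum_c X c y * partial c (w_ a b) y).
  have := @is_derive_chain _ _ _ _ _ _ (coordinates_rV n) _ (w_ a b) (fexpr th i i) (t, y) (1, 0)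
    oi (w_smooth a b 1).
  rewrite th_t//; apply => // c.
  exact: (Ck_derivable (thk c 1) Dty).
have dA a : is_derive ((t, y) : RV) ((1, 0) : RV) (A a : RV -> R^o) (partial j (X a) y).
  rewrite /partial /X -(derive_snd (fun ty : RV => 'D_((1, 0) : RV) (th_ a : RV -> R^o) ty)).
  rewrite -/(De j) (Schwarz _ _ oD (thk a 2) Dty).
  by apply: Ck_is_derive Dty; exact: (Ck_D (De j) (thk a 2)).
have dB a : is_derive ((t, y) : RV) ((1, 0) : RV) (B a : RV -> R^o) (partial k (X a) y).
  rewrite /partial /X -(derive_snd (fun ty : RV => 'D_((1, 0) : RV) (th_ a : RV -> R^o) ty)).
  rewrite -/(De k) (Schwarz _ _ oD (thk a 2) Dty).
  by apply: Ck_is_derive Dty; exact: (Ck_D (De k) (thk a 2)).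
have dth (l a : 'I_n) : 'D_(De l) (th_ a : RV -> R^o) (t, y) = (a == l)%:R.
  rewrite derive_snd.
  rewrite (near_derive (g := fun y : 'rV_n => y 0 a) _ oi iy); last first.
    by move=> z iz; rewrite /th_ th_t.
  have [_ ->] : is_derive y (e l) (fun y : 'rV[R]_n => y 0 a : R^o) ((a == l)%:R).
    have := @is_derive_linear _ _ (fun y : 'rV[R]_n => y 0 a) y (e l).
    by rewrite /e [X in is_derive _ _ _ X]mxE eqxx; apply=> c z z'; rewrite !mxE.
  by [].
have dG := is_derive_sump (index_enum 'I_n) (fun a => is_derive_sump (index_enum 'I_n)
  (fun b => is_derive_mulp (dw a b) (is_derive_mulp (dA a) (dB b)))).
move: DG0; have [_ ->] := dG.
rewrite th_t// /A /B => E0.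
rewrite -[RHS]E0.
under [RHS]eq_bigr do under eq_bigr do rewrite !dth.
by rewrite delta_expand.
Qed.

(** d(i_X omega) = L_X omega - i_X d(omega), and both terms on the right vanish. *)
Lemma path_form_closed_chart (j k : 'I_n) y : cimg (atlas M i) y ->
  partial j (coef1 (path_form omega th t) i k) y =
  partial k (coef1 (path_form omega th t) i j) y.
Proof.
move=> iy; have oi := @cimg_open _ _ M i.
have dcoef l m : partial l (coef1 (path_form omega th t) i m) y =
    \sum_a (X a y * partial l (w_ a m) y + w_ a m y * partial l (X a) y).
  rewrite /partial (near_derive _ oi iy (g := fun y => \sum_a X a y * w_ a m y)); last first.
    by move=> z iz; exact: coef1_path_form.
  have [_ ->] := is_derive_sump (index_enum 'I_n) (fun a => is_derive_mulp
    (Ck_is_derive (e l) (X_smooth a 1) iy) (Ck_is_derive (e l) (w_smooth a m 1) iy)).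
  by [].
have dw_anti a b c : partial a (w_ b c) y = - partial a (w_ c b) y.
  rewrite /partial (near_derive _ oi iy (g := fun y => - w_ c b y)); last first.
    by move=> z iz; exact: coef2_anti.
  by have [_ ->] := is_derive_oppp (Ck_is_derive (e a) (w_smooth c b 1) iy).
apply/eqP; rewrite -subr_eq0 !dcoef -sumrB; apply/eqP.
rewrite -[RHS](lie_derivative_eq0 j k iy) -!big_split/=.
apply: eq_bigr => a _.
have [_ _ _ dom] := so.
have := dom i a j k y iy; rewrite -/w_ (dw_anti j k a).
rewrite (coef2_anti j a so iy : w_ j a y = - w_ a j y).
exact: cartan_algebra.
Qed.

End Closedness.

Section PathForm.
Context {R : realType} {n : nat} {M : closedManifold R n}.
Variables (omega : tensor2 M).
Hypothesis so : symplectic_form omega.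

Lemma path_form_lin (psi : R -> M -> M) t :
  (forall p, tangent p (velocity psi t p)) ->
  (forall p (a : R) v w, tangent p v -> tangent p w ->
     path_form omega psi t p (fun f => a * v f + w f) =
     a * path_form omega psi t p v + path_form omega psi t p w) /\
  (forall p v, ~ tangent p v -> path_form omega psi t p v = 0).
Proof.
case: so => -[b1 b2 _] _ _ _ vt; split => [p a v w pv pw|p v pv]; last exact: tangent_partN.
by rewrite /path_form !tangent_partE//; [exact: b2|exact: tangent_lin].
Qed.

(** Translated on the right by psi_t^-1, the path passes through the identity at time
t and one chart suffices.  The end points of [0, 1] are excluded because the path
consists of symplectomorphisms on [0, 1] only, and L_X omega = 0 is obtained by
differentiating at an interior time. *)
Lemma path_form_closed (psi : R -> M -> M) t :
  symp_path omega psi -> 0 < t < 1 -> closed_forms M (path_form omega psi t).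
Proof.
move=> [p0 psy [eps eps0 psis]] /andP[t0 t1].
have t01 : 0 <= t <= 1 by rewrite !ltW.
pose I := `]- eps, 1 + eps[%classic.
have oI : open I by exact: interval_open.
have It : I t by rewrite /I/= in_itv/=; apply/andP; split; lra.
have [pb ps pis _] := psy t t01.
pose th s := psi s \o minv (psi t).
have ths : smooth_family I th.
  have := @smooth_family_comp _ _ M I setT I psi (fun=> minv (psi t)) id (fun=> 0) oI openT oI psis.
  apply => //.
  - by apply: smooth_map_family; [exact: openT|exact: pis].
  - by move=> k; exact: Ck_id.
  - by move=> k; exact: Ck_cst.
have tht : th t = id by apply/funext => p; rewrite /th/= minvKV.
have pfE : path_form omega psi t = path_form omega th t.
  apply/funext => p; apply/funext => v; rewrite /path_form; congr (tangent_part _ p v).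
  apply/funext => {}p; apply/funext => {}v; congr (omega p _ v).
  apply/funext => f; rewrite /velocity tht; congr (smooth_part _ f).
  by apply/funext => g; rewrite (@minv_eq _ _ _ id id).
have pres : \forall s \near t, preserves omega (th s).
  have : \forall s \near t, s \in `]0, 1[ by apply: near_in_itvoo; rewrite in_itv/= t0.
  apply: filterS => s; rewrite in_itv/= => /andP[s0 s1].
  have s01 : 0 <= s <= 1 by rewrite !ltW.
  have [_ _ _ pr] : symplectomorphism omega (th s).
    by apply: symplectomorphism_comp; [exact: psy|apply: symplectomorphism_minv; exact: psy].
  exact: pr.
rewrite pfE; split.
  have thb : bijective (th t) by rewrite tht; exists id.
  have [l1 l2] := @path_form_lin th t (fun p => velocity_tangent p oI It ths thb).
  split; [exact: l1|exact: l2|move=> i k l].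
  exact: (coef1_path_form_smooth so oI It ths tht i k l).
by move=> i j k y iy; exact: (path_form_closed_chart so oI It ths tht pres j k iy).
Qed.

End PathForm.

(** * A smooth step function *)

Section OneVariable.
Context {R : realType}.

Lemma derive_scale1 (f : R -> R) (x v : R) : derivable (f : R -> R^o) x 1 ->
  is_derive x v (f : R^o -> R^o) (v * derive1 (f : R -> R^o) x).
Proof.
move=> /derivable1_diffP fd; apply: DeriveDef; first exact: diff_derivable.
rewrite derive1E !deriveE//.
have -> : v = v *: (1 : R) by rewrite [_ *: _]mulr1.
by rewrite linearZ/= [_ *: 1]mulr1.
Qed.

(** By induction on k for all members of the family at once, since the derivative of a
member is a combination of two members. *)
Lemma smooth_family1 (I : Type) (F : I -> R -> R) (a b : I -> R) (s t : I -> I) :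
  (forall i x, is_derive x (1 : R) (F i : R -> R^o) (a i * F (s i) x + b i * F (t i) x)) ->
  forall i, smooth_on (E := R^o) setT (F i).
Proof.
move=> dF i k; elim: k i => [|k ih] i.
  split=> // x _; apply: differentiable_continuous; apply/derivable1_diffP.
  by have [] := dF i x.
have cF x : {for x, continuous (F i : R^o -> R)}.
  by apply: differentiable_continuous; apply/derivable1_diffP; have [] := dF i x.
have dF' (v x : R) : is_derive x v (F i : R^o -> R^o) (v * (a i * F (s i) x + b i * F (t i) x)).
  by have [d e] := dF i x; have := derive_scale1 v d; rewrite derive1E e.
apply: CkS; [by move=> x _; exact: cF|by move=> v x _; have [] := dF' v x|move=> v].
apply: (Ck_ext (g := fun x : R^o => v * (a i * F (s i) x + b i * F (t i) x))).
- exact: openT.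
- by move=> x _; have [] := dF' v x.
apply: (Ck_mul openT); first exact: Ck_cst.
by apply: (Ck_add openT); apply: (Ck_mul openT); [exact: Ck_cst|exact: ih|exact: Ck_cst|exact: ih].
Qed.

End OneVariable.

Section Flat.
Context {R : realType}.

(** t^-m exp(-1/t), extended by 0 to the negative half-line: the derivatives of
the flat function exp(-1/t) are combinations of these. *)
Definition flat (m : nat) (t : R) : R :=
  if 0 < t then t ^- m * expR (- t^-1) else 0.

Lemma flat_ge0 m t : 0 <= flat m t.
Proof. by rewrite /flat; case: ifP => // t0; rewrite mulr_ge0 ?expR_ge0// invr_ge0 exprn_ge0// ltW. Qed.

Lemma flat_gt0 m t : 0 < t -> 0 < flat m t.
Proof. by move=> t0; rewrite /flat t0 mulr_gt0 ?expR_gt0// invr_gt0 exprn_gt0. Qed.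

Lemma flat_le0 m t : t <= 0 -> flat m t = 0.
Proof. by move=> t0; rewrite /flat ltNge t0. Qed.

(** From u^(m+1) / (m+1)! <= exp u at u = 1/t; applied to [flat] of index m+1 it bounds
the difference quotient of [flat m] at 0. *)
Lemma flat_le m t : flat m t <= (m.+1)`!%:R * `|t|.
Proof.
rewrite /flat; case: ifPn => [t0|_]; last by rewrite mulr_ge0.
have ti0 : 0 <= t^-1 by rewrite invr_ge0 ltW.
have := expR_ge1Dxn m ti0 => le1.
have le2 : t ^- m.+1 <= (m.+1)`!%:R * expR t^-1.
  rewrite -ler_pdivrMl ?ltr0n ?fact_gt0//; apply: le_trans le1.
  by rewrite mulrC exprVn lerDr.
rewrite expRN gtr0_norm// ler_pdivrMr ?expR_gt0// mulrAC.
rewrite -ler_pdivrMr//; apply: le_trans le2.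
by rewrite exprS invfM mulrC.
Qed.

Lemma is_derive_flat m t : is_derive t (1 : R) (flat m : R -> R^o)
  (1 * flat m.+2 t + (- m%:R) * flat m.+1 t).
Proof.
have [t0|t0|->] := ltgtP t 0.
- rewrite !flat_le0 ?ltW// !mulr0 addr0.
  apply: (@near_eq_is_derive _ _ _ (cst (0 : R^o) : R -> R^o)).
    by near=> s; rewrite /= flat_le0//; apply: ltW; near: s; exact: lt_nbhsl.
- apply: (@near_eq_is_derive _ _ _ (fun t : R => t^-1 ^+ m * expR (- t^-1) : R^o)).
    by near=> s; rewrite /flat ifT ?exprVn//; near: s; exact: lt_nbhsr.
  have di : is_derive t (1 : R) (fun t : R => t^-1 : R^o) (- (t^-1 * t^-1)).
    have := @is_deriveV R id t 1 1 (lt0r_neq0 t0) (is_derive_id _ _).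
    by rewrite [_ *: _]mulr1 expr2 invfM.
  have dX : is_derive t (1 : R) (fun t : R => t^-1 ^+ m : R^o)
      (m%:R * t^-1 ^+ m.-1 * - (t^-1 * t^-1)).
    have dP (x : R) : is_derive x (1 : R) (fun x : R => x ^+ m) (m%:R * x ^+ m.-1).
      apply: DeriveDef; first exact: exprn_derivable.
      by rewrite exp_derive [_ *: 1]mulr1.
    exact: (is_derive1_comp (dP t^-1) di).
  have dE : is_derive t (1 : R) (fun t : R => expR (- t^-1) : R^o)
      (expR (- t^-1) * - - (t^-1 * t^-1)).
    exact: (is_derive1_comp (is_derive_expR _) (is_derive_oppp di)).
  apply: is_derive_eq (is_derive_mulp dX dE) _.
  rewrite /flat t0 -!exprVn; set u := t^-1; set E := expR (- u).
  clear dX; case: m => [|m] /=; rewrite !exprS ?expr0; ring.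
- rewrite !flat_le0// !mulr0 addr0.
  have q0 : h^-1 *: (flat m (h *: 1 + 0) - flat m 0 : R^o) @[h --> (0:R)^'] --> (0 : R^o).
    have c0 : (m.+2)`!%:R * `|h| @[h --> (0:R)^'] --> (0:R).
      rewrite -[X in _ --> X](mulr0 (m.+2)`!%:R); apply: cvgM; first exact: cvg_cst.
      have := @norm_continuous R R^o 0; rewrite /continuous_at normr0 => H.
      by apply: cvg_trans H; apply: cvg_app; exact: nbhs_dnbhs.
    apply/cvgr0Pnorm_lt => eps eps0.
    have /cvgr0Pnorm_lt/(_ _ eps0) := c0; apply: filterS => h.
    apply: le_lt_trans; rewrite [X in _ <= X]ger0_norm ?mulr_ge0//.
    rewrite [_%:A]mulr1 addr0 (@flat_le0 m 0)// subr0.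
    apply: le_trans (flat_le m.+1 h).
    have [h0|h0] := ltP 0 h; last by rewrite flat_le0// scaler0 normr0 flat_ge0.
    rewrite /flat h0 ger0_norm.
      by rewrite exprS invfM -mulrA.
    apply: mulr_ge0; first by rewrite invr_ge0 ltW.
    by rewrite mulr_ge0 ?invr_ge0 ?exprn_ge0 ?expR_ge0 ?ltW.
  by apply: DeriveDef; [apply/cvg_ex; exists (0 : R^o)|apply: cvg_lim].
Unshelve. all: by end_near. Qed.

Lemma flat_smooth m : smooth_on (E := R^o) setT (flat m).
Proof. exact: (smooth_family1 is_derive_flat). Qed.

(** The usual smooth step: 0 before 0, 1 after 1, and increasing in between. *)
Definition sstep (t : R) := flat 0 t / (flat 0 t + flat 0 (1 - t)).

Lemma sstep_den t : 0 < flat 0 t + flat 0 (1 - t).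
Proof.
have [t0|t0] := ltP 0 t; first by rewrite ltr_wpDr ?flat_ge0// flat_gt0.
by rewrite ltr_wpDl ?flat_ge0// flat_gt0//; lra.
Qed.

Lemma sstep01 t : 0 <= sstep t <= 1.
Proof.
have d0 := sstep_den t; rewrite /sstep divr_ge0 ?flat_ge0 ?(ltW d0)//=.
by rewrite ler_pdivrMr// mul1r lerDl flat_ge0.
Qed.

Lemma sstep_le0 t : t <= 0 -> sstep t = 0.
Proof. by move=> t0; rewrite /sstep flat_le0// mul0r. Qed.

Lemma sstep_ge1 t : 1 <= t -> sstep t = 1.
Proof.
move=> t1; have := sstep_den t; rewrite /sstep (@flat_le0 _ (1 - t)) ?addr0; last by lra.
by move=> d0; rewrite divff// gt_eqF.
Qed.

Lemma sstep_smooth : smooth_on (E := R^o) setT sstep.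
Proof.
move=> k; have oT := @openT R^o.
have f1 : Ck k (setT : set R^o) (fun t : R^o => flat 0 (1 - t)).
  apply: (Ck_comp1 (g := fun t : R^o => 1 - t) oT oT) => //; last exact: flat_smooth.
  by apply: (Ck_add oT); [exact: Ck_cst|apply: (Ck_opp oT); exact: Ck_id].
apply: (Ck_mul oT); first exact: flat_smooth.
apply: (Ck_inv oT) => [t _|]; first by rewrite gt_eqF// sstep_den.
by apply: (Ck_add oT) => //; exact: flat_smooth.
Qed.

Lemma is_derive_sstep t : is_derive t (1 : R) (sstep : R -> R^o)
  ((flat 2 t * flat 0 (1 - t) + flat 0 t * flat 2 (1 - t)) / (flat 0 t + flat 0 (1 - t)) ^+ 2).
Proof.
have dA := is_derive_flat 0 t.
have d1 : is_derive t (1 : R) (fun t : R => 1 - t : R^o) (0 + - 1) by exact: is_derive_addp.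
have dB := @is_derive1_comp R (flat 0) (fun t : R => 1 - t) t _ _ (is_derive_flat 0 (1 - t)) d1.
have d0 : flat 0 t + flat 0 (1 - t) != 0 by rewrite gt_eqF// sstep_den.
have := is_derive_mulp dA (@is_deriveV R (fun t => flat 0 t + flat 0 (1 - t)) t _ _ d0 (is_derive_addp dA dB)).
move=> D; apply: is_derive_eq D _; rewrite /GRing.scale/= -[_ ^- 2]/(((flat 0 t + flat 0 (1 - t)) ^+ 2)^-1).
by field.
Qed.

Lemma derive_sstep_ge0 t : 0 <= derive1 (sstep : R -> R^o) t.
Proof.
have [_] := is_derive_sstep t; rewrite derive1E => ->.
by rewrite divr_ge0 ?exprn_ge0 ?addr_ge0 ?mulr_ge0 ?flat_ge0.
Qed.

Lemma derive_sstep_gt0 t : 0 < t < 1 -> 0 < derive1 (sstep : R -> R^o) t.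
Proof.
move=> /andP[t0 t1]; have [_] := is_derive_sstep t; rewrite derive1E => ->.
rewrite divr_gt0 ?exprn_gt0 ?sstep_den// addr_gt0 ?mulr_gt0 ?flat_gt0//; lra.
Qed.

End Flat.

(** * Substitution in lower integrals *)

Section LowerIntegral.
Local Open Scope ereal_scope.
Context {R : realType}.
Local Notation mu := (@lebesgue_measure R).
Implicit Types (D : set R) (f g : R -> \bar R).

(** The integral of a nonnegative function is a supremum over the simple functions
below it, so it is monotone whether or not the functions are measurable. *)
Lemma ge0_le_integral_nonmeasurable D f g : (forall x, D x -> 0 <= f x) ->
  (forall x, D x -> f x <= g x) ->
  \int[mu]_(x in D) f x <= \int[mu]_(x in D) g x.
Proof.
move=> f0 fg; rewrite !ge0_integralE//; last first.
  by move=> x Dx; apply: le_trans (fg x Dx); exact: f0.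
apply: le_ereal_sup => _ [h hf <-]; exists h => // x; apply: le_trans (hf x) _.
by rewrite /patch; case: ifPn => // /set_mem /fg.
Qed.

Section Simple.
Import HBNNSimple.

(** A simple function is a finite combination of indicators, for which the
substitution rule is the last hypothesis. *)
Lemma simple_change D (D' : set R) (chi w : R -> R) (h : {nnsfun measurableTypeR R >-> R}) :
  measurable D -> measurable D' ->
  measurable_fun [set: R] chi -> measurable_fun [set: R] w -> (forall t, (0 <= w t)%R) ->
  (forall A, measurable A ->
     \int[mu]_(t in D) (w t * \1_A (chi t))%:E = mu (A `&` D')) ->
  \int[mu]_(t in D) (w t * h (chi t))%:E = \int[mu]_(s in D') (h s)%:E.
Proof.
move=> mD mD' mchi mw w0 H.
have mk k : measurable (h @^-1` [set k]) by exact: measurable_funPTI.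
have mwk k : measurable_fun D (EFin \o (fun t => w t * \1_(h @^-1` [set k]) (chi t))%R).
  apply/measurable_EFinP; apply: measurable_funTS; apply: measurable_funM => //.
  by apply: measurableT_comp mchi; apply: measurable_indic; exact: mk.
transitivity (\sum_(k \in range h) \int[mu]_(t in D)
    (k%:E * (w t * \1_(h @^-1` [set k]) (chi t))%:E)).
  rewrite -ge0_integral_fsum//.
  - apply: eq_integral => t _.
    rewrite [in LHS](fimfunE h) EFinM -fsumEFin// ge0_mule_fsumr//.
      by apply: eq_fsbigr => k _; rewrite -!EFinM mulrCA.
    by move=> k; rewrite nnfun_muleindic_ge0.
  - by move=> k; apply: measurable_funeM; exact: mwk.
  - move=> k t Dt; rewrite EFinM muleCA; apply: mule_ge0; first by rewrite lee_fin.
    by rewrite nnfun_muleindic_ge0.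
transitivity (\sum_(k \in range h) \int[mu]_(s in D') (k * \1_(h @^-1` [set k]) s)%:E).
  apply: eq_fsbigr => k /set_mem[x _ <-].
  rewrite ge0_integralZl_EFin//.
  - rewrite (H _ (mk (h x))); have := @integralZl_indic_nnsfun _ _ R mu D' mD' h (h x).
    by move=> ->; rewrite integral_indic//; exact: mk.
  - by move=> t _; rewrite lee_fin mulr_ge0.
  - exact: (mwk (h x)).
rewrite -ge0_integral_fsum//.
- by apply: eq_integral => x _; rewrite fsumEFin// -fimfunE.
- by move=> r; exact/measurable_EFinP/measurable_funM.
- by move=> r x _; rewrite nnfun_muleindic_ge0.
Qed.

End Simple.

Import HBNNSimple.

(** The weight [w] turns the measure of D, transported by [chi], into the measure
of D'; the hypothesis for indicators extends to measurable functions by monotone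
convergence. *)
Lemma weighted_change D (D' : set R) (chi w : R -> R) g :
  measurable D -> measurable D' ->
  measurable_fun [set: R] chi -> measurable_fun [set: R] w -> (forall t, (0 <= w t)%R) ->
  (forall A, measurable A ->
     \int[mu]_(t in D) (w t * \1_A (chi t))%:E = mu (A `&` D')) ->
  measurable_fun [set: R] g -> (forall x, 0 <= g x) ->
  \int[mu]_(t in D) ((w t)%:E * g (chi t)) = \int[mu]_(s in D') g s.
Proof.
move=> mD mD' mchi mw w0 H mg g0.
pose f_ := @nnsfun_approx _ (measurableTypeR R) R setT measurableT g mg.
have cf x : EFin \o (fun n => f_ n x) @ \oo --> g x by apply: cvg_nnsfun_approx => // y _.
have ndf x : nondecreasing_seq (fun n => f_ n x).
  by move=> m n mn; exact/lefP/nd_nnsfun_approx.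
transitivity (limn (fun n => \int[mu]_(s in D') (f_ n s)%:E)); last first.
  rewrite -monotone_convergence//.
  - by apply: eq_integral => y _; apply/cvg_lim => //; exact: cf.
  - by move=> n; apply/measurable_EFinP; apply: measurable_funTS; exact/measurable_funP.
  - by move=> n y _; rewrite lee_fin; exact: fun_ge0.
  - by move=> y _ m n mn; rewrite lee_fin; exact: ndf.
rewrite [X in _ = limn X](_ : _ = fun n => \int[mu]_(t in D) (w t * f_ n (chi t))%:E).
  have mwf n : measurable_fun D (EFin \o (fun t => w t * f_ n (chi t))%R).
    apply/measurable_EFinP; apply: measurable_funTS; apply: measurable_funM => //.
    by apply: (measurableT_comp (f := f_ n) _ mchi); exact: measurable_funP.
  rewrite -monotone_convergence//.
  - apply: eq_integral => t _; apply/esym/cvg_lim => //.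
    by apply: cvg_trans (cvgeZl (y := (w t)%:E) _ (cf (chi t))).
  - by move=> n y _; rewrite lee_fin mulr_ge0//; exact: fun_ge0.
  - by move=> y _ m n mn; rewrite lee_fin ler_wpM2l//; exact: ndf.
by apply/funext => n; rewrite (simple_change (D' := D')).
Qed.

(** The integral of a nonnegative function which need not be measurable is the
supremum of the integrals of the simple functions below it; these can be
transported by [tau], the inverse of [chi]. *)
Lemma lower_change D (D' : set R) (chi tau w f : R -> R) :
  measurable D -> measurable D' ->
  measurable_fun [set: R] chi -> measurable_fun [set: R] tau ->
  measurable_fun [set: R] w -> (forall t, (0 <= w t)%R) -> (forall t, D t -> (0 < w t)%R) ->
  (forall t, D t -> D' (chi t) /\ tau (chi t) = t) ->
  (forall s, D' s -> D (tau s) /\ chi (tau s) = s) ->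
  (forall A, measurable A ->
     \int[mu]_(t in D) (w t * \1_A (chi t))%:E = mu (A `&` D')) ->
  (forall s, D' s -> (0 <= f s)%R) ->
  \int[mu]_(t in D) (w t * f (chi t))%:E <= \int[mu]_(s in D') (f s)%:E.
Proof.
move=> mD mD' mchi mtau mw w0 wD DD' D'D H f0.
rewrite ge0_integralE; last first.
  by move=> t Dt; rewrite lee_fin mulr_ge0//; apply: f0; have [] := DD' t Dt.
apply: ge_ereal_sup => _ [h hle <-].
pose gr s := (h (tau s) * (w (tau s))^-1 * \1_D' s)%R.
have gr0 s : (0 <= gr s)%R by rewrite /gr !mulr_ge0// ?invr_ge0.
have mgr : measurable_fun [set: R] (EFin \o gr).
  apply/measurable_EFinP; apply: measurable_funM.
    apply: measurable_funM.
      by apply: (measurableT_comp (f := h) _ mtau); exact: measurable_funP.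
    have -> : (fun s => (w (tau s))^-1%R) = (fun s => powR ((w \o tau) s) (-1)).
      by apply/funext => s; rewrite /= powR_inv1.
    apply: (measurableT_comp (f := @powR R ^~ (-1)%R)); first exact: measurable_powR.
    exact: (measurableT_comp (f := w)).
  by apply: measurable_indic.
have hD t : ~ D t -> h t = 0%R.
  move=> nD; apply/eqP; rewrite eq_le fun_ge0 andbT -lee_fin.
  by have := hle t; rewrite /patch; case: ifPn => // /set_mem.
have <- : \int[mu]_(t in D) ((w t)%:E * (EFin \o gr) (chi t)) = sintegral mu h.
  have := @integral_nnsfun _ (measurableTypeR R) R mu setT measurableT h.
  rewrite patch_setT => <-; rewrite [LHS]integral_mkcond; apply: eq_integral => t _.
  rewrite /patch; case: ifPn => [/set_mem Dt|/negP nD]; last first.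
    by rewrite hD// => Dt; apply: nD; exact: mem_set.
  have [D'c tc] := DD' t Dt.
  rewrite /= -EFinM /gr tc indicE mem_set// mulr1 mulrC mulfVK//.
  by rewrite gt_eqF//; exact: wD.
rewrite (weighted_change mD mD' mchi mw w0 H mgr)//.
apply: ge0_le_integral_nonmeasurable => s D's; first by rewrite lee_fin.
have [Dt ct] := D'D s D's.
rewrite /= lee_fin /gr indicE mem_set// mulr1 ler_pdivrMr ?wD//.
have := hle (tau s); rewrite /patch mem_set// lee_fin ct mulrC; exact.
Qed.

End LowerIntegral.

Section ChangeMeasure.
Context {R : realType}.
Local Notation mu := (@lebesgue_measure R).

(** The measure of density [w] on D, transported by [chi]. *)
Definition wmeas (D : set (measurableTypeR R)) (chi : measurableTypeR R -> measurableTypeR R)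
    (w : R -> R) (A : set (measurableTypeR R)) : \bar R :=
  (\int[mu]_(t in D `&` chi @^-1` A) (w t)%:E)%E.

Lemma integral_indic_comp (D : set R) (chi w : R -> R) (A : set R) :
  (\int[mu]_(t in D) (w t * \1_A (chi t))%:E = wmeas D chi w A)%E.
Proof.
rewrite /wmeas [RHS]integral_mkcondr; apply: eq_integral => t _.
rewrite /patch indicE; case: ifPn => [/set_mem cA|nA].
  by rewrite mem_set// mulr1.
have -> : chi t \in A = false by apply/negbTE; apply: contra nA; rewrite !inE.
by rewrite mulr0.
Qed.

Section WMeasure.
Variables (D : set (measurableTypeR R)) (chi : measurableTypeR R -> measurableTypeR R)
  (w : R -> R).
Hypotheses (mD : measurable D) (mchi : measurable_fun setT chi)
  (mw : measurable_fun [set: R] w) (w0 : forall t, 0 <= w t).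

Let m0 : wmeas D chi w set0 = 0%E.
Proof. by rewrite /wmeas preimage_set0 setI0 integral_set0. Qed.

Let m_ge0 A : (0 <= wmeas D chi w A)%E.
Proof. by apply: integral_ge0 => t _; rewrite lee_fin. Qed.

Let m_sigma : semi_sigma_additive (wmeas D chi w).
Proof.
move=> F mF tF mUF; rewrite /wmeas preimage_bigcup setI_bigcupr ge0_integral_bigcup//.
- apply: is_cvg_ereal_nneg_natsum_cond => n _ _.
  by apply: integral_ge0 => t _; rewrite lee_fin.
- by move=> k; apply: measurableI => //; rewrite -(setTI (_ @^-1` _)); exact: mchi.
- by apply/measurable_EFinP; exact: measurable_funTS.
- by move=> t _; rewrite lee_fin.
- apply/trivIset_setIl/trivIsetP => /= i j _ _ ij; rewrite -preimage_setI.
  by move/trivIsetP : tF => /(_ _ _ _ _ ij) ->//; rewrite preimage_set0.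
Qed.

Definition wmeasure_mixin := isMeasure.Build _ (measurableTypeR R) R (wmeas D chi w) m0 m_ge0 m_sigma.

(** Sigma-finite measures are determined by their values on half-open intervals. *)
Lemma wmeas_unique (D' : set R) : measurable D' ->
  (forall x y, wmeas D chi w `]x, y] = mu (`]x, y] `&` D')) ->
  forall A, measurable A -> wmeas D chi w A = mu (A `&` D').
Proof.
move=> mD' itvE A mA.
pose nu : {measure set (measurableTypeR R) -> \bar R} := HB.pack (wmeas D chi w) wmeasure_mixin.
pose nu' := mrestr mu mD'.
rewrite -[LHS]/(nu A) -[RHS]/(nu' A).
apply: (@measure_unique _ R (measurableTypeR R) (@ocitv R) (fun k => `]- (k%:R), k%:R]%classic)) => //.
- exact: ocitvI.
- by move=> k; exact: is_ocitv.
- exact: bigcup_itvT.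
- by move=> _ [[x y] _ <-]; exact: itvE.
- move=> k; rewrite /= itvE; apply: (@le_lt_trans _ _ (mu `](- (k%:R)), k%:R])).
    by apply: le_measure; rewrite ?inE//; exact: measurableI.
  by rewrite lebesgue_measure_itv/=; case: ifP => _; rewrite ?ltry.
Qed.

End WMeasure.

Lemma reflection_measure (A : set R) : measurable A ->
  mu ((fun t : R => 1 - t) @^-1` A) = mu A.
Proof.
move=> mA.
have monem : measurable_fun [set: measurableTypeR R] (fun t : R => 1 - t : measurableTypeR R).
  by apply: measurable_funB.
pose phi_mixin := isMeasurableFun.Build _ _ _ _ _ monem.
pose phi : {mfun measurableTypeR R >-> measurableTypeR R} := HB.pack (fun t : R => 1 - t : measurableTypeR R) phi_mixin.
rewrite -[LHS]/(pushforward mu phi A).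
apply/esym/lebesgue_measure_unique => //= _ [[a b]] _ <-.
rewrite /pushforward.
have -> : phi @^-1` `]a, b] = `[1 - b, 1 - a[%classic.
  by apply/seteqP; split=> t /=; rewrite !in_itv/= => /andP[? ?]; apply/andP; split; lra.
rewrite !lebesgue_measure_itv/= !lte_fin.
rewrite (_ : (1 - b < 1 - a) = (a < b)); last by apply/idP/idP; lra.
by case: ifP => // _; rewrite -!EFinB; congr (_%:E); ring.
Qed.

End ChangeMeasure.

Section Substitution.
Context {R : realType}.
Local Notation mu := (@lebesgue_measure R).

(** The change of variables t |-> 1 - t, used to run paths backwards. *)
Lemma lower_reflection (f : R -> R) : (forall s, 0 < s < 1 -> 0 <= f s) ->
  (\int[mu]_(t in `]0%R, 1%R[) (f (1 - t))%:E <= \int[mu]_(s in `]0%R, 1%R[) (f s)%:E)%E.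
Proof.
move=> f0; pose D : set R := `]0, 1[%classic.
have mD : measurable D by exact: measurable_itv.
have monem : measurable_fun [set: R] (fun t : R => 1 - t) by apply: measurable_funB.
have DD t : D t -> D (1 - t) by rewrite /D/= !in_itv/= => /andP[? ?]; apply/andP; split; lra.
rewrite (@eq_integral _ (measurableTypeR R) R mu _ (fun t : R => (1 * f (1 - t))%:E)); last by move=> t _; rewrite mul1r.
apply: (@lower_change R D D (fun t => 1 - t) (fun t => 1 - t) (fun=> 1) f mD mD monem monem) => //.
- by move=> t Dt; split; [exact: DD|ring].
- by move=> t Dt; split; [exact: DD|ring].
- move=> A mA; rewrite integral_indic_comp /wmeas integral_cst ?mul1e; last first.
    by apply: measurableI => //; rewrite -(setTI (_ @^-1` _)); exact: monem.
  rewrite -[RHS]reflection_measure; last exact: measurableI.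
  congr (mu _); apply/seteqP; split => t /= [? Dt]; split => //; first exact: DD.
  by rewrite (_ : t = 1 - (1 - t)); [exact: DD|ring].
Qed.

Section Increasing.
Variables (a b : R) (chi : R -> R).
Hypotheses (ab : a < b) (dchi : forall t, derivable (chi : R -> R^o) t 1)
  (cchi : continuous (derive1 chi))
  (chi0 : forall t, 0 <= derive1 chi t) (chip : forall t, a < t < b -> 0 < derive1 chi t)
  (chia : chi a = 0) (chib : chi b = 1).

Let contchi : continuous chi.
Proof. by move=> t; apply: differentiable_continuous; exact/derivable1_diffP. Qed.

Let wcont c d : {within `[c, d], continuous chi}.
Proof. exact: continuous_subspaceT. Qed.

Let chi_incr t u : a <= t -> t < u -> u <= b -> chi t < chi u.
Proof.
move=> at_ tu ub; apply: (@gtr0_derive1_lt_cc R chi t u) => //.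
- by move=> x; rewrite in_itv/= => /andP[? ?]; apply: chip; apply/andP; split; lra.
- by rewrite in_itv/= lexx ltW.
- by rewrite in_itv/= lexx ltW.
Qed.

(* The inverse of chi on ]0, 1[, extended to a monotone, hence measurable, function on R
   by means of a retraction of R onto [0, 1]. *)
Let clip (s : R) := Num.min 1 (Num.max 0 s).
Let clip01 s : 0 <= clip s <= 1.
Proof. by rewrite /clip le_min ge_min lexx ler01/= le_max lexx. Qed.
Let clip_id s : 0 <= s <= 1 -> clip s = s.
Proof. by move=> /andP[s0 s1]; rewrite /clip max_r// min_r. Qed.
Let clip_mono s u : s <= u -> clip s <= clip u.
Proof.
by move=> su; rewrite /clip le_min ge_min lexx/= ge_min; apply/orP; right; rewrite ge_max !le_max lexx su orbT.
Qed.

Let tau s := xget a [set t | a <= t <= b /\ chi t = clip s].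
Let tauP s : a <= tau s <= b /\ chi (tau s) = clip s.
Proof.
have c01 := clip01 s; rewrite /tau; case: xgetP => [t -> //|H]; exfalso.
have [|t] := @IVT R chi a b (clip s) (ltW ab) (@wcont a b).
  by rewrite chia chib min_l ?max_r.
by rewrite in_itv/= => tab tE; apply: (H t).
Qed.

Let chi_inj t u : a <= t <= b -> a <= u <= b -> chi t = chi u -> t = u.
Proof.
move=> /andP[at_ tb] /andP[au ub] tu; have [h|h|//] := ltgtP t u.
- by have := chi_incr at_ h ub; rewrite tu ltxx.
- by have := chi_incr au h tb; rewrite tu ltxx.
Qed.

Let chi_lt t u : a <= t <= b -> a <= u <= b -> (chi t < chi u) = (t < u).
Proof.
move=> /andP[at_ tb] /andP[au ub]; have [h|h|->] := ltgtP t u.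
- by rewrite chi_incr.
- by apply/negbTE; rewrite -leNgt ltW// chi_incr.
- by rewrite ltxx.
Qed.

Let chi_le t u : a <= t <= b -> a <= u <= b -> (chi t <= chi u) = (t <= u).
Proof. by move=> tab uab; rewrite !leNgt chi_lt. Qed.

Let tau_nd : nondecreasing_fun tau.
Proof.
move=> s u su; have [sab sE] := tauP s; have [uab uE] := tauP u.
by rewrite -chi_le// sE uE clip_mono.
Qed.

Let D : set R := `]a, b[%classic.
Let D' : set R := `]0%R, 1%R[%classic.

Let DD' t : D t -> D' (chi t) /\ tau (chi t) = t.
Proof.
rewrite /D /D' /= !in_itv/= => /andP[at_ tb].
have c01 : 0 < chi t < 1 by rewrite -chia -chib !chi_incr// ltW.
split => //; have [tab tE] := tauP (chi t); apply: chi_inj => //; first by rewrite !ltW.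
by rewrite tE clip_id//; case/andP : c01 => ? ?; rewrite !ltW.
Qed.

Let D'D s : D' s -> D (tau s) /\ chi (tau s) = s.
Proof.
rewrite /D /D' /= !in_itv/= => /andP[s0 s1].
have [tab tE] := tauP s; have {}tE : chi (tau s) = s by rewrite tE clip_id// !ltW.
split => //; have aab : a <= a <= b by rewrite lexx ltW.
have bab : a <= b <= b by rewrite lexx ltW.
by rewrite -(chi_lt aab tab) -(chi_lt tab bab) tE chia chib s0 s1.
Qed.

Let mw : measurable_fun [set: R] (derive1 chi : R -> R).
Proof. by apply: continuous_measurable_fun. Qed.

Let mchi : measurable_fun [set: R] chi.
Proof. by apply: continuous_measurable_fun. Qed.

Let mD : measurable D. Proof. exact: measurable_itv. Qed.
Let mD' : measurable D'. Proof. exact: measurable_itv. Qed.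

Let FTC al be : a <= al -> al < be -> be <= b ->
  (\int[mu]_(t in `]al, be[) (derive1 chi t)%:E = (chi be - chi al)%:E)%E.
Proof.
move=> aal albe beb.
rewrite -(@integral_itv_bndoo R al be (fun t => (derive1 chi t)%:E) true false); last first.
  by apply/measurable_EFinP; exact: measurable_funTS.
rewrite EFinB; apply: continuous_FTC2.
- exact: albe.
- by apply: continuous_subspaceT.
- split; [by move=> t _; exact: dchi| |].
    by apply: cvg_at_right_filter; exact: contchi.
  by apply: cvg_at_left_filter; exact: contchi.
- by [].
Qed.

(** The fundamental theorem of calculus: the mass of ]x, y] is the increment of chi
over the preimage of its intersection with ]0, 1[. *)
Let wmeas_itv x y : wmeas D chi (derive1 chi) `]x, y] = mu (`]x, y] `&` D').
Proof.
pose x1 := Num.max x 0; pose y1 := Num.min y 1.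
have [xy|yx] := ltP x1 y1; last first.
  have E0 : `]x, y] `&` D' = set0.
    apply/seteqP; split => // s []; rewrite /= !in_itv/= => /andP[xs sy] /andP[s0 s1].
    have : x1 < y1; last by rewrite ltNge yx.
    by apply: (@lt_le_trans _ _ s); rewrite ?gt_max ?le_min ?xs ?s0 ?sy ?ltW.
  rewrite E0 measure0 /wmeas (_ : _ `&` _ = set0) ?integral_set0//.
  apply/seteqP; split => // t [Dt xyt].
  have : (`]x, y] `&` D') (chi t) by split => //; have [] := DD' Dt.
  by rewrite E0.
have x10 : 0 <= x1 by rewrite le_max lexx orbT.
have y11 : y1 <= 1 by rewrite ge_min lexx orbT.
have [ab1 E1] := tauP x1; have [ab2 E2] := tauP y1.
have {}E1 : chi (tau x1) = x1 by rewrite E1 clip_id// x10 (le_trans (ltW xy)).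
have {}E2 : chi (tau y1) = y1 by rewrite E2 clip_id// y11 (le_trans x10 (ltW xy)).
have lt12 : tau x1 < tau y1 by rewrite -chi_lt// E1 E2.
have inA s : (`]x, y] `&` D') s <-> (x1 < s <= y1 /\ s < 1).
  rewrite /setI /D'/= !in_itv/= gt_max le_min; split.
    by move=> [/andP[-> ->] /andP[-> s1]]; rewrite ltW// s1.
  by move=> [/andP[/andP[-> ->] /andP[-> _]] ->].
have muE : mu (`]x, y] `&` D') = (y1 - x1)%:E.
  have mA : measurable (`]x, y] `&` D') by apply: measurableI => //; exact: measurable_itv.
  apply/eqP; rewrite eq_le; apply/andP; split.
    have -> : (y1 - x1)%:E = mu `[x1, y1] by rewrite lebesgue_measure_itv/= lte_fin xy -EFinB.
    apply: le_measure; [by rewrite inE|by rewrite inE; exact: measurable_itv|].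
    by move=> s /inA [/andP[xs sy] _]; rewrite /= in_itv/= sy ltW.
  have -> : (y1 - x1)%:E = mu `]x1, y1[ by rewrite lebesgue_measure_itv/= lte_fin xy -EFinB.
  apply: le_measure; [by rewrite inE; exact: measurable_itv|by rewrite inE|].
  by move=> s; rewrite /= in_itv/= => /andP[xs sy]; apply/inA; rewrite xs ltW//; split => //; exact: lt_le_trans sy y11.
rewrite muE.
have DE t : (D `&` chi @^-1` `]x, y]) t <-> D t /\ tau x1 < t <= tau y1.
  split => [[Dt xyt]|[Dt]].
    have tab : a <= t <= b by move: Dt; rewrite /D/= in_itv/= => /andP[? ?]; rewrite !ltW.
    have /inA[] : (`]x, y] `&` D') (chi t) by split => //; have [] := DD' Dt.
    by rewrite -{1}E1 -{1}E2 chi_lt// chi_le.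
  have tab : a <= t <= b by move: Dt; rewrite /D/= in_itv/= => /andP[? ?]; rewrite !ltW.
  rewrite -chi_lt// -chi_le// E1 E2 => xyt; split => //.
  have [D't _] := DD' Dt.
  have [] : (`]x, y] `&` D') (chi t); last by [].
  by apply/inA; split => //; move: D't; rewrite /D'/= in_itv/= => /andP[].
have [/andP[a1 b1] /andP[a2 b2]] := (ab1, ab2).
have <- : (\int[mu]_(t in `]tau x1, tau y1[) (derive1 chi t)%:E = (y1 - x1)%:E)%E.
  by rewrite FTC// E1 E2.
rewrite /wmeas.
have mB : measurable (D `&` chi @^-1` `]x, y]).
  by apply: measurableI => //; rewrite -(setTI (_ @^-1` _)); apply: mchi => //; exact: measurable_itv.
have mw' (S : set R) : measurable_fun S (EFin \o (derive1 chi : R -> R)).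
  by apply/measurable_EFinP; exact: measurable_funTS.
apply/eqP; rewrite eq_le; apply/andP; split.
  rewrite -(@integral_itv_bndoo R _ _ (fun t => (derive1 chi t)%:E) true false); last exact: mw'.
  apply: (@ge0_subset_integral _ (measurableTypeR R) R mu _ _ mB (measurable_itv _) _ (mw' _)).
    by move=> t _; rewrite lee_fin.
  by move=> t /DE[_ /andP[xt ty]]; rewrite /= in_itv/= ty ltW.
apply: (@ge0_subset_integral _ (measurableTypeR R) R mu _ _ (measurable_itv _) mB _ (mw' _)).
  by move=> t _; rewrite lee_fin.
move=> t; rewrite /= in_itv/= => /andP[xt ty]; apply/DE.
by split; [rewrite /D/= in_itv/=; apply/andP; split; lra|rewrite xt ltW].
Qed.

(** The substitution rule s = chi(t); its hypothesis on indicators is [wmeas_itv],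
extended from intervals to all measurable sets. *)
Lemma lower_increasing (f : R -> R) : (forall s, 0 < s < 1 -> 0 <= f s) ->
  (\int[mu]_(t in `]a, b[) (derive1 chi t * f (chi t))%:E <=
   \int[mu]_(s in `]0%R, 1%R[) (f s)%:E)%E.
Proof.
move=> f0; apply: (@lower_change R D D' chi tau (derive1 chi) f mD mD' mchi _ mw chi0) => //.
- exact: (nondecreasing_measurable measurableT tau_nd).
- move=> A mA; rewrite integral_indic_comp.
  exact: (wmeas_unique mD mchi mw chi0 mD' wmeas_itv mA).
Qed.

End Increasing.
End Substitution.

(** * Homogeneity of the length element *)

(** For a finite factor k > 0 this holds even between opposite infinities, so that
integrals of functions which are not integrable can be scaled as well. *)
Lemma muleBr_pos (R : realType) (k : R) (x y : \bar R) : 0 < k ->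
  (k%:E * (x - y) = k%:E * x - k%:E * y)%E.
Proof.
move=> k0.
have ky : (k%:E * +oo = +oo :> \bar R)%E by rewrite gt0_muley// lte_fin.
have kNy : (k%:E * -oo = -oo :> \bar R)%E by rewrite gt0_muleNy// lte_fin.
move: x y => [x| |] [y| |]; rewrite ?(ky,kNy)/= ?(ky,kNy)//=.
by rewrite -EFinD -!EFinM -EFinD mulrBr.
Qed.

Lemma muleDr_pos (R : realType) (k : R) (x y : \bar R) : 0 < k ->
  (k%:E * (x + y) = k%:E * x + k%:E * y)%E.
Proof. by move=> k0; rewrite -{1}(oppeK y) muleBr_pos// muleN oppeK. Qed.

Section LowerIntegral2.
Local Open Scope ereal_scope.
Context {R : realType}.
Local Notation mu := (@lebesgue_measure R).
Implicit Types (D : set R) (f g : R -> \bar R).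

Import HBNNSimple.

(** By definition, the integral of a nonnegative function is a lower integral. *)
Lemma lower_integral_le D f (b : \bar R) : measurable D ->
  (forall x, D x -> 0 <= f x) ->
  (forall h : {nnsfun measurableTypeR R >-> R}, (forall x, D x -> (h x)%:E <= f x) ->
     \int[mu]_(x in D) (h x)%:E <= b) ->
  \int[mu]_(x in D) f x <= b.
Proof.
move=> mD f0 H; rewrite ge0_integralE//; apply: ge_ereal_sup => _ [h hle <-].
have hD t : ~ D t -> h t = 0%R.
  move=> nD; apply/eqP; rewrite eq_le fun_ge0 andbT -lee_fin.
  by have := hle t; rewrite /patch; case: ifPn => // /set_mem.
have <- : \int[mu]_(t in D) (h t)%:E = sintegral mu h.
  have := @integral_nnsfun _ (measurableTypeR R) R mu setT measurableT h.
  rewrite patch_setT => <-; rewrite [LHS]integral_mkcond; apply: eq_integral => t _.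
  rewrite /patch; case: ifPn => // /negP nD.
  by rewrite hD// => Dt; apply: nD; exact: mem_set.
apply: H => x Dx; have := hle x; rewrite /patch mem_set//.
Qed.

Let mh (h : {nnsfun measurableTypeR R >-> R}) (D : set R) : measurable_fun D (EFin \o h).
Proof. by apply/measurable_EFinP; apply: measurable_funTS; exact: (@measurable_funP _ _ (measurableTypeR R) _ setT h). Qed.

Lemma ge0_integral_sub D (D' : set R) f : D' `<=` D -> (forall x, D x -> 0 <= f x) ->
  \int[mu]_(x in D') f x <= \int[mu]_(x in D) f x.
Proof.
move=> DD f0; rewrite (_ : D' = D `&` D'); last first.
  by apply/seteqP; split => x; [split => //; exact: DD|case].
rewrite integral_mkcondr; apply: ge0_le_integral_nonmeasurable => x Dx.
  by rewrite /patch; case: ifPn => // _; exact: f0.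
by rewrite /patch; case: ifPn => // _; exact: f0.
Qed.

Lemma ge0_integral_endpoints (a b : R) f : (forall x, 0 <= f x) ->
  \int[mu]_(x in `[a, b]) f x = \int[mu]_(x in `]a, b[) f x.
Proof.
move=> f0; apply/eqP; rewrite eq_le; apply/andP; split.
  apply: (lower_integral_le (measurable_itv _)) => //.
  move=> h hf; rewrite (@integral_itv_bndoo R a b (EFin \o h) true false); last exact: mh.
  apply: ge0_le_integral_nonmeasurable; first by move=> x _; rewrite lee_fin.
  by move=> x; rewrite /= in_itv/= => /andP[ax xb]; apply: hf; rewrite /= in_itv/= !ltW.
apply: ge0_integral_sub => // x; rewrite /= !in_itv/= => /andP[ax xb].
by rewrite !ltW.
Qed.

Lemma integral_endpoints (a b : R) f :
  \int[mu]_(x in `[a, b]) f x = \int[mu]_(x in `]a, b[) f x.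
Proof. by rewrite integralE [RHS]integralE !ge0_integral_endpoints. Qed.

(** It suffices to split the integrals of the simple functions below [f]. *)
Lemma ge0_integral_split_le (a b c : R) f : (forall x, (a < x < c)%R -> 0 <= f x) ->
  (a < b < c)%R ->
  \int[mu]_(x in `]a, c[) f x <= \int[mu]_(x in `]a, b[) f x + \int[mu]_(x in `]b, c[) f x.
Proof.
move=> f0 /andP[ab bc]; apply: (lower_integral_le (measurable_itv _)).
  by move=> x; rewrite /= in_itv/=; exact: f0.
move=> h hf.
have sub x y : (a <= x)%R -> (y <= c)%R ->
    \int[mu]_(t in `]x, y[) (h t)%:E <= \int[mu]_(t in `]x, y[) f t.
  move=> ax yc; apply: ge0_le_integral_nonmeasurable; first by move=> t _; rewrite lee_fin.
  move=> t; rewrite /= in_itv/= => /andP[xt ty]; apply: hf.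
  by rewrite /= in_itv/= (le_lt_trans ax xt) (lt_le_trans ty yc).
have -> : `]a, c[%classic = (`]a, b] `|` `]b, c[)%classic.
  apply/seteqP; split => t; rewrite /setU/= !in_itv/=.
    by move=> /andP[-> ->]; rewrite andbT/=; case: leP; [left|right].
  by move=> [/andP[-> tb]|/andP[bt ->]]; rewrite ?andbT/=; [exact: le_lt_trans tb bc|exact: lt_trans ab bt].
rewrite ge0_integral_setU/=; first last.
- rewrite disj_set2E; apply/eqP/seteqP; split => // t [] /=; rewrite !in_itv/= => /andP[_ tb] /andP[bt _].
  by move: (lt_le_trans bt tb); rewrite ltxx.
- by move=> t _; rewrite lee_fin.
- exact: mh.
- exact: measurable_itv.
- exact: measurable_itv.
rewrite (@integral_itv_bndoo R a b (EFin \o h) false false); last exact: mh.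
by apply: leeD; apply: sub => //; rewrite ltW.
Qed.

(** Scaling by k and by k^-1 gives the two inequalities. *)
Lemma ge0_integralZ D (k : R) f : measurable D -> (0 < k)%R -> (forall x, 0 <= f x) ->
  \int[mu]_(x in D) (k%:E * f x) = k%:E * \int[mu]_(x in D) f x.
Proof.
move=> mD k0 f0.
suff le (c : R) (g : R -> \bar R) : (0 < c)%R -> (forall x, 0 <= g x) ->
    \int[mu]_(x in D) (c%:E * g x) <= c%:E * \int[mu]_(x in D) g x.
  apply/eqP; rewrite eq_le le//=.
  have ki : (0 < k^-1)%R by rewrite invr_gt0.
  have kf x : 0 <= k%:E * f x by rewrite mule_ge0// lee_fin ltW.
  rewrite -lee_pdivlMl//; apply: le_trans (le _ _ ki kf).
  apply: ge0_le_integral_nonmeasurable => // x _.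
  by rewrite muleA -EFinM mulVf ?gt_eqF// mul1e.
move=> c0 g0; apply: (lower_integral_le mD).
  by move=> x _; rewrite mule_ge0// lee_fin ltW.
move=> h hg.
rewrite muleC -lee_pdivrMr// muleC.
have -> : (c^-1)%:E * \int[mu]_(x in D) (h x)%:E = \int[mu]_(x in D) ((c^-1)%:E * (h x)%:E).
  rewrite ge0_integralZl_EFin ?invr_ge0 ?(ltW c0)//; first by move=> x _; rewrite lee_fin.
  exact: mh.
apply: ge0_le_integral_nonmeasurable => x Dx.
  by rewrite mule_ge0 ?lee_fin// invr_ge0 ltW.
by rewrite lee_pdivrMl//; exact: hg.
Qed.

Lemma integralZ D (k : R) f : measurable D -> (0 < k)%R ->
  \int[mu]_(x in D) (k%:E * f x) = k%:E * \int[mu]_(x in D) f x.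
Proof.
move=> mD k0; rewrite integralE [in RHS]integralE.
rewrite muleBr_pos// -!ge0_integralZ//.
by congr (_ - _); apply: eq_integral => x _; rewrite ?ge0_funeposM ?ge0_funenegM// ltW.
Qed.

End LowerIntegral2.

Section L2.
Context {R : realType}.

Lemma lebesgue_rVZ (k : R) n (f : 'rV[R]_n -> \bar R) : 0 < k ->
  lebesgue_rV (fun y => k%:E * f y)%E = (k%:E * lebesgue_rV f)%E.
Proof.
move=> k0; elim: n f => [|n ih] f //=.
by under eq_integral do rewrite ih; exact: integralZ.
Qed.

Lemma lebesgue_rV0 n : lebesgue_rV (fun _ : 'rV[R]_n => 0%E) = 0%E.
Proof.
elim: n => [|n ih] //=.
by under eq_integral do rewrite ih; rewrite integral0.
Qed.

Context {n : nat} {M : closedManifold R n}.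
Variable g : tensor2 M.

Lemma L2_densityZ (a : R) (al : form1 M) i y :
  L2_density g (fun p v => a * al p v) i y = a ^+ 2 * L2_density g al i y.
Proof.
rewrite /L2_density.
have -> : \row_k coef1 (fun p v => a * al p v) i k y = a *: \row_k coef1 al i k y.
  by apply/rowP => k; rewrite !mxE.
by rewrite linearZ/= -!scalemxAl -scalemxAr !mxE !mulrA -expr2.
Qed.

Lemma L2normZ (a : R) (al : form1 M) : a != 0 ->
  L2norm g (fun p v => a * al p v) = `|a| * L2norm g al.
Proof.
move=> a0; have a20 : 0 < a ^+ 2 by rewrite exprn_even_gt0.
rewrite /L2norm -sqrtr_sqr -sqrtrM ?sqr_ge0//; congr Num.sqrt.
set S := (X in _ = _ * fine X).
have -> : (a ^+ 2 * fine S)%R = fine ((a ^+ 2)%:E * S)%E.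
  by case: S => [r| |] //=; rewrite ?(gt0_muley, gt0_muleNy, lte_fin)// mulr0.
congr fine; rewrite /S; elim: (index_enum _) => [|i r ih].
  by rewrite !big_nil mule0.
rewrite !big_cons {}ih.
rewrite muleDr_pos//; congr (_ + _)%E; rewrite -lebesgue_rVZ//; congr lebesgue_rV; apply/funext => y.
by case: asboolP => _; rewrite -EFinM ?L2_densityZ// mulr0.
Qed.

Lemma L2norm0 : L2norm g (fun _ _ => 0) = 0.
Proof.
rewrite /L2norm big1 ?sqrtr0// => i _.
rewrite -[RHS](@lebesgue_rV0 n); congr lebesgue_rV; apply/funext => y.
case: asboolP => // _; congr (_%:E); rewrite /L2_density.
have -> : \row_k coef1 (fun _ _ => 0 : R) i k y = 0 by apply/rowP => k; rewrite !mxE.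
by rewrite !mul0mx mxE mul0r.
Qed.

End L2.

Section Nmu.
Context {R : realType} {n : nat} {M : closedManifold R n}.
Variables (g : tensor2 M) (nB : form1 M -> R) (mu : form1 M -> form1 M) (c : R).
Hypotheses (hnB : norm_on (exact_forms M) nB) (hmu : closed_to_exact mu) (c0 : 0 <= c).

Lemma closed_form0 : closed_forms M (fun _ _ => 0).
Proof.
have c00 i k : coef1 (fun (_ : M) (_ : tvec M) => 0) i k = fun=> 0 :> R by [].
split; first split.
- by move=> *; ring.
- by [].
- by move=> i k l; exact: Ck_cst.
- by move=> i j k y _; rewrite !c00 /partial !(derive_cst (0 : R^o)).
Qed.

Lemma mu0 : mu (fun _ _ => 0) = fun _ _ => 0.
Proof.
have [_ /(_ 1 _ _ closed_form0 closed_form0)] := hmu.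
have -> : (fun (p : M) (v : tvec M) => 1 * 0 + 0 : R) = fun _ _ => 0.
  by apply/funext => p; apply/funext => v; ring.
move=> E; apply/funext => p; apply/funext => v.
have /= := congr1 (fun al => al p v) E; rewrite mul1r.
by move/eqP; rewrite eq_sym -subr_eq0 addrK => /eqP.
Qed.

Lemma muZ (a : R) al : closed_forms M al ->
  mu (fun p v => a * al p v) = fun p v => a * mu al p v.
Proof.
move=> cal; have [_ /(_ a _ _ cal closed_form0)] := hmu; rewrite mu0.
have -> : (fun p v => a * al p v + 0) = (fun p v => a * al p v).
  by apply/funext => p; apply/funext => v; rewrite addr0.
by move=> ->; apply/funext => p; apply/funext => v; rewrite addr0.
Qed.

(** [mu] is only known to be linear on closed forms; this is why the forms of paths
have to be closed. *)
Lemma nmuZ (a : R) al : a != 0 -> closed_forms M al ->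
  nmu g nB mu c (fun p v => a * al p v) = `|a| * nmu g nB mu c al.
Proof.
move=> a0 cal; rewrite /nmu muZ//.
have [_ _ nZ _] := hnB; rewrite nZ; last by have [+ _] := hmu; apply.
have -> : (fun p v => a * al p v - a * mu al p v) = (fun p v => a * (al p v - mu al p v)).
  by apply/funext => p; apply/funext => v; rewrite mulrBr.
by rewrite L2normZ//; ring.
Qed.

Lemma nmu_ge0 al : closed_forms M al -> 0 <= nmu g nB mu c al.
Proof.
move=> cal; rewrite /nmu addr_ge0// ?mulr_ge0 ?sqrtr_ge0//.
by have [n0 _ _ _] := hnB; apply: n0; have [+ _] := hmu; apply.
Qed.

Lemma nmu0 : nmu g nB mu c (fun _ _ => 0) = 0.
Proof.
have e0 : exact_forms M (fun _ _ => 0) by rewrite -mu0; have [+ _] := hmu; apply; exact: closed_form0.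
rewrite /nmu mu0.
have -> : (fun (p : M) (v : tvec M) => 0 - 0 : R) = fun _ _ => 0.
  by apply/funext => p; apply/funext => v; rewrite subr0.
rewrite L2norm0 mulr0 addr0; have [_ _ nZ _] := hnB.
have := nZ 0 _ e0; rewrite normr0 (mul0r (nB _)) => E; rewrite -[RHS]E; congr nB.
by apply/funext => p; apply/funext => v; rewrite mulr0.
Qed.

End Nmu.

(** * Reversed and concatenated paths *)

Section TimeChange.
Context {R : realType}.

(** A time change, constant before a and after a + 1/2: two paths reparametrized by
[tstep 0] and [tstep 2^-1] are never in motion at the same time. *)
Definition tstep (a t : R) := sstep (2 * (t - a)).

Lemma is_derive_tstep a t : is_derive t (1 : R) (tstep a : R -> R^o)
  (2 * derive1 (sstep : R -> R^o) (2 * (t - a))).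
Proof.
have d1 : is_derive t (1 : R) (fun t : R => 2 * (t - a) : R^o) 2.
  have d2 : is_derive t (1 : R) (fun t : R => t - a : R^o) (1 + - 0).
    by apply: is_derive_addp; exact: is_derive_oppp.
  have := is_derive_mulp (is_derive_cst (2 : R^o) t (1:R)) d2.
  by move=> D; apply: is_derive_eq D _; rewrite subr0 mulr1 mulr0 addr0.
have [ds _] := is_derive_sstep (2 * (t - a)).
have ds' : is_derive (2 * (t - a)) (1 : R) (sstep : R -> R^o) (derive1 (sstep : R -> R^o) (2 * (t - a))).
  by apply: DeriveDef; [exact: ds|rewrite derive1E].
have := @is_derive1_comp R sstep (fun t : R => 2 * (t - a)) t _ _ ds' d1.
by rewrite mulrC.
Qed.

Lemma derive_tstep a t : derive1 (tstep a : R -> R^o) t = 2 * derive1 (sstep : R -> R^o) (2 * (t - a)).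
Proof. by rewrite derive1E; have [_ ->] := is_derive_tstep a t. Qed.

Lemma tstep_smooth a : smooth_on (E := R^o) setT (tstep a).
Proof.
move=> k; have oT := @openT R^o.
apply: (Ck_comp1 (g := fun t : R^o => 2 * (t - a)) oT oT) => //; last exact: sstep_smooth.
apply: (Ck_mul oT); first exact: Ck_cst.
by apply: (Ck_add oT); [exact: Ck_id|exact: Ck_cst].
Qed.

Lemma derive_tstep_continuous a : continuous (derive1 (tstep a : R -> R^o)).
Proof.
have -> : derive1 (tstep a : R -> R^o) = 'D_(1 : R^o) (tstep a : R^o -> R^o).
  by apply/funext => t; rewrite derive1E.
by move=> t; exact: (Ck_cont (Ck_D (1 : R^o) (tstep_smooth a 1)) (Logic.I : [set: R^o] t)).
Qed.

Lemma tstep01 a t : 0 <= tstep a t <= 1. Proof. exact: sstep01. Qed.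

Lemma tstep_le a t : t <= a -> tstep a t = 0.
Proof. by move=> ta; apply: sstep_le0; lra. Qed.

Lemma tstep_ge a t : a + 2^-1 <= t -> tstep a t = 1.
Proof. by move=> ta; apply: sstep_ge1; lra. Qed.

Lemma derive_tstep_gt0 a t : a < t < a + 2^-1 -> 0 < derive1 (tstep a : R -> R^o) t.
Proof.
by move=> /andP[? ?]; rewrite derive_tstep mulr_gt0// derive_sstep_gt0//; apply/andP; split; lra.
Qed.

Lemma tstep_lt01 a t : a < t < a + 2^-1 -> 0 < tstep a t < 1.
Proof.
move=> /andP[at_ ta].
have cs x : {for x, continuous (tstep a)}.
  apply: differentiable_continuous; apply/derivable1_diffP; by have [] := is_derive_tstep a x.
have incr x y : a <= x -> x < y -> y <= a + 2^-1 -> tstep a x < tstep a y.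
  move=> ax xy ya; apply: (@gtr0_derive1_lt_cc R (tstep a) x y) => //.
  - by move=> z _; have [] := is_derive_tstep a z.
  - by move=> z; rewrite in_itv/= => /andP[? ?]; apply: derive_tstep_gt0; apply/andP; split; lra.
  - exact: continuous_subspaceT.
  - by rewrite in_itv/= lexx ltW.
  - by rewrite in_itv/= lexx ltW.
apply/andP; split.
  by rewrite -(@tstep_le a a)//; apply: incr => //; exact: ltW.
by rewrite -(@tstep_ge a (a + 2^-1))//; apply: incr => //; exact: ltW.
Qed.

Lemma lower_tstep a (f : R -> R) : (forall s, 0 < s < 1 -> 0 <= f s) ->
  (\int[@lebesgue_measure R]_(t in `]a, (a + 2^-1)%R[) (derive1 (tstep a : R -> R^o) t * f (tstep a t))%:E <=
   \int[@lebesgue_measure R]_(s in `]0%R, 1%R[) (f s)%:E)%E.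
Proof.
move=> f0; apply: lower_increasing => //.
- by rewrite ltrDl.
- by move=> t; have [] := is_derive_tstep a t.
- exact: derive_tstep_continuous.
- by move=> t; rewrite derive_tstep mulr_ge0 ?derive_sstep_ge0.
- by move=> t; exact: derive_tstep_gt0.
- exact: tstep_le.
- exact: tstep_ge.
Qed.

End TimeChange.

(** Nonnegativity excludes the sum of opposite infinities. *)
Lemma ereal_inf_add_le (R : realType) (A B : set (\bar R)) (z : \bar R) :
  (forall a, A a -> (0 <= a)%E) -> (forall b, B b -> (0 <= b)%E) ->
  (forall a b, A a -> B b -> (z <= a + b)%E) ->
  (z <= ereal_inf A + ereal_inf B)%E.
Proof.
move=> A0 B0 zAB.
have : (0 <= ereal_inf A)%E by apply: le_ereal_inf_tmp.
have : (0 <= ereal_inf B)%E by apply: le_ereal_inf_tmp.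
case EA : (ereal_inf A) => [x| |] //; case EB : (ereal_inf B) => [y| |] // _ _;
  rewrite ?addey ?addye ?leey//.
apply/lee_addgt0Pr => e e0; have e20 : 0 < e / 2 by rewrite divr_gt0.
have fA : ereal_inf A \is a fin_num by rewrite EA.
have fB : ereal_inf B \is a fin_num by rewrite EB.
have [a Aa ax] := lb_ereal_inf_adherent e20 fA.
have [b Bb bx] := lb_ereal_inf_adherent e20 fB.
apply: le_trans (zAB a b Aa Bb) _; apply: le_trans (leeD (ltW ax) (ltW bx)) _.
by rewrite EA EB -!EFinD lee_fin; lra.
Qed.

Section Paths.
Context {R : realType} {n : nat} {M : closedManifold R n}.
Variables (omega g : tensor2 M) (nB : form1 M -> R) (mu : form1 M -> form1 M) (c : R).
Hypotheses (so : symplectic_form omega) (hnB : norm_on (exact_forms M) nB)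
  (hmu : closed_to_exact mu) (c0 : 0 <= c).
Local Notation N := (nmu g nB mu c).
Local Notation leb := (@lebesgue_measure R).
Implicit Types (psi Th : R -> M -> M) (phi : M -> M).

(** The end points are dropped because the form of a path is known to be closed in
between only. *)
Lemma plengthE psi : plength omega g nB mu c psi =
  (\int[leb]_(t in `]0%R, 1%R[) (N (path_form omega psi t))%:E)%E.
Proof. exact: integral_endpoints. Qed.

Lemma path_nmu_ge0 psi t : symp_path omega psi -> 0 < t < 1 -> 0 <= N (path_form omega psi t).
Proof. by move=> hp t01; exact: (nmu_ge0 g hnB hmu c0 (path_form_closed so hp t01)). Qed.

Lemma plength_ge0 psi : symp_path omega psi -> (0 <= plength omega g nB mu c psi)%E.
Proof.
move=> hp; rewrite plengthE; apply: integral_ge0 => t; rewrite /= in_itv/= lee_fin.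
exact: path_nmu_ge0.
Qed.

(** The form of the path is multiplied by tau', and the forms of paths are closed. *)
Lemma nmu_reparam psi Th (b : M -> M) (tau : R -> R) t :
  symp_path omega psi -> 0 < tau t < 1 -> bijective b ->
  derivable (tau : R -> R^o) t 1 -> derive1 (tau : R -> R^o) t != 0 ->
  (\forall s \near t, Th s = psi (tau s) \o b) ->
  N (path_form omega Th t) =
  `|derive1 (tau : R -> R^o) t| * N (path_form omega psi (tau t)).
Proof.
move=> hp tau01 bb taud taud0 ThE.
have [p0 py [e e0 ps]] := hp.
have oI : open (`]- e, 1 + e[%classic : set R) by exact: interval_open.
have [t0 t1] := andP tau01.
have It : `]- e, 1 + e[%classic (tau t) by rewrite /= in_itv/=; apply/andP; split; lra.
have pb : bijective (psi (tau t)) by have [] := py (tau t) ltac:(by rewrite !ltW).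
rewrite -(nmuZ g c hnB hmu taud0 (path_form_closed so hp tau01)).
congr (nmu _ _ _ _ _); apply/funext => p; apply/funext => v.
rewrite /path_form.
have [pv|pv] := asboolP (tangent p v); last by rewrite !tangent_partN// mulr0.
rewrite !tangent_partE// (velocity_reparam p oI It ps pb bb taud ThE).
apply: tensor_scalel => //; first by case: so.
exact: velocity_tangent oI It ps pb.
Qed.

(** Right translation by psi_1^-1 makes the reversed path start at the identity. *)
Lemma reverse_path psi : symp_path omega psi ->
  symp_path omega (fun t => psi (1 - t) \o minv (psi 1)).
Proof.
move=> [p0 py [e e0 ps]].
have [b1 s1 i1 o1] : symplectomorphism omega (psi 1) by apply: py; rewrite ler01 lexx.
split.
- by rewrite subr0; apply/funext => p /=; rewrite minvKV.
- move=> t /andP[t0 t1]; apply: symplectomorphism_comp.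
    by apply: py; apply/andP; split; lra.
  by apply: symplectomorphism_minv; apply: py; rewrite ler01 lexx.
exists e => //.
have oI : open (`]- e, 1 + e[%classic : set R) by exact: interval_open.
apply: (@smooth_family_comp _ _ M _ setT _ psi (fun=> minv (psi 1)) (fun t => 1 - t) (fun=> 0) oI openT oI ps).
- by apply: smooth_map_family; [exact: openT|exact: i1].
- move=> k; have oK : open (`]- e, 1 + e[%classic : set R^o) by exact: oI.
  by apply: (Ck_add oK); [exact: Ck_cst|apply: (Ck_opp oK); exact: Ck_id].
- by move=> k; exact: Ck_cst.
- by move=> t; rewrite /= !in_itv/= => /andP[? ?]; apply/andP; split; lra.
- by [].
Qed.

Lemma plength_reverse psi : symp_path omega psi ->
  (plength omega g nB mu c (fun t => psi (1 - t)%R \o minv (psi 1%R)) <=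
   plength omega g nB mu c psi)%E.
Proof.
move=> hp; have [p0 py _] := hp; rewrite !plengthE.
apply: le_trans (lower_reflection (f := fun t => N (path_form omega psi t)) _); last first.
  by move=> s s01; exact: path_nmu_ge0.
apply: ge0_le_integral_nonmeasurable => t; rewrite /= in_itv/= => /andP[t0 t1].
  by rewrite lee_fin; apply: path_nmu_ge0; rewrite ?t0//; exact: reverse_path.
have d1 : is_derive t (1 : R) (fun t : R => 1 - t : R^o) (0 + - 1) by exact: is_derive_addp.
have dE : derive1 (fun t : R => 1 - t : R^o) t = -1 by rewrite derive1E; have [_ ->] := d1; rewrite add0r.
rewrite (@nmu_reparam psi _ (minv (psi 1)) (fun t => 1 - t) t hp).
- by rewrite dE normrN1 mul1r.
- by apply/andP; split; lra.
- by apply: minv_bij; have [] := py 1 ltac:(by rewrite ler01 lexx).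
- by have [] := d1.
- by rewrite dE oppr_eq0 oner_eq0.
- by near=> s.
Unshelve. all: by end_near. Qed.

(** First follow [psi] to its end point [psi 1], then [phi], right-translated by
[psi 1]. *)
Definition concat_path (phi psi : R -> M -> M) (t : R) : M -> M :=
  phi (tstep 2^-1 t) \o psi (tstep 0 t).

Lemma concat_path_symp (phi psi : R -> M -> M) : symp_path omega phi -> symp_path omega psi ->
  symp_path omega (concat_path phi psi).
Proof.
move=> [f0 fy [e e0 fs]] [p0 py [d d0 ps]]; split.
- by rewrite /concat_path !tstep_le// f0 p0.
- by move=> t _; apply: symplectomorphism_comp; [apply: fy|apply: py]; exact: tstep01.
exists 1 => //.
have oI x y : open (`]x, y[%classic : set R) by exact: interval_open.
apply: (@smooth_family_comp _ _ M _ _ _ phi psi (tstep 2^-1) (tstep 0) (oI _ _) (oI _ _) (oI _ _) fs ps).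
- by move=> k; apply: Ck_sub (tstep_smooth _ k).
- by move=> k; apply: Ck_sub (tstep_smooth _ k).
- by move=> t _; rewrite /= in_itv/=; have /andP[? ?] := tstep01 2^-1 t; apply/andP; split; lra.
- by move=> t _; rewrite /= in_itv/=; have /andP[? ?] := tstep01 0 t; apply/andP; split; lra.
Qed.

(** On each half of [0, 1] only one of the two paths moves, the other one acting as a
fixed right translation or being at rest at the identity. *)
Lemma plength_concat (phi psi : R -> M -> M) : symp_path omega phi -> symp_path omega psi ->
  (plength omega g nB mu c (concat_path phi psi) <=
   plength omega g nB mu c phi + plength omega g nB mu c psi)%E.
Proof.
move=> hf hp; rewrite !plengthE; have hc := concat_path_symp hf hp.
have [f0 fy _] := hf; have [p0 py _] := hp.
have h2 : (2^-1 : R) + 2^-1 = 1 by lra.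
apply: le_trans (ge0_integral_split_le (b := 2^-1) _ _) _.
- by move=> t t01; rewrite lee_fin; exact: path_nmu_ge0.
- by apply/andP; split; lra.
rewrite [leLHS]addeC; apply: leeD.
- apply: le_trans (lower_tstep 2^-1 (f := fun t => N (path_form omega phi t)) _); last first.
    by move=> s s01; exact: path_nmu_ge0.
  rewrite h2; apply: ge0_le_integral_nonmeasurable => t; rewrite /= in_itv/= => /andP[t0 t1].
    by rewrite lee_fin; apply: path_nmu_ge0 => //; apply/andP; split; lra.
  have t01 : 2^-1 < t < 2^-1 + 2^-1 by rewrite h2 t0 t1.
  have dp := derive_tstep_gt0 t01.
  rewrite (@nmu_reparam phi _ (psi 1) (tstep 2^-1) t hf).
  + by rewrite gtr0_norm.
  + exact: tstep_lt01.
  + by have [] := py 1 ltac:(by rewrite ler01 lexx).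
  + by have [] := is_derive_tstep 2^-1 t.
  + by rewrite gt_eqF.
  + near=> s; rewrite /concat_path (@tstep_ge _ 0)// add0r ltW//.
    by near: s; exact: lt_nbhsr.
- apply: le_trans (lower_tstep 0 (f := fun t => N (path_form omega psi t)) _); last first.
    by move=> s s01; exact: path_nmu_ge0.
  rewrite add0r; apply: ge0_le_integral_nonmeasurable => t; rewrite /= in_itv/= => /andP[t0 t1].
    by rewrite lee_fin; apply: path_nmu_ge0 => //; apply/andP; split; lra.
  have t01 : 0 < t < 0 + 2^-1 by rewrite add0r t0 t1.
  have dp := derive_tstep_gt0 t01.
  rewrite (@nmu_reparam psi _ id (tstep 0) t hp).
  + by rewrite gtr0_norm.
  + exact: tstep_lt01.
  + by exists id.
  + by have [] := is_derive_tstep 0 t.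
  + by rewrite gt_eqF.
  + near=> s; rewrite /concat_path (@tstep_le _ 2^-1) ?f0// ltW//.
    by near: s; exact: lt_nbhsl.
Unshelve. all: by end_near. Qed.

Local Notation dist_id := (dist_id omega g nB mu c).
Local Notation dist := (dist omega g nB mu c).
Local Notation sdist := (sdist omega g nB mu c).
Local Notation S := (Symp0 omega).

Lemma constant_path : symp_path omega (fun=> @id M).
Proof.
split=> // [t _|]; first exact: symplectomorphism_id.
by exists 1 => //; apply: smooth_family_id; exact: interval_open.
Qed.

Lemma Symp0_bij phi : S phi -> bijective phi.
Proof. by move=> [psi [_ py _] <-]; have [] := py 1 ltac:(by rewrite ler01 lexx). Qed.

Lemma Symp0_minv phi : S phi -> S (minv phi).
Proof.
move=> [psi hp <-]; exists (fun t => psi (1 - t) \o minv (psi 1)); first exact: (reverse_path hp).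
by have [p0 _ _] := hp; rewrite subrr p0.
Qed.

Lemma Symp0_comp phi (psi : M -> M) : S phi -> S psi -> S (phi \o psi).
Proof.
move=> [f hf <-] [p hp <-]; exists (concat_path f p); first exact: (concat_path_symp hf hp).
by rewrite /concat_path !tstep_ge//; lra.
Qed.

Lemma dist_id_ge0 phi : (0 <= dist_id phi)%E.
Proof. by apply: le_ereal_inf_tmp => _ [psi [hp _] <-]; exact: plength_ge0. Qed.

Lemma dist_id_comp phi (psi : M -> M) : (dist_id (phi \o psi) <= dist_id phi + dist_id psi)%E.
Proof.
apply: ereal_inf_add_le.
- by move=> _ [f [hf _] <-]; exact: plength_ge0.
- by move=> _ [p [hp _] <-]; exact: plength_ge0.
- move=> _ _ [f [hf <-] <-] [p [hp <-] <-].
  apply: le_trans (plength_concat hf hp); apply: ereal_inf_lbound.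
  exists (concat_path f p) => //; split; first exact: (concat_path_symp hf hp).
  by rewrite /concat_path !tstep_ge//; lra.
Qed.

Lemma dist_id_minv_le phi : (dist_id (minv phi) <= dist_id phi)%E.
Proof.
apply: le_ereal_inf_tmp => _ [psi [hp <-] <-].
apply: le_trans (plength_reverse hp); apply: ereal_inf_lbound.
exists (fun t => psi (1 - t) \o minv (psi 1)) => //; split; first exact: (reverse_path hp).
by have [p0 _ _] := hp; rewrite subrr p0.
Qed.

Lemma minvV phi : bijective phi -> minv (minv phi) = phi.
Proof. by move=> pb; apply: minv_eq; [exact: minvKV|exact: minvK]. Qed.

Lemma dist_id_minv phi : bijective phi -> dist_id (minv phi) = dist_id phi.
Proof.
move=> pb; apply/eqP; rewrite eq_le dist_id_minv_le/=.
by rewrite -{1}(minvV pb) dist_id_minv_le.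
Qed.

Lemma dist_id_id : dist_id id = 0%E.
Proof.
apply/eqP; rewrite eq_le dist_id_ge0 andbT.
have hid := constant_path.
apply: (@le_trans _ _ (plength omega g nB mu c (fun=> @id M))).
  by apply: ereal_inf_lbound; exists (fun=> @id M).
rewrite /plength integral0_eq// => t _.
have -> : path_form omega (fun=> @id M) t = fun _ _ => 0; last by rewrite (nmu0 g c hnB hmu).
apply/funext => p; apply/funext => v; rewrite /path_form.
have [pv|pv] := asboolP (tangent p v); last by rewrite tangent_partN.
rewrite tangent_partE//.
have -> : velocity (fun=> @id M) t p = fun=> 0.
  apply/funext => f; have [fs|fs] := asboolP (smooth_fun f); last by rewrite /velocity smooth_partN.
  by rewrite /velocity smooth_partE// derive1_cst.
by apply: tensor0l => //; case: so.
Qed.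

(** phi^-1 psi and psi^-1 phi are inverse to each other. *)
Lemma dist_sym phi (psi : M -> M) : S phi -> S psi -> dist phi psi = dist psi phi.
Proof.
move=> /Symp0_bij fb /Symp0_bij pb; rewrite /dist -dist_id_minv.
  by rewrite minv_comp ?minvV//; exact: minv_bij.
by apply: bij_comp => //; exact: minv_bij.
Qed.

(** phi1^-1 phi3 = (phi1^-1 phi2) (phi2^-1 phi3). *)
Lemma dist_triangle phi1 phi2 phi3 : S phi2 ->
  (dist phi1 phi3 <= dist phi1 phi2 + dist phi2 phi3)%E.
Proof.
move=> /Symp0_bij b2; apply: le_trans (dist_id_comp _ _).
rewrite /dist (_ : (minv phi1 \o phi2) \o (minv phi2 \o phi3) = minv phi1 \o phi3)//.
by apply/funext => p /=; rewrite minvKV.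
Qed.

(** [dist] is symmetric; the value +oo is treated apart. *)
Lemma sdistE phi (psi : M -> M) : S phi -> S psi -> sdist phi psi = dist phi psi.
Proof.
move=> Sf Sp; rewrite /sdist (dist_sym Sp Sf).
have : (0 <= dist phi psi)%E by exact: dist_id_ge0.
case: (dist phi psi) => [r| |] // _; first by rewrite -EFinD -EFinM; congr (_%:E); lra.
by rewrite addye// gt0_muley// lte_fin invr_gt0.
Qed.

Lemma dist_fin_num phi (psi : M -> M) : lengths_defined omega g nB mu c -> S phi -> S psi ->
  dist phi psi \is a fin_num.
Proof.
move=> ld Sf Sp; have [p hp pE] : S (minv phi \o psi) by apply: Symp0_comp => //; exact: Symp0_minv.
rewrite fin_numE; apply/andP; split; first by rewrite gt_eqF// (lt_le_trans _ (dist_id_ge0 _)).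
rewrite lt_eqF//; apply: (@le_lt_trans _ _ (plength omega g nB mu c p)).
  by apply: ereal_inf_lbound; exists p.
have := ld p hp => ip; rewrite /plength.
have := integrable_fin_num _ ip.
rewrite fin_numE => /(_ (measurable_itv _))/andP[_].
by rewrite -ltey.
Qed.

Lemma dist_left_invariant : left_invariant S dist.
Proof.
move=> h x y /Symp0_bij hb /Symp0_bij xb Sy; rewrite /dist minv_comp//.
by congr dist_id; apply/funext => p /=; rewrite minvK.
Qed.

End Paths.

(** * The torus as a manifold *)

Section Angle.
Context {R : realType}.
Implicit Types a b t : R.

(** The angle in ]-pi, pi[ of a point (a, b) <> (-1, 0) of the unit circle. *)
Definition angle a b : R := 2 * atan (b / (1 + a)).

Lemma angle_bound a b : `|angle a b| < pi.
Proof.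
rewrite ltr_norml /angle.
by have := atan_gtNpi2 (b / (1 + a)); have := atan_ltpi2 (b / (1 + a)); lra.
Qed.

Lemma cos2_atan t : cos (atan t) ^+ 2 = (1 + t ^+ 2)^-1.
Proof. by rewrite cos_atan exprVn sqr_sqrtr// addr_ge0 ?sqr_ge0. Qed.

(** The half-angle formula tan(t/2) = sin t / (1 + cos t). *)
Lemma angleK a b : a ^+ 2 + b ^+ 2 = 1 -> -1 < a ->
  cos (angle a b) = a /\ sin (angle a b) = b.
Proof.
move=> ab a1; have a0 : 1 + a != 0 by rewrite gt_eqF//; lra.
set t := b / (1 + a).
have t2 : 1 + t ^+ 2 = 2 / (1 + a).
  rewrite /t expr_div_n; have -> : b ^+ 2 = (1 - a) * (1 + a) by lra.
  by field.
have c2 : cos (atan t) ^+ 2 = (1 + a) / 2 by rewrite cos2_atan t2; field.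
have c0 : cos (atan t) != 0 by rewrite -sqrf_eq0 c2 mulf_neq0// invr_eq0 pnatr_eq0.
have s_ : sin (atan t) = t * cos (atan t) by rewrite -{2}(atanK t) /tan; field.
have aE : angle a b = (atan t) *+ 2 by rewrite /angle -/t mulr2n; ring.
rewrite aE cos_mulr2n sin_mulr2n c2; split; first by rewrite -mulr_natl; field.
rewrite s_ -mulr_natl.
transitivity (2 * (t * cos (atan t) ^+ 2)); first by ring.
by rewrite c2 /t; field.
Qed.

Lemma angle_cos_sin x : `|x| < pi -> angle (cos x) (sin x) = x.
Proof.
rewrite ltr_norml => /andP[xl xr].
have xE : x = (x / 2) *+ 2 by rewrite mulr2n; lra.
have c0 : 0 < cos (x / 2) by apply: cos_gt0_pihalf; apply/andP; split; lra.
rewrite /angle; have -> : sin x / (1 + cos x) = tan (x / 2).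
  rewrite {1 2}xE sin_mulr2n cos_mulr2n /tan !mulr2n.
  set c := cos _ in c0 *; set s := sin _; have cn : c != 0 by rewrite gt_eqF.
  have -> : 1 + (c ^+ 2 + c ^+ 2 - 1) = 2 * c ^+ 2 by ring.
  by field.
by rewrite tanK; [lra|rewrite in_itv/=; apply/andP; split; lra].
Qed.

Lemma angle_continuous (T : topologicalType) (f h : T -> R) (p : T) :
  {for p, continuous f} -> {for p, continuous h} -> -1 < f p ->
  {for p, continuous (fun p => angle (f p) (h p))}.
Proof.
move=> fc hc f1; apply: cvgM; first exact: cvg_cst.
apply: (@continuous_comp _ _ _ (fun p => h p / (1 + f p)) atan); last exact: continuous_atan.
apply: cvgM => //; apply: cvgV; first by rewrite gt_eqF//; lra.
by apply: cvgD; [exact: cvg_cst|exact: fc].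
Qed.

Lemma continuous_cmul (T : topologicalType) (a : R) (f : T -> R) (p : T) :
  {for p, continuous f} -> {for p, continuous (fun p => a * f p)}.
Proof. by move=> fc; apply: cvgM; [exact: cvg_cst|exact: fc]. Qed.

Lemma continuous_cadd (T : topologicalType) (a : R) (f : T -> R) (p : T) :
  {for p, continuous f} -> {for p, continuous (fun p => a + f p)}.
Proof. by move=> fc; apply: cvgD; [exact: cvg_cst|exact: fc]. Qed.

End Angle.

Lemma open_forall (T : topologicalType) (I : finType) (A : I -> set T) :
  (forall i, open (A i)) -> open [set x | forall i, A i x].
Proof.
move=> oA; rewrite openE => x Ax; apply: filter_forall => i.
by apply: open_nbhs_nbhs; split => //; exact: Ax.
Qed.

Lemma rV_continuous (R : realType) n (X : topologicalType) (f : X -> 'rV[R]_n) (x : X) :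
  (forall i, {for x, continuous (fun x => f x 0 i)}) -> {for x, continuous f}.
Proof. by move=> fc; apply: (coordinates_cvg (coordinates_rV n)) => i; exact: fc. Qed.

Section Torus.
Context {R : realType} {n : nat}.

(** The n-torus, as the set of pairs (cosines, sines) of n angles. *)
Definition torus_set : set ('rV[R]_n * 'rV[R]_n)%type :=
  [set A : ('rV[R]_n * 'rV[R]_n)%type | forall i : 'I_n, A.1 0 i ^+ 2 + A.2 0 i ^+ 2 = 1].

Definition torus : topologicalType := set_type torus_set.

Definition cs (p : torus) (i : 'I_n) : R := (set_val p).1 0 i.
Definition sn (p : torus) (i : 'I_n) : R := (set_val p).2 0 i.

Lemma cs2sn2 p i : cs p i ^+ 2 + sn p i ^+ 2 = 1.
Proof. exact: (set_valP p). Qed.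

Lemma torus_eq p q : (forall i, cs p i = cs q i) -> (forall i, sn p i = sn q i) -> p = q.
Proof.
move=> c s; apply: val_inj.
have E (a b : ('rV[R]_n * 'rV[R]_n)%type) : a.1 = b.1 -> a.2 = b.2 -> a = b.
  by case: a => a1 a2; case: b => b1 b2 /= -> ->.
by apply: E; apply/rowP => i; [exact: c|exact: s].
Qed.

Lemma cs_continuous i : continuous (cs^~ i).
Proof.
move=> p; apply: (@continuous_comp _ _ _ (set_val : torus -> _) (fun A => A.1 0 i)).
  exact: initial_continuous.
case: (set_val p) => a b.
apply: (@continuous_fst_comp _ _ _ (fun a : 'rV[R]_n => a 0 i)).
exact: coord_continuous.
Qed.

Lemma sn_continuous i : continuous (sn^~ i).
Proof.
move=> p; apply: (@continuous_comp _ _ _ (set_val : torus -> _) (fun A => A.2 0 i)).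
  exact: initial_continuous.
case: (set_val p) => a b.
apply: (@continuous_snd_comp _ _ _ (fun a : 'rV[R]_n => a 0 i)).
exact: coord_continuous.
Qed.

Lemma torus_continuous_at (X : topologicalType) (f : X -> torus) (x : X) :
  (forall i, {for x, continuous (fun x => cs (f x) i)}) ->
  (forall i, {for x, continuous (fun x => sn (f x) i)}) -> {for x, continuous f}.
Proof.
move=> c s U [/= _ [[W oW <-]] /= Wfx] WU.
have : {for x, continuous (set_val \o f)}.
  have -> : set_val \o f = (fun x => ((set_val (f x)).1, (set_val (f x)).2)).
    by apply/funext => y /=; rewrite -surjective_pairing.
  apply: continuous_pair.
    by apply: (coordinates_cvg (coordinates_rV n)) => i; exact: c.
  by apply: (coordinates_cvg (coordinates_rV n)) => i; exact: s.
move=> H; have WN : nbhs ((set_val \o f) x) W by apply: open_nbhs_nbhs; split.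
have HW : nbhs x (fun y => W (set_val (f y))) := H W WN.
by apply: filterS HW => y Wy; exact: WU.
Qed.

Lemma torus_continuous (X : topologicalType) (f : X -> torus) :
  (forall i, continuous (fun x => cs (f x) i)) ->
  (forall i, continuous (fun x => sn (f x) i)) -> continuous f.
Proof. by move=> c s x; apply: torus_continuous_at => i; [exact: c|exact: s]. Qed.

Lemma torus_hausdorff : hausdorff_space torus.
Proof.
move=> p q pq; apply: val_inj.
have hT : hausdorff_space ('rV[R]_n * 'rV[R]_n)%type by exact: norm_hausdorff.
apply: hT => A B /= Ap Bq.
have [r [Ar Br]] := pq (set_val @^-1` A) (set_val @^-1` B)
  (initial_continuous Ap) (initial_continuous Bq).
by exists (set_val r).
Qed.

Lemma tpi_in (z : 'rV[R]_n) : torus_set (\row_i cos (z 0 i), \row_i sin (z 0 i)).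
Proof. by move=> i /=; rewrite !mxE cos2Dsin2. Qed.

(** The universal covering. *)
Definition tpi (z : 'rV[R]_n) : torus := SigSub (mem_set (tpi_in z)) : set_type torus_set.

Lemma cs_tpi z i : cs (tpi z) i = cos (z 0 i). Proof. by rewrite /cs /= mxE. Qed.
Lemma sn_tpi z i : sn (tpi z) i = sin (z 0 i). Proof. by rewrite /sn /= mxE. Qed.

Lemma tpi_continuous : continuous tpi.
Proof.
apply: torus_continuous => i.
  have -> : (fun z => cs (tpi z) i) = cos \o (fun z => z 0 i) by apply/funext => z; rewrite cs_tpi.
  by move=> z; apply: continuous_comp; [exact: coord_continuous|exact: continuous_cos].
have -> : (fun z => sn (tpi z) i) = sin \o (fun z => z 0 i) by apply/funext => z; rewrite sn_tpi.
by move=> z; apply: continuous_comp; [exact: coord_continuous|exact: continuous_sin].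
Qed.

(** By the addition formulas.  Thanks to this, translations by multiples of 2 pi need not
be named. *)
Lemma tpiD z z' w : tpi z = tpi z' -> tpi (z + w) = tpi (z' + w).
Proof.
move=> e; have ec i : cos (z 0 i) = cos (z' 0 i) by rewrite -!cs_tpi e.
have es i : sin (z 0 i) = sin (z' 0 i) by rewrite -!sn_tpi e.
by apply: torus_eq => i; rewrite ?cs_tpi ?sn_tpi !mxE ?cosD ?sinD ec es.
Qed.

(** Charts: the angles, measured from 0 or from pi according to the bits [s i]. *)
Implicit Types s : {ffun 'I_n -> bool}.

Definition csgn (b : bool) : R := if b then -1 else 1.
Definition cshift (b : bool) : R := if b then pi else 0.

Lemma csgn2 b : csgn b ^+ 2 = 1. Proof. by case: b; rewrite /csgn ?sqrrN expr1n. Qed.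

Definition tchart s : chart R n torus := {|
  cdom := [set p | forall i, -1 < csgn (s i) * cs p i];
  cmap := fun p => \row_i (cshift (s i) + angle (csgn (s i) * cs p i) (csgn (s i) * sn p i));
  cinv := tpi |}.

Lemma cos_shift b x : cos (cshift b + x) = csgn b * cos x.
Proof. by case: b; rewrite /cshift /csgn ?add0r ?mul1r// addrC cosDpi mulN1r. Qed.

Lemma sin_shift b x : sin (cshift b + x) = csgn b * sin x.
Proof. by case: b; rewrite /cshift /csgn ?add0r ?mul1r// addrC sinDpi mulN1r. Qed.

Lemma tchartK s p : cdom (tchart s) p -> tpi (cmap (tchart s) p) = p.
Proof.
move=> sp.
have u i : (csgn (s i) * cs p i) ^+ 2 + (csgn (s i) * sn p i) ^+ 2 = 1.
  by rewrite !exprMn csgn2 !mul1r cs2sn2.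
have aK i := angleK (u i) (sp i).
have sK b x : csgn b * (csgn b * x) = x by rewrite mulrA -expr2 csgn2 mul1r.
apply: torus_eq => i; rewrite ?cs_tpi ?sn_tpi mxE ?cos_shift ?sin_shift.
  by have [-> _] := aK i.
by have [_ ->] := aK i.
Qed.

Lemma tchart_img s : cimg (tchart s) = [set z | forall i, `|z 0 i - cshift (s i)| < pi].
Proof.
apply/seteqP; split => [_ [p _ <-] i|z zs].
  by rewrite mxE addrAC subrr add0r angle_bound.
have cE i : csgn (s i) * cs (tpi z) i = cos (z 0 i - cshift (s i)).
  rewrite cs_tpi -{1}(subrK (cshift (s i)) (z 0 i)) addrC cos_shift.
  by rewrite mulrA -expr2 csgn2 mul1r.
have sE i : csgn (s i) * sn (tpi z) i = sin (z 0 i - cshift (s i)).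
  rewrite sn_tpi -{1}(subrK (cshift (s i)) (z 0 i)) addrC sin_shift.
  by rewrite mulrA -expr2 csgn2 mul1r.
exists (tpi z).
  move=> i; rewrite cE; have := zs i; set x := _ - _ => xpi.
  have -> : cos x = cos `|x| by case: (ger0P x) => // _; rewrite cosN.
  by rewrite -cospi ltr_cos ?in_itv/= ?lexx ?pi_ge0 ?normr_ge0 ?ltW.
by apply/rowP => i; rewrite mxE cE sE angle_cos_sin// addrC subrK.
Qed.

Lemma tchart_is_chart s : is_chart (tchart s).
Proof.
split.
- apply: open_forall => i.
  apply: (open_comp (f := fun p => csgn (s i) * cs p i) (D := [set x | -1 < x])).
    by move=> p _; apply: continuous_cmul; exact: cs_continuous.
  exact: open_gt.
- rewrite tchart_img; apply: open_forall => i.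
  have : open ((fun z : 'rV[R]_n => z 0 i) @^-1` `]cshift (s i) - pi, cshift (s i) + pi[).
    apply: open_comp; last exact: interval_open.
    by move=> z _; exact: coord_continuous.
  congr open; apply/funext => z; apply/propext.
  by rewrite /preimage/= in_itv/= ltr_distl.
- by move=> p; exact: tchartK.
- move=> p sp; apply: rV_continuous => i.
  have -> : (fun t => cmap (tchart s) t 0 i) =
    (fun p => cshift (s i) + angle (csgn (s i) * cs p i) (csgn (s i) * sn p i)).
    by apply/funext => q; rewrite mxE.
  apply: continuous_cadd; apply: angle_continuous; last exact: sp.
    by apply: continuous_cmul; exact: cs_continuous.
  by apply: continuous_cmul; exact: sn_continuous.
- by move=> z _; exact: tpi_continuous.
Qed.

Lemma tchart_cover p : exists s, cdom (tchart s) p.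
Proof.
exists [ffun i => cs p i < 0] => i; rewrite ffunE /csgn.
case: (ltP (cs p i) 0) => c0; first by rewrite mulN1r ltrN2 (lt_trans c0).
by rewrite mul1r (lt_le_trans _ c0)// ltrN10.
Qed.

Lemma tpi_surj p : exists z, tpi z = p.
Proof. by have [s sp] := tchart_cover p; exists (cmap (tchart s) p); exact: tchartK. Qed.

Lemma torus_compact : compact [set: torus].
Proof.
pose K : set 'rV[R]_n := [set z | forall i, `[- (2 * pi), 2 * pi]%classic (z 0 i)].
have cK : compact K.
  by apply: (@rV_compact R n (fun=> `[- (2 * pi), 2 * pi]%classic)) => i; exact: segment_compact.
have -> : [set: torus] = tpi @` K; last first.
  by apply: continuous_compact => //; apply: continuous_subspaceT; exact: tpi_continuous.
apply/seteqP; split => // p _; have [s sp] := tchart_cover p.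
exists (cmap (tchart s) p); last exact: tchartK.
move=> i; have : cimg (tchart s) (cmap (tchart s) p) by exists p.
rewrite tchart_img => /(_ i); rewrite ltr_norml => /andP[lo hi].
rewrite /= in_itv/=; have := @pi_gt0 R; move: lo hi; rewrite /cshift; case: (s i) => ? ? ?; apply/andP; split; lra.
Qed.

(** Where two charts overlap, they differ locally by a constant: by [tpiD], a
translate of one lift is a lift, and it lies in the image of the other chart. *)
Lemma tchart_compat s s' (k : 'I_n) :
  smooth_on (cmap (tchart s) @` (cdom (tchart s) `&` cdom (tchart s')))
            (fun y => cmap (tchart s') (cinv (tchart s) y) 0 k).
Proof.
have [_ oi' K' _ _] := tchart_is_chart s'.
move=> m; apply: Ck_local => _ [p [sp s'p] <-].
set y := cmap (tchart s) p; set y' := cmap (tchart s') p.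
have yy' : tpi y' = tpi y by rewrite !tchartK.
have oU : open [set z | cimg (tchart s') (z + (y' - y))].
  exact: open_translate oi'.
exists [set z | cimg (tchart s') (z + (y' - y))], (fun z : 'rV[R]_n => z 0 k + (y' - y) 0 k); split.
- exact: oU.
- by rewrite /= addrC subrK; exists p.
- by apply: (Ck_add oU); [exact: Ck_coord|exact: Ck_cst].
- move=> z /= [q s'q qE]; rewrite /=.
  have -> : tpi z = q.
    have -> : z = y + (z - y) by rewrite addrC subrK.
    rewrite -(tpiD (z - y) yy'); have -> : y' + (z - y) = z + (y' - y) by rewrite addrCA.
    by rewrite -qE; exact: tchartK.
  by rewrite -[LHS]/(cmap (tchart s') q 0 k) qE !mxE.
Qed.

End Torus.

Section TorusManifold.
Context {R : realType} {n : nat}.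
Local Notation RV := (R^o * 'rV[R]_n)%type.
Local Notation torus := (@torus R n).

Let tatlas (k : 'I_#|{ffun 'I_n -> bool}|) := tchart (R := R) (enum_val k).

Let tatlas_cover (p : torus) : exists k, cdom (tatlas k) p.
Proof.
have [s sp] := tchart_cover p; exists (enum_rank s).
by rewrite /tatlas enum_rankK.
Qed.

(** The torus as a manifold; the inverses of all its charts are [tpi]. *)
Definition torusM : closedManifold R n := @ClosedManifold R n torus _ tatlas
  torus_hausdorff torus_compact (fun k => tchart_is_chart (enum_val k)) tatlas_cover
  (fun k l => tchart_compat (enum_val k) (enum_val l)).

Implicit Types (f : torusM -> R) (p q : torusM) (z : 'rV[R]_n).

(** Both sides lift the same point, by [tpiD], and the right-hand one lies in the image
of the chart. *)
Lemma tchart_lift (s : {ffun 'I_n -> bool}) (y' z0 z : 'rV[R]_n) : tpi y' = tpi z0 ->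
  cimg (tchart s) (z + (y' - z0)) -> cmap (tchart s) (tpi z) = z + (y' - z0).
Proof.
move=> yz [q sq qE].
suff -> : tpi z = q by [].
have -> : z = z0 + (z - z0) by rewrite addrC subrK.
rewrite -(tpiD (z - z0) yz); have -> : y' + (z - z0) = z + (y' - z0) by rewrite addrCA.
by rewrite -qE; exact: tchartK.
Qed.

(** A chart is a local inverse of [tpi] up to a translation, under which [tpi] is
well behaved by [tpiD]. *)
Lemma smooth_fun_torus f : smooth_fun f <-> smooth_on setT (f \o @tpi R n).
Proof.
split=> [fs k|fs i k]; last by apply: (Ck_sub (U := setT)) => //; exact: fs.
apply: Ck_local => z _; have [i ip] := atlas_cover (c := torusM) (tpi z).
set y := cmap (atlas torusM i) (tpi z).
have yz : tpi y = tpi z by exact: (cmapK ip).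
have oi := @cimg_open _ _ torusM i.
exists [set x | cimg (atlas torusM i) (x + (y - z))], (fun x => f (tpi (x + (y - z)))); split.
- exact: open_translate oi.
- by rewrite /= addrC subrK; exists (tpi z).
- exact: (@Ck_translate R _ k _ (f \o cinv (atlas torusM i)) (y - z) oi (fs i k)).
- move=> x _; rewrite /=; congr f.
  by rewrite addrCA (tpiD (x - z) yz) addrC subrK.
Qed.

(** A section of [tpi], not continuous in general: it serves to define functions on the
torus from functions invariant under the fibres of [tpi]. *)
Definition lift p : 'rV[R]_n := xget 0 [set z | tpi z = p].

Lemma liftK p : tpi (lift p) = p.
Proof. by rewrite /lift; case: xgetP => // /(_ _ ) N; have [z zp] := tpi_surj p; case: (N z). Qed.

Lemma smooth_fun_lift (F : 'rV[R]_n -> R) : (forall z z', tpi z = tpi z' -> F z = F z') ->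
  smooth_on setT F -> smooth_fun (F \o lift : torusM -> R).
Proof.
move=> Fi Fs; apply/smooth_fun_torus => k; have := Fs k; congr Ck.
by apply/funext => z; apply: Fi; rewrite liftK.
Qed.

(** Near a given point, a chart at the image reads the lift up to a constant
translation ([tchart_lift]). *)
Lemma smooth_family_torus (I : set R) (psi : R -> torusM -> torusM) (Phi : RV -> 'rV[R]_n) :
  open I -> (forall t z, I t -> psi t (tpi z) = tpi (Phi (t, z))) ->
  (forall k i, Ck k [set x : RV | I x.1] (fun x => Phi x 0 i)) ->
  smooth_family I psi.
Proof.
move=> oI PhiE Phis.
have oIx : open [set x : RV | I x.1] by exact: open_fst.
have Phic (x : RV) : I x.1 -> {for x, continuous Phi}.
  by move=> Ix; apply: rV_continuous => i; exact: (Ck_cont (Phis 0%N i)).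
have jc : jcont I psi.
  move=> t p It; have [i ip] := atlas_cover p.
  have H : {for (t, p), continuous (fun tp : R * torusM =>
      tpi (Phi (tp.1, cmap (atlas torusM i) tp.2)))}.
    apply: (@continuous_comp _ _ _ (fun tp : R * torusM =>
       Phi (tp.1, cmap (atlas torusM i) tp.2)) (@tpi R n)); last exact: tpi_continuous.
    apply: (@continuous_comp _ _ _ (fun tp : R * torusM =>
       ((tp.1, cmap (atlas torusM i) tp.2) : RV)) Phi); last exact: Phic.
    apply: continuous_pair; first exact: cvg_fst.
    by apply: continuous_snd_comp; exact: cmap_continuous.
  have E (tp : R * torusM) : I tp.1 -> cdom (atlas torusM i) tp.2 ->
      tpi (Phi (tp.1, cmap (atlas torusM i) tp.2)) = psi tp.1 tp.2.
    by move=> Itp itp; rewrite -PhiE//; congr (psi _ _); exact: (cmapK itp).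
  have N : \forall tp \near (t, p), tpi (Phi (tp.1, cmap (atlas torusM i) tp.2)) = psi tp.1 tp.2.
    have N1 : \forall s \near t, I s by exact: open_nbhs_nbhs.
    have N2 : \forall q \near p, cdom (atlas torusM i) q.
      by apply: open_nbhs_nbhs; split => //; exact: cdom_open.
    exists ([set s | I s], [set q | cdom (atlas torusM i) q]) => //.
    by move=> tp [/= ? ?]; exact: E.
  have e : tpi (Phi (t, cmap (atlas torusM i) p)) = psi t p := E (t, p) It ip.
  move=> U; rewrite -[_.1]/t -[_.2]/p -e => /H HU.
  have : nbhs (t, p) [set tp : R * torusM | U (tpi (Phi (tp.1, cmap (atlas torusM i) tp.2)))] by exact: HU.
  by move: N; apply: filterS2 => tp; rewrite /= => <-.
split => // i j k m.

apply: Ck_local => ty0 [It0 ity0 jty0].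
set z0 := Phi ty0; set y' := cmap (atlas torusM j) (psi ty0.1 (cinv (atlas torusM i) ty0.2)).
have yz : tpi y' = tpi z0.
  transitivity (psi ty0.1 (cinv (atlas torusM i) ty0.2)); first exact: (cmapK jty0).
  by rewrite /z0 [ty0 in RHS]surjective_pairing -PhiE.
have oj := @cimg_open _ _ torusM j.
exists ([set x : RV | I x.1] `&` (fun x => Phi x + (y' - z0)) @^-1` cimg (atlas torusM j)),
  (fun x : RV => Phi x 0 k + (y' - z0) 0 k); split.
- apply: openI_preimage; [exact: oIx|exact: oj|move=> x Ix].
  by apply: (@continuous_comp _ _ _ Phi (fun z => z + (y' - z0))); [exact: Phic|exact: translate_continuous].
- split => //=; rewrite -/z0 addrC subrK; by exists (psi ty0.1 (cinv (atlas torusM i) ty0.2)).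
- apply: Ck_add.
  + apply: openI_preimage; [exact: oIx|exact: oj|move=> x Ix].
    by apply: (@continuous_comp _ _ _ Phi (fun z => z + (y' - z0))); [exact: Phic|exact: translate_continuous].
  + by apply: (Ck_sub (U := [set x : RV | I x.1])); [move=> x []|exact: Phis].
  + exact: Ck_cst.
- move=> x [Ix jx].
  have e1 : psi x.1 (cinv (atlas torusM i) x.2) = tpi (Phi x).
    by rewrite [x in RHS]surjective_pairing -PhiE.
  have e2 : cmap (atlas torusM j) (tpi (Phi x)) = Phi x + (y' - z0) := tchart_lift yz jx.
  by rewrite e1 e2 [LHS]mxE [in X in _ + X]mxE.
Qed.

Lemma partial_tpi f k z z' : tpi z = tpi z' -> partial k (f \o @tpi R n) z = partial k (f \o @tpi R n) z'.
Proof.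
move=> zz; apply: derive_eq_line => h /=; congr f.
by rewrite addrC (tpiD _ zz) addrC.
Qed.

(** The vector field d/dz_k. *)
Definition tdir (k : 'I_n) p : tvec torusM :=
  smooth_part (fun f => partial k (f \o @tpi R n) (lift p)).

Lemma coordvec_torus i k y : coordvec (M := torusM) i k y = tdir k (tpi y).
Proof.
apply/funext => f; rewrite /coordvec /tdir; case: (pselect (smooth_fun f)) => fs.
  by rewrite !smooth_partE//; apply: partial_tpi; rewrite liftK.
by rewrite !smooth_partN.
Qed.

Lemma tdir_tangent k p : tangent p (tdir k p).
Proof.
have [i ip] := atlas_cover p.
rewrite -(cmapK ip) -(coordvec_torus i k); apply: coordvec_tangent; exact: cimg_cmap.
Qed.

Lemma tdirE k z f : smooth_fun f -> tdir k (tpi z) f = partial k (f \o @tpi R n) z.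
Proof. by move=> fs; rewrite /tdir smooth_partE//; apply: partial_tpi; rewrite liftK. Qed.

End TorusManifold.

Arguments torusM R n : clear implicits.

(** * Averages and Hadamard's lemma *)

(** The tube lemma; near coverings are the form of compactness suited to it. *)
Lemma tube (X Y : topologicalType) (K : set X) (y : Y) (P : Y -> X -> Prop) : compact K ->
  (forall x, K x -> nbhs (x, y) [set xy : X * Y | P xy.2 xy.1]) ->
  nbhs y [set y' | forall x, K x -> P y' x].
Proof.
move=> /(iffLR (compact_near_coveringP K)) cK H.
apply: (cK Y (nbhs y) P) => x Kx; have [[A B] /= [Ax By] AB] := H x Kx.
by exists (A, B) => //= -[x' y'] /= [Ax' By']; exact: (AB (x', y')).
Qed.

Lemma nbhs_sub (X : topologicalType) (x : X) (A B : set X) : nbhs x A -> A `<=` B -> nbhs x B.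
Proof. by move=> xA AB; apply: filterS xA. Qed.

Lemma continuous_dist (R : realType) (X : topologicalType) (f : X -> R) (x : X) :
  (forall e, 0 < e -> nbhs x [set y | `|f y - f x| <= e]) -> {for x, continuous f}.
Proof.
move=> H; apply/cvgrPdist_le => e e0; apply: filterS (H e e0) => y /=.
by rewrite distrC.
Qed.

Lemma nbhs_snd (X Y : topologicalType) (x : X) (y : Y) (P : X * Y -> Prop) :
  nbhs (x, y) P -> nbhs (x, y) [set xy : X * Y | P xy /\ P (xy.1, y)].
Proof.
move=> [[A B] /= [Ax By] AB]; exists (A, B) => //= -[x' y'] /= [Ax' By'].
by split; apply: AB => //; split => //; exact: nbhs_singleton.
Qed.

Section Mean.
Context {R : realType}.
Local Notation leb := (@lebesgue_measure R).
Implicit Types f g : R -> R.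

Definition mean f : R := \int[leb]_(s in `[0, 1]) f s.

Lemma mean_integrable f : continuous f -> leb.-integrable `[0, 1] (EFin \o f).
Proof.
move=> fc; apply: continuous_compact_integrable; first exact: segment_compact.
exact: continuous_subspaceT.
Qed.

Lemma mean_lin f g (a : R) : continuous f -> continuous g ->
  mean (fun s => a * (f s - g s)) = a * (mean f - mean g).
Proof.
move=> fc gc; have m1 : measurable (`[0, 1]%classic : set (measurableTypeR R)) by exact: measurable_itv.
rewrite /mean RintegralZl//.
  by rewrite (RintegralB m1 (mean_integrable fc) (mean_integrable gc)).
apply: (@mean_integrable (fun s => f s - g s)) => s.
by apply: cvgB; [exact: fc|exact: gc].
Qed.

Lemma mean_cst (a : R) : mean (fun=> a) = a.
Proof.
have m1 : measurable (`[0, 1]%classic : set (measurableTypeR R)) by exact: measurable_itv.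
have l1 : leb (`[0, 1]%classic : set R) = 1%E.
  by rewrite lebesgue_measure_itv/= lte_fin ltr01 oppr0 adde0.
transitivity (a * fine (leb (`[0, 1]%classic : set R))); last by rewrite l1 mulr1.
exact: (Rintegral_cst leb m1 a).
Qed.

Lemma mean_dist f g (e : R) : continuous f -> continuous g ->
  (forall s, 0 <= s <= 1 -> `|f s - g s| <= e) -> `|mean f - mean g| <= e.
Proof.
move=> fc gc fg; have m1 : measurable (`[0, 1]%classic : set (measurableTypeR R)) by exact: measurable_itv.
have dc : continuous (fun s => f s - g s) by move=> s; apply: cvgB; [exact: fc|exact: gc].
rewrite /mean -(RintegralB m1 (mean_integrable fc) (mean_integrable gc)).
apply: le_trans (le_normr_Rintegral m1 (mean_integrable dc)) _.
rewrite -[leRHS]mean_cst; apply: le_Rintegral => //.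
- by apply: mean_integrable => s; apply: cvg_norm; exact: dc.
- by apply: mean_integrable => s; exact: cvg_cst.
Qed.

End Mean.

Section ParametricMean.
Context {R : realType} {n : nat}.
Local Notation RV := (R^o * 'rV[R]_n)%type.
Implicit Types (h : RV -> R) (z v : 'rV[R]_n).

Definition pmean h z : R := mean (fun s => h (s, z)).

Lemma slice_continuous h z : continuous h -> continuous (fun s : R => h (s, z)).
Proof.
move=> hc s; apply: (@continuous_comp _ _ _ (fun s : R^o => (s, z) : RV) h); last exact: hc.
exact: pair_fst_continuous.
Qed.

(** Compactness of [0, 1] makes continuity in the parameter uniform. *)
Lemma uniform_slice h z (e : R) : continuous h -> 0 < e ->
  \forall z' \near z, forall s, 0 <= s <= 1 -> `|h (s, z') - h (s, z)| <= e.
Proof.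
move=> hc e0; have e2 : 0 < e / 2 by rewrite divr_gt0.
have cK : compact (`[0, 1]%classic : set R) by exact: segment_compact.
have H : nbhs z [set z' | forall s, (`[0, 1]%classic : set R) s -> `|h (s, z') - h (s, z)| <= e].
  apply: (tube cK) => s _; have /cvgr_dist_le/(_ _ e2) hs := hc (s, z).
  apply: (nbhs_sub (nbhs_snd hs)) => -[s' z'] /= [h1 h2].
  rewrite (_ : h (s', z') - h (s', z) = (h (s, z) - h (s', z)) - (h (s, z) - h (s', z'))); last by lra.
  by apply: le_trans (ler_normB _ _) _; lra.
apply: (nbhs_sub H) => z' H' s s01; apply: H'; by rewrite /= in_itv.
Qed.

Lemma pmean_continuous h : continuous h -> continuous (pmean h).
Proof.
move=> hc z; apply: continuous_dist => e e0.
apply: (nbhs_sub (uniform_slice z hc e0)) => z' H.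
apply: mean_dist; [exact: slice_continuous|exact: slice_continuous|].
exact: H.
Qed.

(** Differentiation under the integral sign.  By the mean value theorem the difference
quotient of [h] is a value of its derivative at a nearby parameter, and
[uniform_slice] makes this approximation uniform over [0, 1]. *)
Lemma is_derive_pmean h z v : (forall k, Ck k setT h) ->
  is_derive z v (pmean h : 'rV[R]_n -> R^o) (pmean ('D_((0, v) : RV) (h : RV -> R^o)) z).
Proof.
move=> hs.
have hc : continuous h by move=> x; exact: (Ck_cont (hs 0%N)).
set h' := 'D_((0, v) : RV) (h : RV -> R^o).
have hc' : continuous h' by move=> x; exact: (Ck_cont (Ck_D ((0, v) : RV) (hs 1%N))).
suff L : (fun t : R => t^-1 *: (pmean h (t *: v + z) - pmean h z : R^o)) @ 0^' --> pmean h' z.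
  by apply: DeriveDef; [apply/cvg_ex; exists (pmean h' z)|apply: cvg_lim].
apply/cvgrPdist_le => e e0.
have lc : (fun t : R => t *: v + z) @ 0 --> z.
  rewrite -[X in _ --> X](add0r z) -(scale0r v).
  apply: cvgD; last exact: cvg_cst.
  by apply: cvgZr_tmp; exact: cvg_id.
have /lc U := uniform_slice z hc' e0.
have [d /= d0 dU] := U.
near=> t.
have td : `|t| < d by near: t; exists d => //= t; rewrite /= sub0r normrN.
have t0 : t != 0 by near: t; exact: nbhs_dnbhs_neq.
have sc w : continuous (fun s : R => h (s, w)) by exact: slice_continuous.
rewrite distrC.
have -> : t^-1 *: (pmean h (t *: v + z) - pmean h z : R^o) =
    mean (fun s => t^-1 * (h (s, t *: v + z) - h (s, z))).
  by rewrite (mean_lin t^-1 (sc _) (sc _)).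
apply: mean_dist.
- move=> s; apply: cvgM; first exact: cvg_cst.
  by apply: cvgB; exact: sc.
- exact: slice_continuous.
- move=> s s01.
  have [r rt] := @MVT_line R _ setT h ((0, v) : RV) ((s, z) : RV) t (hs 1%N) (fun _ _ => I).
  have E r' : r' *: ((0, v) : RV) + (s, z) = (s, r' *: v + z).
    by congr pair; rewrite /= ?scaler0 ?add0r.
  rewrite !E => ->; rewrite mulrA mulVf// mul1r -/h'.
  apply: (dU r) => //=; rewrite sub0r normrN; exact: le_lt_trans td.
Unshelve. all: by end_near. Qed.

Lemma pmean_smooth h : (forall k, Ck k setT h) -> forall k, Ck k setT (pmean h).
Proof.
move=> hs k; elim: k h hs => [|k ih] h hs.
  split=> // z _; apply: pmean_continuous => x; exact: (Ck_cont (hs 0%N)).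
apply: CkS.
- move=> z _; apply: pmean_continuous => x; exact: (Ck_cont (hs 0%N)).
- by move=> v z _; have [] := is_derive_pmean z v hs.
- move=> v; apply: (Ck_ext (g := pmean ('D_((0, v) : RV) (h : RV -> R^o)))); first exact: openT.
    by move=> z _; have [] := is_derive_pmean z v hs.
  by apply: ih => l; apply: Ck_D; exact: hs.
Qed.

End ParametricMean.

Lemma is_derive_continuous (R : realType) (f : R -> R) (x df : R) :
  is_derive x (1 : R) (f : R -> R^o) df -> {for x, continuous f}.
Proof. by move=> [fd _]; apply: differentiable_continuous; exact/derivable1_diffP. Qed.

Lemma mean_FTC (R : realType) (f f' : R -> R) :
  (forall s, is_derive s (1 : R) (f : R -> R^o) (f' s)) -> continuous f' ->
  mean f' = f 1 - f 0.
Proof.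
move=> fd f'c; rewrite /mean /Rintegral (@continuous_FTC2 R f' f 0 1)//.
- exact: continuous_subspaceT.
- split.
  + by move=> x _; have [] := fd x.
  + by apply: cvg_at_right_filter; exact: is_derive_continuous (fd 0).
  + by apply: cvg_at_left_filter; exact: is_derive_continuous (fd 1).
- by move=> x _; rewrite derive1E; have [_ ->] := fd x.
Qed.

Section Hadamard.
Context {R : realType} {n : nat}.
Local Notation RV := (R^o * 'rV[R]_n)%type.
Implicit Types (F : 'rV[R]_n -> R) (z : 'rV[R]_n) (i : 'I_n).

Definition repl i (a : R) z : 'rV[R]_n := (a - z 0 i) *: delta_mx 0 i + z.

Lemma replE i a z j : repl i a z 0 j = if j == i then a else z 0 j.
Proof. by rewrite !mxE eqxx; case: eqP => [->|_]/=; rewrite ?mulr1 ?mulr0 ?add0r ?subrK. Qed.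

Lemma Ck_repl k F i a : (forall k, Ck k setT F) -> Ck k setT (fun z => F (repl i a z)).
Proof.
move=> Fs; have oT : open (setT : set 'rV[R]_n) by exact: openT.
apply: (Ck_comp_rV (f := F) (b := repl i a) oT oT); [by []| |exact: Fs].
move=> j; have -> : (fun z => repl i a z 0 j) = (fun z => if j == i then a else z 0 j).
  by apply/funext => z; rewrite replE.
by case: eqP => _; [exact: Ck_cst|exact: Ck_coord].
Qed.

(** Hadamard's lemma: the difference quotient of a smooth function in one
coordinate extends smoothly over the hyperplane where its denominator vanishes,
because it is an average of the partial derivative. *)
Lemma hadamard_div F i (a : R) : (forall k, Ck k setT F) -> exists Q : 'rV[R]_n -> R,
  [/\ forall k, Ck k setT Q,
      forall z, F z - F (repl i a z) = (z 0 i - a) * Q z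
    & forall z, z 0 i = a -> Q z = partial i F z].
Proof.
move=> Fs; pose e : 'rV[R]_n := delta_mx 0 i.
pose b (x : RV) : 'rV[R]_n := (x.1 * (x.2 0 i - a)) *: e + repl i a x.2.
pose h (x : RV) := partial i F (b x).
have oT : open (setT : set RV) by exact: openT.
have hs k : Ck k setT h.
  have oV : open (setT : set 'rV[R]_n) by exact: openT.
  apply: (Ck_comp_rV (f := partial i F) (b := b) oT oV); [by []| |by apply: Ck_D; exact: Fs].
  move=> j; have -> : (fun x => b x 0 j) =
      (fun x : RV => (x.1 * (x.2 0 i + - a)) * e 0 j + (if j == i then a else x.2 0 j)).
    by apply/funext => x; rewrite mxE replE mxE.
  apply: (Ck_add oT).
    apply: (Ck_mul oT); last exact: Ck_cst.
    apply: (Ck_mul oT); first exact: Ck_fst.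
    by apply: (Ck_add oT); [exact: Ck_snd|exact: Ck_cst].
  by case: eqP => _; [exact: Ck_cst|exact: Ck_snd].
have hc : continuous h by move=> x; exact: (Ck_cont (hs 0%N)).
(* h is the partial derivative along the segment from the hyperplane to the point; up
   to the factor z_i - a, its average is the increment of F over this segment. *)
exists (pmean h); split.
- exact: pmean_smooth.
- move=> z; set u := z 0 i - a.
  have sc : continuous (fun s : R => h (s, z)) by exact: slice_continuous.
  have d s : is_derive s (1 : R) (fun s : R => F ((s * u) *: e + repl i a z) : R^o) (u * (h (s, z) - 0)).
    rewrite subr0 mulrC.
    have d1 : is_derive s (1 : R) (fun s : R => s * u : R^o) (s * 0 + u * 1).
      by apply: (@is_derive_mulp _ _ (fun s : R => s : R) (fun=> u)).
    have d2 := @is_derive_line R _ F e (repl i a z) (s * u) (Ck_derivable (Fs 1%N) I).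
    have := @is_derive1_comp R (fun s : R => F (s *: e + repl i a z)) (fun s : R => s * u) s _ _ d2 d1.
    by rewrite mulr0 add0r mulr1.
  have cc : continuous (fun s : R => u * (h (s, z) - 0)).
    by move=> s; apply: cvgM; [exact: cvg_cst|apply: cvgB; [exact: sc|exact: cvg_cst]].
  have := mean_FTC d cc; rewrite (@mean_lin R (fun s => h (s, z)) (fun=> 0)); last 2 first.
  - exact: sc.
  - by move=> s; exact: cvg_cst.
  rewrite mean_cst subr0 => ->; rewrite mul1r mul0r scale0r add0r; congr (F _ - _).
  by rewrite /repl -/e /u addrA -scalerDl addrA subrK subrr scale0r add0r.
- move=> z za; rewrite /pmean.
  have -> : (fun s => h (s, z)) = fun=> partial i F z.
    apply/funext => s; rewrite /h; congr (partial i F _).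
    by rewrite /b /repl /= za !subrr mulr0 !scale0r !add0r.
  exact: mean_cst.
Qed.

End Hadamard.

(** * Derivations on the torus *)

Section Trigonometry.
Context {R : realType}.

Lemma cos_sin_smooth (b : bool) :
  smooth_on (E := R^o) setT ((if b then cos else sin : R -> R) : R^o -> R).
Proof.
apply: (@smooth_family1 R bool (fun b => if b then cos else sin)
  (fun b => if b then -1 else 1) (fun=> 0) negb id) => -[] x /=.
- by rewrite mul0r addr0 mulN1r; exact: is_derive_cos.
- by rewrite mul0r addr0 mul1r; exact: is_derive_sin.
Qed.

Lemma Ck_cos k (E : normedModType R) (U : set E) (f : E -> R) : open U ->
  Ck k U f -> Ck k U (fun x => cos (f x)).
Proof.
move=> oU fk; apply: (Ck_comp1 (K := setT) oU) => //; first exact: openT.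
exact: (cos_sin_smooth true).
Qed.

Lemma Ck_sin k (E : normedModType R) (U : set E) (f : E -> R) : open U ->
  Ck k U f -> Ck k U (fun x => sin (f x)).
Proof.
move=> oU fk; apply: (Ck_comp1 (K := setT) oU) => //; first exact: openT.
exact: (cos_sin_smooth false).
Qed.

End Trigonometry.

Section TorusHadamard.
Context {R : realType} {n : nat}.
Local Notation T := (torusM R n).
Implicit Types (f : T -> R) (p q : T) (z : 'rV[R]_n) (i : 'I_n).

Lemma cs_smooth i : smooth_fun (fun q : T => cs q i).
Proof.
apply/smooth_fun_torus => k.
have -> : (fun q : T => cs q i) \o @tpi R n = fun z => cos (z 0 i).
  by apply/funext => z /=; rewrite cs_tpi.
by apply: Ck_cos; [exact: openT|exact: Ck_coord].
Qed.

Lemma sn_smooth i : smooth_fun (fun q : T => sn q i).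
Proof.
apply/smooth_fun_torus => k.
have -> : (fun q : T => sn q i) \o @tpi R n = fun z => sin (z 0 i).
  by apply/funext => z /=; rewrite sn_tpi.
by apply: Ck_sin; [exact: openT|exact: Ck_coord].
Qed.

(** The sine and the cosine of the difference of two angles. *)
Definition tsn i p q : R := sn q i * cs p i - cs q i * sn p i.
Definition tcs i p q : R := cs q i * cs p i + sn q i * sn p i.

Lemma tsn_smooth i p : smooth_fun (tsn i p : T -> R).
Proof.
have := smooth_fun_lin (- sn p i) (cs_smooth i)
  (smooth_fun_mul (sn_smooth i) (smooth_fun_cst (cs p i))).
by congr smooth_fun; apply/funext => q; rewrite /tsn; ring.
Qed.

Lemma tcs_smooth i p : smooth_fun (tcs i p : T -> R).
Proof.
have := smooth_fun_lin (sn p i) (sn_smooth i)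
  (smooth_fun_mul (cs_smooth i) (smooth_fun_cst (cs p i))).
by congr smooth_fun; apply/funext => q; rewrite /tcs; ring.
Qed.

Lemma tsn_tpi i a z : tsn i (tpi a) (tpi z) = sin (z 0 i - a 0 i).
Proof. by rewrite /tsn !cs_tpi !sn_tpi sinB. Qed.

Lemma tcs_tpi i a z : tcs i (tpi a) (tpi z) = cos (z 0 i - a 0 i).
Proof. by rewrite /tcs !cs_tpi !sn_tpi cosB. Qed.

(** Replacing an angle is an operation on the torus itself. *)
Lemma tpi_repl i (a : R) z z' : tpi z = tpi z' -> tpi (repl i a z) = tpi (repl i a z').
Proof.
move=> e; apply: torus_eq => j; rewrite ?cs_tpi ?sn_tpi !replE; case: eqP => // _.
  by rewrite -!cs_tpi e.
by rewrite -!sn_tpi e.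
Qed.

Lemma cos1_sin0 (x : R) : cos x = 1 -> sin x = 0.
Proof. by move=> c1; apply/eqP; rewrite -sqrf_eq0; have := cos2Dsin2 x; rewrite c1; lra. Qed.

Lemma tpi_repl_eq i (a : R) z : cos (z 0 i - a) = 1 -> tpi (repl i a z) = tpi z.
Proof.
move=> c1; have s0 := cos1_sin0 c1.
apply: torus_eq => j; rewrite ?cs_tpi ?sn_tpi !replE; case: eqP => // ->.
  by rewrite -[z 0 i](subrK a) cosD c1 s0 mul1r mul0r subr0.
by rewrite -[z 0 i](subrK a) sinD c1 s0 mul0r mul1r add0r.
Qed.

Definition trepl i (a : R) f q : R := f (tpi (repl i a (lift q))).

Lemma trepl_tpi i a f z : trepl i a f (tpi z) = f (tpi (repl i a z)).
Proof. by rewrite /trepl (tpi_repl i a (liftK (tpi z))). Qed.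

Lemma trepl_smooth i a f : smooth_fun f -> smooth_fun (trepl i a f).
Proof.
move=> /smooth_fun_torus fs; apply/smooth_fun_torus => k.
have -> : trepl i a f \o @tpi R n = fun z => (f \o @tpi R n) (repl i a z).
  by apply/funext => z; exact: trepl_tpi.
exact: Ck_repl.
Qed.

Section Quotient.
Variables (F : 'rV[R]_n -> R) (i : 'I_n) (a : R).
Hypotheses (Fs : forall k, Ck k setT F).

(** With [u] the difference of the angles, (F - F(repl)) (1 + cos u) / 2 divided by
[sin u], with its limit where [u] is a multiple of 2 pi. *)
Definition hquot z : R := if cos (z 0 i - a) == 1 then partial i F z
  else (F z - F (repl i a z)) * sin (z 0 i - a) / (2 * (1 - cos (z 0 i - a))).

(** Near the hyperplane z_i = a both the numerator and sin u are divisible by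
u = z_i - a, and S = sin u / u has the value 1 there. *)
Lemma hquot_near : exists S H : 'rV[R]_n -> R,
  [/\ open [set z | S z != 0], forall z, z 0 i = a -> S z = 1,
      forall k, Ck k [set z | S z != 0] H & forall z, S z != 0 -> hquot z = H z].
Proof.
have oT : open (setT : set 'rV[R]_n) by exact: openT.
have uk k : Ck k setT (fun z : 'rV[R]_n => z 0 i - a).
  by apply: (Ck_add oT); [exact: Ck_coord|exact: Ck_cst].
have [Q [Qs QE Q0]] := hadamard_div i a Fs.
have [S [Ss SE S0]] := hadamard_div (F := fun z => sin (z 0 i - a)) i a (fun k => Ck_sin oT (uk k)).
have {}SE z : sin (z 0 i - a) = (z 0 i - a) * S z.
  by rewrite -SE replE eqxx subrr sin0 subr0.
have {}S0 z : z 0 i = a -> S z = 1.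
  move=> za; rewrite S0// /partial.
  rewrite (@derive_eq_line _ _ (R^o : normedModType R) _ sin _ _ 0 1); first last.
    by move=> h; rewrite !mxE !eqxx za addrK addr0.
  by have [_ ->] := @is_derive_sin R 0; rewrite cos0.
pose H z := Q z * (1 + cos (z 0 i - a)) / (2 * S z).
have oV : open [set z | S z != 0].
  apply: (open_comp (f := S) (D := [set x | x != 0])); last exact: open_neq.
  by move=> z _; exact: (Ck_cont (Ss 0%N)).
exists S, H; split => //.
- move=> k; apply: (Ck_mul oV).
    apply: (Ck_mul oV); first exact: Ck_sub (Qs k).
    apply: (Ck_add oV); first exact: Ck_cst.
    by apply: (Ck_cos oV); exact: Ck_sub (uk k).
  apply: (Ck_inv oV); first by move=> z Sz; rewrite mulf_neq0// pnatr_eq0.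
  by apply: (Ck_mul oV); [exact: Ck_cst|exact: Ck_sub (Ss k)].
- move=> z Sz; rewrite /hquot /H; case: eqP => [c1|/eqP c1].
    have za : z 0 i = a.
      move: (cos1_sin0 c1); rewrite SE => /eqP; rewrite mulf_eq0 (negbTE Sz) orbF subr_eq0 => /eqP//.
    by rewrite c1 S0// Q0//; field.
  rewrite QE SE; have := cos2Dsin2 (z 0 i - a); rewrite SE.
  move: c1 Sz; move: (z 0 i - a) (S z) (Q z) (cos _) => u s q c c1 s0 e.
  have c1' : 1 - c != 0 by rewrite subr_eq0 eq_sym.
  rewrite (_ : u * q * (u * s) = q * (u * s) ^+ 2 / s); last by field.
  have -> : (u * s) ^+ 2 = (1 - c) * (1 + c) by rewrite -[RHS]/((1 - c) * (1 + c)) -(addrK (c ^+ 2) ((u * s) ^+ 2)) [_ + c ^+ 2]addrC e; ring.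
  by field; rewrite s0 c1'.
Qed.

Hypothesis Fi : forall z z', tpi z = tpi z' -> F z = F z'.

Lemma hquot_inv z z' : tpi z = tpi z' -> hquot z = hquot z'.
Proof.
move=> zz; rewrite /hquot !cosB !sinB -!cs_tpi -!sn_tpi zz (Fi zz).
rewrite (Fi (tpi_repl i a zz)); case: ifP => // _.
by apply: derive_eq_line => h; apply: Fi; rewrite addrC (tpiD _ zz) addrC.
Qed.

(** A point where cos u = 1 is moved to the hyperplane z_i = a by a translation which
does not change its image on the torus; there [hquot_near] applies. *)
Lemma hquot_smooth k : Ck k setT hquot.
Proof.
have oT : open (setT : set 'rV[R]_n) by exact: openT.
have [S [H [oS S1 Hs HE]]] := hquot_near.
have uc : continuous (fun z : 'rV[R]_n => cos (z 0 i - a)).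
  move=> z; apply: (@Ck_cont _ _ 0 setT) => //; apply: (Ck_cos oT).
  by apply: (Ck_add oT); [exact: Ck_coord|exact: Ck_cst].
apply: Ck_local => z0 _; have [c1|c1] := eqVneq (cos (z0 0 i - a)) 1.
  pose w := repl i a z0 - z0.
  have wE z : tpi (z + w) = tpi z.
    by rewrite /w addrCA (tpiD (z - z0) (tpi_repl_eq c1)) addrC subrK.
  exists [set z | S (z + w) != 0], (fun z => H (z + w)); split.
  - exact: open_translate oS.
  - by rewrite /= /w addrC subrK S1 ?oner_neq0// replE eqxx.
  - exact: (@Ck_translate _ _ k _ H w oS (Hs k)).
  - by move=> z Sz; rewrite -(hquot_inv (wE z)) HE.
have oC : open [set z : 'rV[R]_n | cos (z 0 i - a) != 1].
  apply: (open_comp (f := fun z : 'rV[R]_n => cos (z 0 i - a)) (D := [set x | x != 1])); last exact: open_neq.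
  by move=> z _; exact: uc.
exists [set z : 'rV[R]_n | cos (z 0 i - a) != 1],
  (fun z : 'rV[R]_n => (F z - F (repl i a z)) * sin (z 0 i - a) / (2 * (1 - cos (z 0 i - a)))); split => //.
- have uk : Ck k [set z : 'rV[R]_n | cos (z 0 i - a) != 1] (fun z : 'rV[R]_n => z 0 i - a).
    by apply: (Ck_add oC); [exact: Ck_coord|exact: Ck_cst].
  apply: (Ck_mul oC).
    apply: (Ck_mul oC); last exact: (Ck_sin oC uk).
    apply: (Ck_add oC); first exact: Ck_sub (Fs k).
    apply: (Ck_opp oC); exact: Ck_sub (Ck_repl k i a Fs).
  apply: (Ck_inv oC).
    by move=> z /= c; rewrite mulf_neq0 ?pnatr_eq0// subr_eq0 eq_sym.
  apply: (Ck_mul oC); first exact: Ck_cst.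
  apply: (Ck_add oC); first exact: Ck_cst.
  by apply: (Ck_opp oC); exact: (Ck_cos oC uk).
- by move=> z /= /negbTE c; rewrite /hquot c.
Qed.

End Quotient.

(** Hadamard's lemma on the torus: a derivation only sees a function through its
partial derivatives, one coordinate at a time.  The difference g of [f] and of its
restriction to a hypersurface is sin u * k + g * (1 - cos u) / 2 with [k] smooth,
and both factors of the last product vanish at the point. *)
Lemma tangent_trepl i (f : T -> R) (v : tvec T) a : smooth_fun f -> tangent (tpi a : T) v ->
  v f = v (trepl i (a 0 i) f) + v (tsn i (tpi a)) * partial i (f \o @tpi R n) a.
Proof.
move=> fs [vl vm _]; pose F := f \o @tpi R n; pose p : T := tpi a.
have Fs : forall k, Ck k setT F by apply/smooth_fun_torus.
have Fi z z' : tpi z = tpi z' -> F z = F z' by rewrite /F /= => ->.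
have FE z : f (tpi z) = F z by [].
pose r := trepl i (a 0 i) f; have rs : smooth_fun r by exact: trepl_smooth.
pose k : T -> R := hquot F i (a 0 i) \o @lift R n.
have kE z : k (tpi z) = hquot F i (a 0 i) z by rewrite /k /=; apply: hquot_inv => //; exact: liftK.
have ks : smooth_fun k by apply: smooth_fun_lift; [move=> z z'; exact: hquot_inv|move=> m; exact: hquot_smooth].
pose g q := (-1) * r q + f q; have gs : smooth_fun g by exact: smooth_fun_lin.
pose m q := (- 2^-1) * tcs i p q + 2^-1.
have ms : smooth_fun m by apply: smooth_fun_lin; [exact: tcs_smooth|exact: smooth_fun_cst].
have gE : g = fun q => 1 * (tsn i p q * k q) + g q * m q.
  apply/funext => q; have [z <-] := tpi_surj q.
  rewrite kE /m tsn_tpi tcs_tpi /g /r trepl_tpi !FE /hquot.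
  case: eqP => [c1|/eqP c1].
    by rewrite -(Fi _ _ (tpi_repl_eq c1)) (cos1_sin0 c1) mulN1r addNr !mul0r mulr0 addr0.
  have := cos2Dsin2 (z 0 i - a 0 i); move: c1.
  move: (F z) (F _) (sin _) (cos _) => A B s c c1 e.
  have c1' : 1 - c != 0 by rewrite subr_eq0 eq_sym.
  have -> : s * ((A - B) * s / (2 * (1 - c))) = (A - B) * s ^+ 2 / (2 * (1 - c)) by field.
  have -> : s ^+ 2 = (1 - c) * (1 + c) by rewrite -(addrK (c ^+ 2) (s ^+ 2)) [_ + c ^+ 2]addrC e; ring.
  by field.
have ap : tcs i p p = 1 by rewrite tcs_tpi subrr cos0.
have sp : tsn i p p = 0 by rewrite tsn_tpi subrr sin0.
have gp : g p = 0 by rewrite /g /r trepl_tpi (tpi_repl_eq (z := a)) ?subrr ?cos0// mulN1r addNr.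
have vg : v g = v (tsn i p) * k p.
  rewrite {1}gE vl ?vm//; try by [exact: tsn_smooth|apply: smooth_fun_mul; rewrite //; exact: tsn_smooth].
  by rewrite sp gp /m ap; lra.
have := vl (-1) r f rs fs; rewrite -/g vg kE /hquot subrr cos0 eqxx -/p => ->.
by rewrite -/r mulN1r addrA subrr add0r.
Qed.

End TorusHadamard.

Lemma continuous_near_eq (X Y : topologicalType) (f g : X -> Y) (x : X) :
  (\forall y \near x, f y = g y) -> {for x, continuous g} -> {for x, continuous f}.
Proof.
move=> fg gc U; rewrite -[_ x]/(f x) (nbhs_singleton fg) => /gc gU.
have gU' : nbhs x [set y | U (g y)] by exact: gU.
have : nbhs x [set y | U (f y)] by move: fg gU'; apply: filterS2 => y; rewrite /= => ->.
by [].
Qed.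

Lemma smooth_fun_continuous (R : realType) n (M : closedManifold R n) (f : M -> R) :
  smooth_fun f -> continuous f.
Proof.
move=> fs p; have [i ip] := atlas_cover p.
apply: (@continuous_near_eq _ _ f (fun q => f (cinv (atlas M i) (cmap (atlas M i) q)))).
  have N : nbhs p (cdom (atlas M i)) by apply: open_nbhs_nbhs; split => //; exact: cdom_open.
  by apply: filterS N => q iq; rewrite cmapK.
apply: (@continuous_comp _ _ _ (cmap (atlas M i)) (f \o cinv (atlas M i))).
  exact: cmap_continuous.
by apply: (Ck_cont (fs i 0%N)); exact: cimg_cmap.
Qed.

Section Torus2.
Context {R : realType}.
Local Notation T := (torusM R 2).
Implicit Types (f : T -> R) (p q : T) (z : 'rV[R]_2) (v w : tvec T).
Local Notation i0 := (ord0 : 'I_2).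
Local Notation i1 := (ord_max : 'I_2).

Lemma ord2E (i : 'I_2) : i = i0 \/ i = i1.
Proof. by case: i => [[|[|//]] Hi]; [left|right]; exact: val_inj. Qed.

Lemma rV2_eq z z' : z 0 i0 = z' 0 i0 -> z 0 i1 = z' 0 i1 -> z = z'.
Proof. by move=> e0 e1; apply/rowP => i; case: (ord2E i) => ->. Qed.

(** The coordinate 1-forms: the sine of q_i - p_i is a local coordinate at p. *)
Definition dx (i : 'I_2) p v : R := v (tsn i p).

Lemma dx_tdir i j p : dx i p (tdir j p) = (i == j)%:R.
Proof.
rewrite /dx; have [a <-] := tpi_surj p; rewrite tdirE; last exact: tsn_smooth.
rewrite /partial (@derive_eq_line _ _ (R^o : normedModType R) _ (fun s : R => sin ((i == j)%:R * s)) _ _ 0 1); last first.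
  move=> h; rewrite /= tsn_tpi !mxE eqxx /= addrK addr0.
  by rewrite /GRing.scale /= mulr1 mulrC.
set c : R := _%:R; clearbody c.
have d1 : is_derive (0 : R) (1 : R) (fun s : R => c * s : R^o) (c * 1 + 0 * 0).
  exact: (@is_derive_mulp _ _ (fun=> c) (fun s : R => s : R)).
have := @is_derive1_comp R sin (fun s : R => c * s) 0 _ _ (is_derive_sin _) d1.
by rewrite mulr0 cos0 mul0r addr0 mulr1 mul1r => -[_ ->].
Qed.

Lemma dx_lin i p (a : R) v w : dx i p (fun f => a * v f + w f) = a * dx i p v + dx i p w.
Proof. by []. Qed.

(** Apply the product rule to 1 * 1. *)
Lemma tangent_cst p v (a : R) : tangent p v -> v (fun=> a) = 0.
Proof.
move=> [vl vm _]; have s1 (c : R) : smooth_fun (fun _ : T => c) by exact: smooth_fun_cst.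
have e1 : v (fun=> 1) = 0.
  have := vm _ _ (s1 1) (s1 1); rewrite !mul1r.
  have -> : (fun _ : T => 1 : R) = fun=> 1 * 1 by rewrite mulr1.
  by rewrite mulr1; lra.
have := vl (a - 1) _ _ (s1 1) (s1 1).
by rewrite e1 mulr0 addr0 mulr1 subrK.
Qed.

(** Fix one angle, then the other: what remains is a constant. *)
Lemma tangent_expand p v : tangent p v ->
  v = fun f => dx i0 p v * tdir i0 p f + dx i1 p v * tdir i1 p f.
Proof.
move=> pv; apply/funext => f; have [fs|fs] := pselect (smooth_fun f); last first.
  by have [_ _ v0] := pv; rewrite v0// /tdir !smooth_partN// !mulr0 addr0.
move: pv; have [a <-] := tpi_surj p => pv.
rewrite !tdirE// (tangent_trepl i0 fs pv).
have rs := trepl_smooth i0 (a 0 i0) fs.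
rewrite (tangent_trepl i1 rs pv).
have -> : trepl i1 (a 0 i1) (trepl i0 (a 0 i0) f) = fun=> f (tpi a).
  apply/funext => q; have [z <-] := tpi_surj q; rewrite !trepl_tpi; congr (f (tpi _)).
  by apply: rV2_eq; rewrite !replE.
rewrite (tangent_cst _ pv) add0r addrC; congr (_ + _ * _).
apply: derive_eq_line => h; rewrite /= trepl_tpi; congr (f (tpi _)).
by apply: rV2_eq; rewrite !replE !mxE ?eqxx/= ?mulr0 ?add0r.
Qed.

(** The area form dx /\ dy and the flat metric; their coefficients are constant. *)
Definition om2 : tensor2 T := fun p v w => dx i0 p v * dx i1 p w - dx i1 p v * dx i0 p w.
Definition g2 : tensor2 T := fun p v w => dx i0 p v * dx i0 p w + dx i1 p v * dx i1 p w.

Lemma om2_tdir1 p v : om2 p v (tdir i1 p) = dx i0 p v.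
Proof.
rewrite /om2 !dx_tdir; have -> : (i0 == i1) = false by [].
by rewrite eqxx mulr1 mulr0 subr0.
Qed.

Lemma om2_tdir0 p v : om2 p v (tdir i0 p) = - dx i1 p v.
Proof.
rewrite /om2 !dx_tdir; have -> : (i1 == i0) = false by [].
by rewrite eqxx mulr1 mulr0 sub0r.
Qed.

Lemma coef_om2 i j k y : coef2 om2 i j k y =
  (i0 == j)%:R * (i1 == k)%:R - (i1 == j)%:R * (i0 == k)%:R.
Proof. by rewrite /coef2 !coordvec_torus /om2 !dx_tdir. Qed.

Lemma coef_g2 i j k y : coef2 g2 i j k y =
  (i0 == j)%:R * (i0 == k)%:R + (i1 == j)%:R * (i1 == k)%:R.
Proof. by rewrite /coef2 !coordvec_torus /g2 !dx_tdir. Qed.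

Lemma tangent_eq0 p v : tangent p v -> dx i0 p v = 0 -> dx i1 p v = 0 -> v = fun=> 0.
Proof.
move=> pv e0 e1; rewrite (tangent_expand pv); apply/funext => f.
by rewrite e0 e1 !mul0r addr0.
Qed.

Lemma partial_cst (c : R) (F : 'rV[R]_2 -> R) (j : 'I_2) y : (forall y, F y = c) -> partial j F y = 0.
Proof.
move=> Fc; have -> : F = fun=> c by apply/funext.
by rewrite /partial derive_cst.
Qed.

Lemma symplectic_om2 : symplectic_form om2.
Proof.
split.
- split.
  + by move=> p a u v w _ _ _; rewrite /om2 !dx_lin; ring.
  + by move=> p a u v w _ _ _; rewrite /om2 !dx_lin; ring.
  + move=> i j k m; apply: (Ck_ext (g := fun=> coef2 om2 i j k 0)).
    * exact: (@cimg_open _ _ T i).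
    * by move=> x _; rewrite !coef_om2.
    * exact: Ck_cst.
- by move=> p v _; rewrite /om2; ring.
- move=> p v pv H; apply: (tangent_eq0 pv).
    by have := H _ (tdir_tangent i1 p); rewrite om2_tdir1.
  have := H _ (tdir_tangent i0 p); rewrite om2_tdir0 => /eqP.
  by rewrite oppr_eq0 => /eqP.
- move=> i j k l y _; by rewrite !(partial_cst _ _ (coef_om2 _ _ _)) !addr0.
Qed.

Lemma riemannian_g2 : riemannian_metric g2.
Proof.
split.
- split.
  + by move=> p a u v w _ _ _; rewrite /g2 !dx_lin; ring.
  + by move=> p a u v w _ _ _; rewrite /g2 !dx_lin; ring.
  + move=> i j k m; apply: (Ck_ext (g := fun=> coef2 g2 i j k 0)).
    * exact: (@cimg_open _ _ T i).
    * by move=> x _; rewrite !coef_g2.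
    * exact: Ck_cst.
- by move=> p v w _ _; rewrite /g2; ring.
- move=> p v pv v0; rewrite lt_neqAle addr_ge0 -?expr2 ?sqr_ge0// andbT eq_sym.
  apply: contra_notN v0; rewrite paddr_eq0 -?expr2 ?sqr_ge0// !sqrf_eq0 => /andP[/eqP e0 /eqP e1].
  exact: tangent_eq0 e0 e1.
Qed.

End Torus2.

(** * The oscillation norm on exact forms of the 2-torus *)

Section Oscillation.
Context {R : realType} {T : Type}.
Implicit Types F G : T -> R.

Definition osc F : R := sup [set x | exists p q, x = F p - F q].

Lemma osc_ge F (c : R) p q : (forall p, `|F p| <= c) -> F p - F q <= osc F.
Proof.
move=> Fc; apply: ub_le_sup; last by exists p, q.
exists (c + c) => _ [a [b ->]]; have := Fc a; have := Fc b; rewrite !ler_norml.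
by move=> /andP[? ?] /andP[? ?]; lra.
Qed.

Lemma osc_le F (c : R) (p0 : T) : (forall p q, F p - F q <= c) -> osc F <= c.
Proof.
move=> Fc; apply: ge_sup; first by exists (F p0 - F p0), p0, p0.
by move=> _ [p [q ->]].
Qed.

Lemma osc_ext F G : (forall p q, F p - F q = G p - G q) -> osc F = osc G.
Proof. by move=> FG; rewrite /osc; congr sup; apply/seteqP; split => _ [p [q ->]]; exists p, q. Qed.

End Oscillation.

Section Torus2Norm.
Context {R : realType}.
Local Notation T := (torusM R 2).
Implicit Types (F G : T -> R) (p q : T) (z : 'rV[R]_2) (v w : tvec T).
Local Notation i0 := (ord0 : 'I_2).
Local Notation i1 := (ord_max : 'I_2).

Lemma smooth_fun_bounded F : smooth_fun F -> exists c, forall p, `|F p| <= c.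
Proof.
move=> Fs; have : compact (F @` [set: T]).
  apply: continuous_compact; last exact: torus_compact.
  by apply: continuous_subspaceT; exact: smooth_fun_continuous.
move=> /compact_bounded[c [_ cF]]; exists (c + 1) => p.
by apply: (cF (c + 1)); [lra|exists p].
Qed.

Lemma tdir_dfun F G i p : smooth_fun F -> smooth_fun G -> dfun F = dfun G ->
  tdir i p F = tdir i p G.
Proof.
move=> Fs Gs /(congr1 (fun al => al p (tdir i p))).
by rewrite /dfun !tangent_partE//; exact: tdir_tangent.
Qed.

(** The torus is connected: two of its points are joined by segments parallel to the
axes, along which F - G is constant. *)
Lemma dfun_eq F G p q : smooth_fun F -> smooth_fun G -> dfun F = dfun G ->
  F p - F q = G p - G q.
Proof.
move=> Fs Gs FG; pose H p := (-1) * G p + F p.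
have Hs : smooth_fun H by exact: smooth_fun_lin.
have [HT _] := smooth_fun_torus H; have {}HT := HT Hs.
have H0 i z : partial i (H \o @tpi R 2) z = 0.
  rewrite -tdirE//; have [tl _ _] := tdir_tangent i (tpi z : T).
  by rewrite tl// (tdir_dfun _ _ Fs Gs FG) mulN1r addNr.
have Hr i a z : H (tpi (repl i a z)) = H (tpi z).
  have [s _ e] := @MVT_line R _ setT (H \o @tpi R 2) (delta_mx 0 i) z (a - z 0 i) (HT 1%N) (fun _ _ => I).
  apply/eqP; rewrite -subr_eq0; apply/eqP; rewrite [LHS]e.
  by move: (H0 i (s *: delta_mx 0 i + z)); rewrite /partial => ->; rewrite mulr0.
have [z <-] := tpi_surj p; have [z' <-] := tpi_surj q.
have e : H (tpi z) = H (tpi z').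
  rewrite -(Hr i0 (z' 0 i0) z) -(Hr i1 (z' 0 i1)); congr (H (tpi _)).
  by apply: rV2_eq; rewrite !replE.
by move: e; rewrite /H; lra.
Qed.

(** A potential of an exact form, chosen arbitrarily: its oscillation does not depend
on the choice by [dfun_eq]. *)
Definition prim (be : form1 T) : T -> R := xget (fun=> 0) [set F | smooth_fun F /\ be = dfun F].

Definition nB2 (be : form1 T) : R := osc (prim be).

Lemma primP F : smooth_fun F -> smooth_fun (prim (dfun F)) /\ dfun F = dfun (prim (dfun F)).
Proof. by move=> Fs; rewrite /prim; case: xgetP => [G _ //|/(_ F)]; case. Qed.

Lemma nB2E F : smooth_fun F -> nB2 (dfun F) = osc F.
Proof.
move=> Fs; have [ps pE] := primP Fs.
by apply: osc_ext => p q; apply: dfun_eq.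
Qed.

Lemma dfun_lin (a : R) F G : smooth_fun F -> smooth_fun G ->
  dfun (fun p => a * F p + G p) = fun p v => a * dfun F p v + dfun G p v.
Proof.
move=> Fs Gs; apply/funext => p; apply/funext => v; rewrite /dfun.
have [pv|pv] := pselect (tangent p v); last by rewrite !tangent_partN// mulr0 addr0.
by rewrite !tangent_partE//; have [-> ] := pv.
Qed.

Lemma dfun_cst (a : R) : dfun (fun _ : T => a) = fun _ _ => 0.
Proof.
apply/funext => p; apply/funext => v; rewrite /dfun.
have [pv|pv] := pselect (tangent p v); last by rewrite !tangent_partN.
by rewrite tangent_partE// (tangent_cst a pv).
Qed.

Lemma osc_scale_le (l : R) F : smooth_fun F -> osc (fun p => l * F p) <= `|l| * osc F.
Proof.
move=> Fs; have [c Fc] := smooth_fun_bounded Fs.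
apply: (osc_le (tpi 0)) => p q; rewrite -mulrBr.
have o1 := osc_ge p q Fc; have o2 := osc_ge q p Fc.
by case: (ger0P l) => l0; nra.
Qed.

Lemma norm_nB2 : norm_on (exact_forms T) nB2.
Proof.
have ge0 F : smooth_fun F -> 0 <= osc F.
  by move=> Fs; have [c Fc] := smooth_fun_bounded Fs; rewrite -(subrr (F (tpi 0))) (osc_ge _ _ Fc).
have sc (l : R) F : smooth_fun F -> smooth_fun (fun p => l * F p).
  by move=> Fs; have := smooth_fun_lin l Fs (smooth_fun_cst 0); congr smooth_fun; apply/funext => p; rewrite addr0.
have dsc (l : R) F : smooth_fun F -> dfun (fun p => l * F p) = fun p v => l * dfun F p v.
  move=> Fs; have := dfun_lin l Fs (smooth_fun_cst 0); rewrite dfun_cst.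
  under eq_fun do rewrite addr0; move=> ->; apply/funext => p; apply/funext => v.
  by rewrite addr0.
split.
- by move=> _ [F Fs ->]; rewrite nB2E// ge0.
- move=> _ [F Fs ->]; rewrite nB2E// => o0; have [c Fc] := smooth_fun_bounded Fs.
  have -> : F = fun=> F (tpi 0); last exact: dfun_cst.
  apply/funext => p; apply/eqP; rewrite eq_le -[F p <= _]subr_le0 -[_ <= F p]subr_le0.
  by rewrite -[X in _ <= X]o0 -[X in _ && (_ <= X)]o0 !(osc_ge _ _ Fc).
- move=> l _ [F Fs ->]; rewrite -dsc// !nB2E//; last exact: sc.
  apply/eqP; rewrite eq_le osc_scale_le//=.
  have [->|l0] := eqVneq l 0; first by rewrite normr0 mul0r ge0//; exact: sc.
  have := osc_scale_le l^-1 (sc l F Fs).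
  have -> : (fun p => l^-1 * (l * F p)) = F by apply/funext => p; rewrite mulKf.
  by rewrite normfV mulrC ler_pdivlMr ?normr_gt0// mulrC.
- move=> _ _ [F Fs ->] [G Gs ->].
  have -> : (fun p v => dfun F p v + dfun G p v) = dfun (fun p => 1 * F p + G p).
    by rewrite dfun_lin//; apply/funext => p; apply/funext => v; rewrite mul1r.
  rewrite !nB2E//; last exact: smooth_fun_lin.
  have [c Fc] := smooth_fun_bounded Fs; have [d Gd] := smooth_fun_bounded Gs.
  apply: (osc_le (tpi 0)) => p q; rewrite !mul1r.
  by have := osc_ge p q Fc; have := osc_ge p q Gd; lra.
Qed.

(** For alpha = i_X omega this is the differential of the x-component of X. *)
Definition mu2 (al : form1 T) : form1 T := dfun (fun p => al p (tdir i1 p)).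

Lemma contraction_smooth (al : form1 T) : is_form1 al -> smooth_fun (fun p => al p (tdir i1 p)).
Proof.
move=> [_ _ als] i k; have := als i i1 k; congr Ck; apply/funext => y.
by rewrite /coef1 coordvec_torus.
Qed.

Lemma closed_to_exact_mu2 : closed_to_exact mu2.
Proof.
split; first by move=> al [fal _]; exists (fun p => al p (tdir i1 p)) => //; exact: contraction_smooth.
move=> l a b [fa _] [fb _]; rewrite /mu2 dfun_lin//; exact: contraction_smooth.
Qed.

Lemma nmu2E (al : form1 T) : is_form1 al -> nmu g2 nB2 mu2 0 al = osc (fun p => al p (tdir i1 p)).
Proof. by move=> fal; rewrite /nmu mul0r addr0 nB2E//; exact: contraction_smooth. Qed.

End Torus2Norm.

(** * Shears of the 2-torus *)

Section Shears.
Context {R : realType}.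
Local Notation T := (torusM R 2).
Local Notation RV := (R^o * 'rV[R]_2)%type.
Local Notation i0 := (ord0 : 'I_2).
Local Notation i1 := (ord_max : 'I_2).
Implicit Types (p q : T) (z : 'rV[R]_2) (v w : tvec T).

Variables (u : R -> R) (c : R).
Hypotheses (us : smooth_on (E := R^o) setT u)
  (up : forall x y, cos x = cos y -> sin x = sin y -> u x = u y)
  (uc : forall x t, u (x + t * c) = u x).

Definition kvec z : 'rV[R]_2 := \row_i (if i == i0 then u (z 0 i1) else c).

(** The flow of u(y) d/dx + c d/dy; [uc] makes [u] constant along it. *)
Definition shear (t : R) p : T := tpi (lift p + t *: kvec (lift p)).

Lemma kvec_tpi z z' : tpi z = tpi z' -> kvec z = kvec z'.
Proof.
move=> e; apply/rowP => i; rewrite !mxE; case: eqP => // _; apply: up.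
  by rewrite -!cs_tpi e.
by rewrite -!sn_tpi e.
Qed.

(** Through the covering the shear is given by a formula; all its properties are
read off from it. *)
Lemma shear_tpi t z : shear t (tpi z) = tpi (z + t *: kvec z).
Proof.
by rewrite /shear (kvec_tpi (liftK (tpi z))) (tpiD _ (liftK (tpi z))).
Qed.

Lemma kvec_flow t z : kvec (z + t *: kvec z) = kvec z.
Proof.
apply/rowP => i; rewrite !mxE; case: eqP => // _; exact: uc.
Qed.

Lemma shearD s t p : shear s (shear t p) = shear (s + t) p.
Proof.
have [z <-] := tpi_surj p; rewrite !shear_tpi kvec_flow; congr tpi.
by rewrite -addrA -scalerDl [t + s]addrC.
Qed.

Lemma shear0 : shear 0 = id.
Proof. by apply/funext => p; rewrite /shear scale0r addr0 liftK. Qed.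

Lemma shearK t : cancel (shear t) (shear (- t)).
Proof. by move=> p; rewrite shearD addNr shear0. Qed.

Lemma shearKV t : cancel (shear (- t)) (shear t).
Proof. by move=> p; rewrite shearD subrr shear0. Qed.

Lemma shear_bij t : bijective (shear t).
Proof. exists (shear (- t)); [exact: shearK|exact: shearKV]. Qed.

Lemma minv_shear t : minv (shear t) = shear (- t).
Proof. apply: minv_eq; [exact: shearK|exact: shearKV]. Qed.

Lemma shear_smooth_family I : open I -> smooth_family I shear.
Proof.
move=> oI; apply: (@smooth_family_torus _ _ I shear (fun x : RV => x.2 + x.1 *: kvec x.2) oI).
  by move=> t z _; exact: shear_tpi.
move=> k i; have oU : open [set x : RV | I x.1] by exact: open_fst.
have -> : (fun x : RV => (x.2 + x.1 *: kvec x.2) 0 i) =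
    (fun x : RV => x.2 0 i + x.1 * (if i == i0 then u (x.2 0 i1) else c)).
  by apply/funext => x; rewrite !mxE.
apply: (Ck_add oU); first exact: Ck_snd.
apply: (Ck_mul oU); first exact: Ck_fst.
case: eqP => _; last exact: Ck_cst.
apply: (Ck_comp1 (K := setT) oU); [exact: openT|by []|exact: Ck_snd|exact: us].
Qed.

Lemma shear_smooth t : smooth_map (shear t).
Proof. apply: (smooth_family_map openT I); exact: shear_smooth_family openT. Qed.

Lemma Ck1_derivable_u y : derivable (u : R -> R^o) y 1.
Proof. exact: (@Ck_derivable R (R^o : normedModType R) 0 setT u y 1 (us 1%N) I). Qed.

(** One entry of the Jacobian matrix of the shear in the coordinate vector fields. *)
Lemma tdir_shear t z i j (a : R -> R) (a' : R) :
  (forall s, (s *: delta_mx 0 j + z + t *: kvec (s *: delta_mx 0 j + z)) 0 i -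
             (z + t *: kvec z) 0 i = a s) ->
  is_derive (0 : R) (1 : R) (a : R -> R^o) a' ->
  tdir j (tpi z : T) (tsn i (shear t (tpi z)) \o shear t) = a'.
Proof.
move=> aE da; have a0 : a 0 = 0 by rewrite -aE scale0r add0r subrr.
rewrite tdirE; last by apply: smooth_fun_comp; [exact: shear_smooth|exact: tsn_smooth].
rewrite /partial (@derive_eq_line _ _ (R^o : normedModType R) _ (fun s : R => sin (a s)) _ _ 0 1).
  have := @is_derive1_comp R sin a 0 _ _ (is_derive_sin _) da.
  by rewrite a0 cos0 mul1r => -[_ ->].
by move=> h; rewrite /= !shear_tpi tsn_tpi aE /GRing.scale /= mulr1 addr0.
Qed.

(** The Jacobian matrix is unipotent, so that dx /\ dy is preserved. *)
Lemma dx_tmap_shear t p : exists b : R, forall v, tangent p v ->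
  dx i0 (shear t p) (tmap (shear t) v) = dx i0 p v + b * dx i1 p v /\
  dx i1 (shear t p) (tmap (shear t) v) = dx i1 p v.
Proof.
have [z <-] := tpi_surj p; exists (t * derive1 (u : R -> R^o) (z 0 i1)) => v pv.
have did : is_derive (0 : R) (1 : R) (fun s : R => s : R^o) 1 by exact: is_derive_id.
have d0 (x : R) : is_derive (0 : R) (1 : R) (fun=> x : R^o) 0 by exact: is_derive_cst.
have e01 : (i0 == i1) = false by [].
have e10 : (i1 == i0) = false by [].
have ex i : dx i (shear t (tpi z)) (tmap (shear t) v) =
    dx i0 (tpi z) v * tdir i0 (tpi z : T) (tsn i (shear t (tpi z)) \o shear t) +
    dx i1 (tpi z) v * tdir i1 (tpi z : T) (tsn i (shear t (tpi z)) \o shear t).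
  rewrite {1}/dx /tmap smooth_partE; last exact: tsn_smooth.
  by rewrite {1}(tangent_expand pv).
have dw : is_derive (0 : R) (1 : R) (fun s : R => t * (u (s + z 0 i1) - u (z 0 i1)) : R^o)
    (t * derive1 (u : R -> R^o) (z 0 i1)).
  have ds : is_derive (0 : R) (1 : R) (fun s : R => s + z 0 i1 : R^o) (1 + 0).
    exact: is_derive_addp did (d0 _).
  have du : is_derive (0 + z 0 i1 : R) (1 : R) (u : R -> R^o) (derive1 (u : R -> R^o) (z 0 i1)).
    by rewrite add0r derive1E; apply: DeriveDef => //; exact: Ck1_derivable_u.
  have d1 := @is_derive1_comp R u (fun s : R => s + z 0 i1) 0 _ _ du ds.
  have d2 := is_derive_mulp (d0 t) (is_derive_addp d1 (d0 (- u (z 0 i1)))).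
  by move: d2; rewrite !addr0 mulr1 mulr0 addr0.
rewrite !ex; split.
- rewrite (@tdir_shear t z i0 i0 (fun s => s) 1)//; last first.
    by move=> s; rewrite !mxE eqxx e10/= mulr1 mulr0 add0r; ring.
  rewrite (@tdir_shear t z i0 i1 _ _ _ dw).
  + by rewrite mulr1 mulrC [in X in _ + X]mulrC.
  + by move=> s; rewrite !mxE !eqxx e01/= mulr1 mulr0 add0r; ring.
- rewrite (@tdir_shear t z i1 i0 (fun=> 0) 0)//; last first.
    by move=> s; rewrite !mxE eqxx e10/= mulr0 add0r; ring.
  rewrite (@tdir_shear t z i1 i1 (fun s => s) 1)//; first by rewrite mulr0 add0r mulr1.
  by move=> s; rewrite !mxE !eqxx e10/= mulr1; ring.
Qed.

Lemma shear_symplectic t : symplectomorphism om2 (shear t).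
Proof.
split; [exact: shear_bij|exact: shear_smooth|by rewrite minv_shear; exact: shear_smooth|].
move=> p v w pv pw; have [b E] := dx_tmap_shear t p.
have [v0 v1] := E v pv; have [w0 w1] := E w pw.
by rewrite /om2 v0 v1 w0 w1; ring.
Qed.

Lemma shear_path : symp_path om2 shear.
Proof.
split; [exact: shear0|by move=> t _; exact: shear_symplectic|].
by exists 1 => //; apply: shear_smooth_family; exact: interval_open.
Qed.

Lemma shear_Symp0 : Symp0 om2 (shear 1).
Proof. by exists shear => //; exact: shear_path. Qed.

End Shears.

(** * Lengths of paths on the 2-torus *)

Section Curves.
Context {R : realType} {n : nat} {M : closedManifold R n}.
Local Notation RV := (R^o * 'rV[R]_n)%type.
Variables (I : set R) (psi : R -> M -> M) (f : M -> R).
Hypotheses (oI : open I) (psis : smooth_family I psi) (fs : smooth_fun f).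

Lemma curve_Ck k q : Ck k (I : set R^o) (fun t : R^o => f (psi t q)).
Proof.
have [i iq] := atlas_cover q.
have := Ck_slice_fst (cmap (atlas M i) q) (@open_box _ _ M I i oI) (@family_Ck _ _ M I psi f i k oI psis fs).
rewrite /= cmapK//; apply: Ck_sub => t It; split => //; exact: cimg_cmap.
Qed.

Definition dcurve t q : R := derive1 (fun s : R => f (psi s q) : R^o) t.

Lemma is_derive_curve t q : I t ->
  is_derive t (1 : R) (fun s : R => f (psi s q) : R^o) (dcurve t q).
Proof.
move=> It; rewrite /dcurve derive1E; apply: DeriveDef => //.
exact: derive_curve oI It psis fs.
Qed.

(** In a chart this is a partial derivative of a smooth function of (t, y). *)
Lemma dcurve_continuous t q : I t ->
  {for (t, q), continuous (fun tq : R * M => dcurve tq.1 tq.2)}.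
Proof.
move=> It; have [i iq] := atlas_cover q.
pose F (ty : RV) := f (psi ty.1 (cinv (atlas M i) ty.2)).
pose D := 'D_((1, 0) : RV) (F : RV -> R^o).
have Fs : Ck 0 [set ty : RV | I ty.1 /\ cimg (atlas M i) ty.2] D.
  exact: Ck_D (@family_Ck _ _ M I psi f i 1 oI psis fs).
apply: (@continuous_near_eq _ _ _ (fun tq : R * M => D (tq.1, cmap (atlas M i) tq.2))).
  have N : nbhs q (cdom (atlas M i)) by apply: open_nbhs_nbhs; split => //; exact: cdom_open.
  exists (setT, cdom (atlas M i)); first by split => //; exact: filterT.
  move=> [t' q'] [/= _ iq']; rewrite /D derive_fst /dcurve derive1E /F /=.
  by rewrite cmapK.
apply: (@continuous_comp _ _ _ (fun tq : R * M => (tq.1, cmap (atlas M i) tq.2) : RV) D).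
  apply: continuous_pair; first exact: cvg_fst.
  by apply: continuous_snd_comp; exact: cmap_continuous.
by apply: (Ck_cont Fs); split => //; exact: cimg_cmap.
Qed.

Lemma dcurve_bounded (a b : R) : (`[a, b]%classic `<=` I) ->
  exists c, forall t q, a <= t <= b -> `|dcurve t q| <= c.
Proof.
move=> abI; have : compact ((fun tq : R * M => dcurve tq.1 tq.2) @` (`[a, b]%classic `*` setT)).
  apply: continuous_compact; last first.
    by apply: compact_setX; [exact: segment_compact|exact: carrier_compact].
  apply: continuous_in_subspaceT => -[t q] /set_mem [/= tab _].
  by apply: dcurve_continuous; exact: abI.
move=> /compact_bounded[c [_ cF]]; exists (c + 1) => t q tab.
apply: (cF (c + 1)); first by lra.
by exists (t, q) => //; split => //=; rewrite in_itv.
Qed.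

End Curves.

Section TorusLength.
Context {R : realType}.
Local Notation T := (torusM R 2).
Local Notation i0 := (ord0 : 'I_2).
Local Notation i1 := (ord_max : 'I_2).
Local Notation leb := (@lebesgue_measure R).
Implicit Types (psi : R -> T -> T) (p q : T).

Local Notation A psi := (dcurve psi (fun p : T => cs p i0)).
Local Notation B psi := (dcurve psi (fun p : T => sn p i0)).

(** The speed of the angle x along the curve t |-> psi t q. *)
Definition xspeed psi (t : R) q : R :=
  B psi t q * cs (psi t q) i0 - A psi t q * sn (psi t q) i0.

Section Path.
Variable psi : R -> T -> T.
Hypothesis hp : symp_path om2 psi.

Lemma path_interval : exists2 e : R, 0 < e & smooth_family `]- e, 1 + e[ psi.
Proof. by case: hp. Qed.

(** Contracting i_X omega with d/dy gives the x-component of X; at psi_t(q) it is the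
speed of the angle x along the curve of q.  Since psi_t is bijective, taking the
oscillation over q or over psi_t(q) makes no difference. *)
Lemma nmu_xspeed t : 0 < t < 1 ->
  nmu g2 nB2 mu2 0 (path_form om2 psi t) = osc (xspeed psi t).
Proof.
move=> t01; have [fal _] := path_form_closed symplectic_om2 hp t01.
rewrite (nmu2E fal).
have [e e0 ps] := path_interval; have [_ py _] := hp.
have /andP[t0 t1] := t01.
have It : `]- e, 1 + e[%classic t by rewrite /= in_itv/=; apply/andP; split; lra.
have oI : open (`]- e, 1 + e[%classic : set R) by exact: interval_open.
have [pb _ _ _] := py t ltac:(by rewrite !ltW).
have E q : path_form om2 psi t (psi t q) (tdir i1 (psi t q)) = xspeed psi t q.
  rewrite /path_form tangent_partE; last exact: tdir_tangent.
  rewrite om2_tdir1.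
  rewrite /dx /velocity smooth_partE; last exact: tsn_smooth.
  rewrite minvK// derive1E.
  have dA := is_derive_curve oI ps (cs_smooth i0) q It.
  have dB := is_derive_curve oI ps (sn_smooth i0) q It.
  have dc (c : R) : is_derive t (1 : R) (fun=> c : R^o) 0 by exact: is_derive_cst.
  have := is_derive_addp (is_derive_mulp dB (dc (cs (psi t q) i0)))
    (is_derive_oppp (is_derive_mulp dA (dc (sn (psi t q) i0)))).
  move=> [_ ->]; rewrite /xspeed !mulr0 !add0r; ring.
rewrite /osc; congr sup; apply/seteqP; split => _ [p [q ->]].
  by exists (minv (psi t) p), (minv (psi t) q); rewrite -!E !minvKV.
by exists (psi t p), (psi t q); rewrite !E.
Qed.

Lemma xspeed_bounded : exists c, forall t q, 0 <= t <= 1 -> `|xspeed psi t q| <= c.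
Proof.
have [e e0 ps] := path_interval.
have oI : open (`]- e, 1 + e[%classic : set R) by exact: interval_open.
have sI : `[0, 1]%classic `<=` (`]- e, 1 + e[%classic : set R).
  by move=> t /=; rewrite !in_itv/= => /andP[? ?]; apply/andP; split; lra.
have [a Aa] := dcurve_bounded oI ps (cs_smooth i0) sI.
have [b Bb] := dcurve_bounded oI ps (sn_smooth i0) sI.
exists (b + a) => t q t01; rewrite /xspeed.
have bnd (x y c s : R) : `|x| <= y -> c ^+ 2 + s ^+ 2 = 1 -> `|x * c| <= y /\ `|x * s| <= y.
  move=> xy cs1; have y0 : 0 <= y by exact: le_trans xy.
  have c1 : `|c| <= 1 by rewrite ler_norml; apply/andP; split; nra.
  have s1 : `|s| <= 1 by rewrite ler_norml; apply/andP; split; nra.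
  by rewrite !normrM; split; rewrite -[leRHS]mulr1 ler_pM.
have [b1 _] := bnd _ _ _ _ (Bb t q t01) (cs2sn2 (psi t q) i0).
have [_ a1] := bnd _ _ _ _ (Aa t q t01) (cs2sn2 (psi t q) i0).
by apply: le_trans (ler_normB _ _) _; exact: lerD.
Qed.

End Path.
End TorusLength.

Section TorusLength2.
Context {R : realType}.
Local Notation T := (torusM R 2).
Local Notation i0 := (ord0 : 'I_2).
Local Notation i1 := (ord_max : 'I_2).
Local Notation leb := (@lebesgue_measure R).
Implicit Types (p q : T).

Variable psi : R -> T -> T.
Hypothesis hp : symp_path om2 psi.

Let N t : R := nmu g2 nB2 mu2 0 (path_form om2 psi t).

Lemma xspeed_le_osc t p q : 0 <= t <= 1 -> xspeed psi t p - xspeed psi t q <= osc (xspeed psi t).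
Proof.
by move=> t01; have [c xc] := xspeed_bounded hp; apply: (@osc_ge _ _ _ c) => r; exact: xc.
Qed.

Lemma xspeed_continuous q t : 0 < t < 1 -> {for t, continuous (fun t => xspeed psi t q)}.
Proof.
move=> /andP[t0 t1]; have [e e0 ps] := path_interval hp.
have oI : open (`]- e, 1 + e[%classic : set R) by exact: interval_open.
have It : `]- e, 1 + e[%classic t by rewrite /= in_itv/=; apply/andP; split; lra.
have jc (h : R * T -> R) : {for (t, q), continuous h} -> {for t, continuous (fun t => h (t, q))}.
  move=> hc; apply: (@continuous_comp _ _ _ (fun t : R => (t, q)) h) => //.
  exact: pair_fst_continuous.
have cc (f : T -> R) : smooth_fun f -> {for t, continuous (fun t => f (psi t q))}.
  by move=> fs; exact: is_derive_continuous (is_derive_curve oI ps fs q It).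
apply: cvgB; apply: cvgM.
- exact: (jc _ (dcurve_continuous oI ps (sn_smooth i0) It)).
- exact: (cc _ (cs_smooth i0)).
- exact: (jc _ (dcurve_continuous oI ps (cs_smooth i0) It)).
- exact: (cc _ (sn_smooth i0)).
Qed.

Lemma osc_gt_nbhs (a t : R) : 0 < t < 1 -> a < osc (xspeed psi t) ->
  \forall s \near t, 0 < s < 1 -> a < osc (xspeed psi s).
Proof.
move=> t01 at_.
have [p [q pq]] : exists p q, a < xspeed psi t p - xspeed psi t q.
  apply: contrapT => H; move: at_; rewrite ltNge => /negP; apply.
  apply: (osc_le (tpi 0)) => p q; rewrite leNgt; apply/negP => apq.
  by apply: H; exists p, q.
have dc : {for t, continuous (fun s => xspeed psi s p - xspeed psi s q)}.
  have cp := xspeed_continuous (q := p) t01; have cq := xspeed_continuous (q := q) t01.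
  by apply: cvgB; [exact: cp|exact: cq].
have H : \forall s \near t, a < xspeed psi s p - xspeed psi s q.
  exact: (cvgr_gt _ dc _ pq).
apply: (nbhs_sub H) => s apq /andP[s0 s1].
by apply: lt_le_trans apq _; apply: xspeed_le_osc; rewrite !ltW.
Qed.

Let Ns t : \bar R := if 0 < t < 1 then (osc (xspeed psi t))%:E else 0%E.

Lemma osc_xspeed_ge0 t : 0 <= t <= 1 -> 0 <= osc (xspeed psi t).
Proof. by move=> t01; rewrite -(subrr (xspeed psi t (tpi 0))); exact: xspeed_le_osc. Qed.

(** The length element is lower semicontinuous, being the supremum over pairs of
points of functions continuous in time. *)
Lemma speed_measurable : measurable_fun (setT : set R) Ns.
Proof.
apply: lower_semicontinuous_measurable => t a; rewrite /Ns.
have [a0 _|a0] := ltP a 0.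
  exists setT; first exact: filterT.
  move=> s _; case: ifP => [/andP[s0 s1]|_]; last by rewrite lte_fin.
  by rewrite lte_fin (lt_le_trans a0)// osc_xspeed_ge0// !ltW.
case: ifP => [t01|_]; rewrite lte_fin => at_; last by move: at_; rewrite ltNge a0.
exists [set s | 0 < s < 1 /\ a < osc (xspeed psi s)].
  have N1 : \forall s \near t, 0 < s < 1.
    have : nbhs t (`]0, 1[%classic : set R).
      by apply: open_nbhs_nbhs; split; [exact: interval_open|rewrite /= in_itv].
    by apply: filterS => s; rewrite /= in_itv.
  by move: N1 (osc_gt_nbhs t01 at_); apply: filterS2 => s s01 /(_ s01).
by move=> s [-> ?]; rewrite lte_fin.
Qed.

Lemma path_length_defined : leb.-integrable `[0, 1] (fun t => (N t)%:E).
Proof.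
have NE t : `]0, 1[%classic t -> (N t)%:E = Ns t.
  by rewrite /= in_itv/= /Ns /N => t01; rewrite t01 nmu_xspeed.
have mo : measurable_fun (`]0, 1[%classic : set R) (fun t => (N t)%:E).
  apply: (eq_measurable_fun Ns); first by move=> t /set_mem /NE.
  exact: measurable_funS speed_measurable.
have mN : measurable_fun (`[0, 1]%classic : set R) (fun t => (N t)%:E).
  exact: emeasurable_fun_itv_cc mo.
apply/integrableP; split => //.
rewrite integral_endpoints.
have [c xc] := xspeed_bounded hp.
apply: (@le_lt_trans _ _ (\int[leb]_(t in `]0%R, 1%R[) (c + c)%:E)%E).
  apply: ge0_le_integral_nonmeasurable => t t01; first exact: abse_ge0.
  rewrite NE//; move: t01; rewrite /= in_itv/= /Ns => t01; rewrite t01 /= lee_fin.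
  have t01' : 0 <= t <= 1 by case/andP: t01 => ? ?; rewrite !ltW.
  rewrite ger0_norm ?osc_xspeed_ge0//; apply: (osc_le (tpi 0)) => p q.
  by apply: le_trans (ler_norm _) _; apply: le_trans (ler_normB _ _) _; exact: lerD (xc _ _ t01') (xc _ _ t01').
rewrite integral_cst//= lebesgue_measure_itv/= lte_fin ltr01 oppr0 adde0 mule1.
exact: ltry.
Qed.

End TorusLength2.

(** * A lower bound for the length *)

Section LowerBound.
Context {R : realType}.
Local Notation T := (torusM R 2).
Local Notation i0 := (ord0 : 'I_2).
Local Notation i1 := (ord_max : 'I_2).
Local Notation leb := (@lebesgue_measure R).
Implicit Types (p q : T).

Definition xcos p q : R := cs p i0 * cs q i0 + sn p i0 * sn q i0.

(** Here a, b are the cosine and the sine of an angle, whose speed is db a - da b; then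
da and db are - b and a times this speed, and similarly for a', b'.  The derivative
of the cosine of the difference of the angles is thus a sine times the difference of
the speeds. *)
Lemma cos_difference_speed (a b a' b' da db da' db' : R) :
  a ^+ 2 + b ^+ 2 = 1 -> a' ^+ 2 + b' ^+ 2 = 1 -> a * da + b * db = 0 -> a' * da' + b' * db' = 0 ->
  `|a * da' + a' * da + (b * db' + b' * db)| <= `|(db * a - da * b) - (db' * a' - da' * b')|.
Proof.
move=> e e' d d'.
have key (x y dx dy : R) : x ^+ 2 + y ^+ 2 = 1 -> x * dx + y * dy = 0 ->
    dx = - y * (dy * x - dx * y) /\ dy = x * (dy * x - dx * y).
  move=> exy dxy; split.
    rewrite (_ : - y * _ = dx * (x ^+ 2 + y ^+ 2) - x * (x * dx + y * dy)); last by ring.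
    by rewrite exy dxy mulr1 mulr0 subr0.
  rewrite (_ : x * (_ - _) = dy * (x ^+ 2 + y ^+ 2) - y * (x * dx + y * dy)); last by ring.
  by rewrite exy dxy mulr1 mulr0 subr0.
have E : a * da' + a' * da + (b * db' + b' * db) =
    (a * b' - a' * b) * ((db * a - da * b) - (db' * a' - da' * b')).
  have [d1 d2] := key _ _ _ _ e d; have [d1' d2'] := key _ _ _ _ e' d'.
  move: (db * a - da * b) (db' * a' - da' * b') d1 d2 d1' d2' => G G' -> -> -> ->.
  by ring.
have s1 : `|a * b' - a' * b| <= 1.
  have : (a * b' - a' * b) ^+ 2 + (a * a' + b * b') ^+ 2 = 1.
    by rewrite -[RHS]mulr1 -{1}e -e'; ring.
  move: (a * b' - a' * b) (a * a' + b * b') => s c h.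
  by rewrite ler_norml; apply/andP; split; nra.
by rewrite E normrM -[leRHS]mul1r ler_wpM2r.
Qed.

Section Path.
Variable psi : R -> T -> T.
Hypothesis hp : symp_path om2 psi.

(** Integrate the derivative of the cosine of the difference of the two angles, which
is bounded by the difference of their speeds, hence by the oscillation. *)
Lemma xcos_le_plength p q :
  ((`|xcos (psi 1 p) (psi 1 q) - xcos (psi 0 p) (psi 0 q)|)%:E <= plength om2 g2 nB2 mu2 0 psi)%E.
Proof.
have [e e0 ps] := path_interval hp.
pose I : set R := `]- e, 1 + e[%classic.
have oI : open I by exact: interval_open.
have oI' : open (I : set R^o) by exact: interval_open.
have sI t : 0 <= t <= 1 -> I t.
  by move=> /andP[? ?]; rewrite /I /= in_itv/=; apply/andP; split; lra.
pose C t := xcos (psi t p) (psi t q).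
have Cs k : Ck k (I : set R^o) (C : R^o -> R).
  apply: (Ck_add oI'); apply: (Ck_mul oI').
  - exact: (curve_Ck oI ps (cs_smooth i0)).
  - exact: (curve_Ck oI ps (cs_smooth i0)).
  - exact: (curve_Ck oI ps (sn_smooth i0)).
  - exact: (curve_Ck oI ps (sn_smooth i0)).
pose C' : R -> R := 'D_(1 : R^o) (C : R^o -> R^o).
have dC t : I t -> is_derive t (1 : R) (C : R -> R^o) (C' t).
  by move=> It; apply: DeriveDef => //; exact: (Ck_derivable (Cs 1%N) It).
have C'c t : I t -> {for t, continuous C'}.
  by move=> It; exact: (Ck_cont (Ck_D (1 : R^o) (Cs 1%N)) It).
have wc : {within `[0, 1], continuous C'}.
  by apply: continuous_in_subspaceT => t /set_mem; rewrite /= in_itv/= => t01; apply: C'c; exact: sI.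
have FTC : (\int[leb]_(t in `[0%R, 1%R]) (C' t)%:E = (C 1)%:E - (C 0)%:E)%E.
  apply: continuous_FTC2 => //.
  - split.
    + by move=> t; rewrite in_itv/= => /andP[t0 t1]; have [] := dC t (sI t ltac:(by rewrite !ltW)).
    + by apply: cvg_at_right_filter; apply: is_derive_continuous (dC 0 (sI 0 _)); rewrite lexx ler01.
    + by apply: cvg_at_left_filter; apply: is_derive_continuous (dC 1 (sI 1 _)); rewrite lexx ler01.
  - move=> t; rewrite in_itv/= => /andP[t0 t1]; rewrite derive1E.
    by have [_ ->] := dC t (sI t ltac:(by rewrite !ltW)).
have iC : leb.-integrable `[0, 1] (EFin \o C').
  by apply: continuous_compact_integrable => //; exact: segment_compact.
have -> : (`|xcos (psi 1 p) (psi 1 q) - xcos (psi 0 p) (psi 0 q)|)%:E =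
    (`| \int[leb]_(t in `[0%R, 1%R]) (C' t)%:E |)%E by rewrite FTC.
apply: le_trans (le_abse_integral _ _ _) _.
- exact: measurable_itv.
- by case/integrableP: iC.
rewrite plengthE integral_endpoints.
apply: ge0_le_integral_nonmeasurable => t; rewrite /= in_itv/= => t01; first by rewrite lee_fin.
have t01' : 0 <= t <= 1 by case/andP: t01 => ? ?; rewrite !ltW.
have It := sI t t01'.
rewrite lee_fin nmu_xspeed//.
have dA r := is_derive_curve oI ps (cs_smooth i0) r It.
have dB r := is_derive_curve oI ps (sn_smooth i0) r It.
have dd := is_derive_addp (is_derive_mulp (dA p) (dA q)) (is_derive_mulp (dB p) (dB q)).
have [_ ddE] := dd; have C'E : C' t = _ := ddE; rewrite C'E.
have orth r : cs (psi t r) i0 * dcurve psi (fun p : T => cs p i0) t r +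
    sn (psi t r) i0 * dcurve psi (fun p : T => sn p i0) t r = 0.
  have := is_derive_addp (is_derive_mulp (dA r) (dA r)) (is_derive_mulp (dB r) (dB r)).
  have -> : (fun s : R => cs (psi s r) i0 * cs (psi s r) i0 + sn (psi s r) i0 * sn (psi s r) i0) = fun=> 1.
    by apply/funext => s; rewrite -!expr2 cs2sn2.
  by move=> [_]; rewrite derive_cst; lra.
apply: le_trans (cos_difference_speed (cs2sn2 _ _) (cs2sn2 _ _) (orth p) (orth q)) _.
rewrite -/(xspeed psi t p) -/(xspeed psi t q).
have h1 := xspeed_le_osc hp p q t01'; have h2 := xspeed_le_osc hp q p t01'.
by rewrite ler_norml; apply/andP; split; lra.
Qed.

End Path.
End LowerBound.

(** * Failure of right-invariance *)

Section Counterexample.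
Context {R : realType}.
Local Notation T := (torusM R 2).
Local Notation i0 := (ord0 : 'I_2).
Local Notation i1 := (ord_max : 'I_2).
Implicit Types (p q : T).

Let u0 : R -> R := fun=> 0.
Let u1 (y : R) : R := pi / 4 * sin y.

Let u0_smooth : smooth_on (E := R^o) setT u0.
Proof. move=> k; exact: Ck_cst. Qed.

Let u1_smooth : smooth_on (E := R^o) setT u1.
Proof.
move=> k; have oT : open (setT : set R^o) by exact: openT.
apply: (Ck_mul oT); first exact: Ck_cst.
by apply: (Ck_sin oT); exact: Ck_id.
Qed.

Let u0_per (x y : R) : cos x = cos y -> sin x = sin y -> u0 x = u0 y.
Proof. by []. Qed.

Let u1_per (x y : R) : cos x = cos y -> sin x = sin y -> u1 x = u1 y.
Proof. by rewrite /u1 => _ ->. Qed.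

Let u0_cst (x t : R) : u0 (x + t * pi) = u0 x.
Proof. by []. Qed.

Let u1_cst (x t : R) : u1 (x + t * 0) = u1 x.
Proof. by rewrite mulr0 addr0. Qed.

Let half_turn : T -> T := shear u0 pi 1.
Let xshear : T -> T := shear u1 0 1.

Let d := dist_id (@om2 R) (@g2 R) (@nB2 R) (@mu2 R) 0.

(** The half turn is reached without any motion in the direction x. *)
Lemma dist_id_half_turn : d half_turn = 0%E.
Proof.
have hp := shear_path u0_smooth u0_per u0_cst.
apply/eqP; rewrite eq_le; apply/andP; split; last first.
  exact: (dist_id_ge0 _ (@symplectic_om2 R) (@norm_nB2 R) (@closed_to_exact_mu2 R) (lexx 0)).
apply: (@le_trans _ _ (plength (@om2 R) g2 nB2 mu2 0 (shear u0 pi))).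
  by apply: ereal_inf_lbound; exists (shear u0 pi).
rewrite plengthE integral0_eq// => t; rewrite /= in_itv/= => t01.
rewrite (nmu_xspeed hp t01).
have x0 q : xspeed (shear u0 pi) t q = 0.
  have [z <-] := tpi_surj q.
  have cE s i : i = i0 -> cs (shear u0 pi s (tpi z) : T) i = cos (z 0 i0) /\ sn (shear u0 pi s (tpi z) : T) i = sin (z 0 i0).
    by move=> ->; rewrite (shear_tpi pi u0_per) cs_tpi sn_tpi !mxE eqxx /u0 mulr0 addr0.
  rewrite /xspeed /dcurve.
  rewrite (_ : (fun s : R => cs (shear u0 pi s (tpi z)) i0) = fun=> cos (z 0 i0)); last first.
    by apply/funext => s; have [-> _] := cE s i0 erefl.
  rewrite (_ : (fun s : R => sn (shear u0 pi s (tpi z)) i0) = fun=> sin (z 0 i0)); last first.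
    by apply/funext => s; have [_ ->] := cE s i0 erefl.
  by rewrite !derive1_cst !mul0r subrr.
congr (_%:E); apply/eqP; rewrite eq_le; apply/andP; split.
  by apply: (osc_le (tpi 0)) => p q; rewrite !x0 subrr.
by apply: (osc_xspeed_ge0 hp); case/andP: t01 => ? ?; rewrite !ltW.
Qed.

Let g : T -> T := minv (id \o xshear) \o (half_turn \o xshear).

(** The factor pi/4 doubles because sin (y + pi) = - sin y. *)
Lemma conjugate_tpi z : g (tpi z) = tpi (\row_i (if i == i0 then z 0 i0 + pi / 2 * sin (z 0 i1) else z 0 i1 + pi)).
Proof.
rewrite /g /= /half_turn /xshear (minv_shear u1_per u1_cst).
rewrite (shear_tpi 0 u1_per) (shear_tpi pi u0_per) (shear_tpi 0 u1_per); congr tpi.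
apply: rV2_eq; rewrite !mxE /= /u0 /u1 ?mulr0 ?addr0 ?mul1r ?sinDpi; last by ring.
by field.
Qed.

(** The points (0, pi/2) and (0, 0) have the same angle x at the beginning, and angles
x that differ by pi/2 at the end. *)
Lemma dist_id_conjugate : (1 <= d g)%E.
Proof.
apply: le_ereal_inf_tmp => _ [psi [hp psi1] <-].
have [p0 _ _] := hp.
pose z : 'rV[R]_2 := \row_i (if i == i0 then 0 else pi / 2).
have := xcos_le_plength hp (tpi z) (tpi 0).
have -> : xcos (psi 1 (tpi z)) (psi 1 (tpi 0)) = 0.
  rewrite psi1 !conjugate_tpi /xcos !cs_tpi !sn_tpi !mxE /= sin_pihalf sin0 mulr1 mulr0 !add0r.
  by rewrite cos_pihalf sin0 mul0r mulr0 addr0.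
have -> : xcos (psi 0 (tpi z)) (psi 0 (tpi 0)) = 1.
  by rewrite p0 /xcos !cs_tpi !sn_tpi !mxE /= cos0 sin0 mulr1 mulr0 addr0.
by rewrite sub0r normrN1.
Qed.

(** Compare d(id, phi) with d(h, phi h), for phi the half turn and h the shear. *)
Lemma not_right_invariant :
  ~ right_invariant (Symp0 (@om2 R)) (dist (@om2 R) (@g2 R) (@nB2 R) (@mu2 R) 0).
Proof.
move=> ri.
have sid : Symp0 (@om2 R) id.
  by exists (fun=> id) => //; exact: constant_path.
have sh : Symp0 (@om2 R) half_turn := shear_Symp0 u0_smooth u0_per u0_cst.
have sx : Symp0 (@om2 R) xshear := shear_Symp0 u1_smooth u1_per u1_cst.
have := ri xshear id half_turn sx sid sh; rewrite /dist.
have -> : minv (@id T) = id by exact: minv_eq.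
rewrite -/d -[minv (id \o xshear) \o _]/g -[id \o half_turn]/half_turn dist_id_half_turn => g0.
by have := dist_id_conjugate; rewrite g0 lee_fin ler10.
Qed.

End Counterexample.

(** * Pseudo-distance, left-invariance, symmetry, and failure of right-invariance *)

Theorem proposition2p3 (R : realType) :
  (forall (n : nat) (M : closedManifold R n) (omega g : tensor2 M)
      (nB : form1 M -> R) (mu : form1 M -> form1 M) (c : R),
    symplectic_form omega -> riemannian_metric g ->
    norm_on (exact_forms M) nB -> closed_to_exact mu -> 0 <= c ->
    let S := Symp0 omega in
    let d := dist omega g nB mu c in
    let ds := sdist omega g nB mu c in
    [/\ (* (1) *)
        [/\ forall phi psi, S phi -> S psi -> (0 <= d phi psi)%E,
            forall phi1 phi2 phi3, S phi1 -> S phi2 -> S phi3 ->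
              (d phi1 phi3 <= d phi1 phi2 + d phi2 phi3)%E,
            pseudo_distance S ds
          & lengths_defined omega g nB mu c ->
              forall phi psi, S phi -> S psi ->
                d phi psi \is a fin_num /\ ds phi psi \is a fin_num],
        (* (2), left-invariance *)
        left_invariant S d
      & (* (3) *)
        c = 0 ->
        (forall alpha phi, closed_forms M alpha -> S phi ->
           nB (mu alpha) = nB (mu (pullback phi alpha))) ->
        forall phi psi, S phi -> S psi ->
          d phi psi = d psi phi /\ d phi psi = ds phi psi]) /\
  (* (2), failure of right-invariance *)
  (exists (n : nat) (M : closedManifold R n) (omega g : tensor2 M)
      (nB : form1 M -> R) (mu : form1 M -> form1 M) (c : R),
    [/\ symplectic_form omega, riemannian_metric g,
        norm_on (exact_forms M) nB, closed_to_exact mu & 0 <= c] /\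
    lengths_defined omega g nB mu c /\
    ~ right_invariant (Symp0 omega) (dist omega g nB mu c)).
Proof.
split.
- move=> n M omega g nB mu c so sg hnB hmu c0 S d ds.
  have d0 phi psi : (0 <= d phi psi)%E by exact: (dist_id_ge0 g so hnB hmu c0).
  have tri phi1 phi2 phi3 : S phi2 -> (d phi1 phi3 <= d phi1 phi2 + d phi2 phi3)%E.
    by move=> S2; exact: (dist_triangle g so hnB hmu c0 phi1 phi3 S2).
  have sym phi psi : S phi -> S psi -> d phi psi = d psi phi.
    by move=> Sf Sp; exact: (dist_sym g so hnB hmu c0 Sf Sp).
  have dsE phi psi : S phi -> S psi -> ds phi psi = d phi psi.
    by move=> Sf Sp; exact: (sdistE g so hnB hmu c0 Sf Sp).
  split; [split| |] => //.
  + by move=> phi1 phi2 phi3 _ S2 _; exact: tri.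
  + split.
    * by move=> x y Sx Sy; rewrite dsE.
    * move=> x Sx; rewrite dsE// /d /dist.
      have -> : minv x \o x = id by apply/funext => p; rewrite /= minvK//; exact: Symp0_bij Sx.
      exact: (dist_id_id g so hnB hmu c0).
    * by move=> x y Sx Sy; rewrite !dsE// sym.
    * by move=> x y z Sx Sy Sz; rewrite !dsE//; exact: tri.
  + move=> ld phi psi Sf Sp; rewrite dsE//.
    by have f := dist_fin_num so hnB hmu c0 ld Sf Sp.
  + exact: dist_left_invariant.
  + by move=> _ _ phi psi Sf Sp; rewrite dsE//; split => //; exact: sym.
- exists 2%N, (torusM R 2), (@om2 R), (@g2 R), (@nB2 R), (@mu2 R), 0.
  split; first by split; [exact: symplectic_om2|exact: riemannian_g2|exact: norm_nB2|exact: closed_to_exact_mu2|exact: lexx].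
  split; first by move=> psi hp; exact: path_length_defined.
  exact: not_right_invariant.
Qed.
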